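(* (i) Assume the Axiom of Projective Determinacy (PD). Then every separable metric space which is projective and countable dense homogeneous (CDH) is completely metrizable. (ii) Assume the Axiom of Determinacy (AD). Then every countable dense homogeneous (CDH) separable metric space is completely metrizable.
   Context: A separable topological space $X$ is countable dense homogeneous (CDH) if for any two countable dense subsets $D, D' \subseteq X$ there is a homeomorphism $h : X \to X$ such that $h[D]=D'$. A separable metric space is projective if it is a projective subset of its completion. PD is the assertion that every projective subset of $\omega^\omega$ is determined; AD is the assertion that every subset of $\omega^\omega$ is determined (for the usual two-player infinite game on $\omega$). The background theory for (i) is ZFC; the background theory for (ii) is ZF together with the Axiom of Dependent Choice (DC). *)

(* Defs.v *)
From HB Require Import structures.
From mathcomp Require Import all_boot all_order all_algebra.
From mathcomp Require Import all_classical all_reals all_analysis.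

Set Implicit Arguments.
Unset Strict Implicit.
Unset Printing Implicit Defensive.

Import Order.TTheory GRing.Theory Num.Theory.

(* The two parts of the theorem have different background theories.

   The ambient logic, with excluded middle and choice, plays the role of ZFC;
   the notions of the first half of the file are the ordinary ones.

   A theorem of ZF + DC under AD cannot be stated in that way, because AD
   contradicts the ambient axiom of choice and would be a false hypothesis.
   By the completeness theorem, being provable in ZF + DC + AD means holding in
   every first-order model of ZF + DC + AD.  The second half of the file
   (module ST) therefore interprets the same topological notions inside an
   arbitrary structure for the language of set theory. *)

Local Open Scope classical_set_scope.
Local Open Scope ring_scope.

Definition homeomorphism (X Y : topologicalType) (h : X -> Y) : Prop :=
  continuous h /\ exists g : Y -> X, [/\ continuous g, cancel h g & cancel g h].

Definition separable (X : topologicalType) : Prop :=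
  exists D : set X, countable D /\ dense D.

Definition countable_dense_homogeneous (X : topologicalType) : Prop :=
  separable X /\
  forall D D' : set X, countable D -> dense D -> countable D' -> dense D' ->
    exists h : X -> X, homeomorphism h /\ h @` D = D'.

Definition complete_space (X : uniformType) : Prop :=
  forall F : set_system X, ProperFilter F -> cauchy F -> exists x : X, F --> x.

Definition completely_metrizable (R : realType) (X : topologicalType) : Prop :=
  exists d : X -> X -> R,
    [/\ forall x y, d x y = 0 <-> x = y,
        forall x y, d x y = d y x,
        forall x y z, d x z <= d x y + d y z,
        forall x, nbhs x =
          filter_from [set e : R | 0 < e] (fun e => [set y | d x y < e])
      & forall s : nat -> X,
          (forall e : R, 0 < e -> exists N : nat, forall m n : nat,
             (N <= m)%N -> (N <= n)%N -> d (s m) (s n) < e) ->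
          exists l : X, s @ \oo --> l].

Definition baire_space : topologicalType := prod_topology (fun _ : nat => nat).

(* [boldSigma1 n A] for n >= 1 is the boldface class Sigma^1_n of the
   projective hierarchy: a Sigma^1_1 set is the projection of a closed subset
   of T x omega^omega, and a Sigma^1_(n+1) set is the projection of a Pi^1_n
   subset of T x omega^omega.  The value n = 0 (open sets) only serves to start
   the recursion. *)
Fixpoint boldSigma1 (n : nat) (T : topologicalType) (A : set T) : Prop :=
  match n with
  | 0 => open A
  | n'.+1 => exists B : set (T * baire_space),
      @boldSigma1 n' (T * baire_space)%type (~` B) /\ A = fst @` B
  end.

Definition projective (T : topologicalType) (A : set T) : Prop :=
  exists n : nat, boldSigma1 n.+1 A.

Definition projective_metric_space (R : realType) (X : metricType R) : Prop :=
  exists (Y : metricType R) (i : X -> Y),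
    [/\ complete_space Y,
        forall x y, mdist (i x) (i y) = mdist x y,
        dense (range i)
      & projective (range i)].

(* A run of the game is x : nat -> nat; player I chooses x 0, x 2, ... and
   player II chooses x 1, x 3, ...  A strategy maps the sequence of all moves
   made so far to the next move. *)
Definition determined (A : set baire_space) : Prop :=
  (exists sigma : seq nat -> nat, forall x : baire_space,
     (forall n, ~~ odd n -> x n = sigma (mkseq x n)) -> A x) \/
  (exists tau : seq nat -> nat, forall x : baire_space,
     (forall n, odd n -> x n = tau (mkseq x n)) -> ~ A x).

Definition projective_determinacy : Prop :=
  forall A : set baire_space, projective A -> determined A.

Module ST.

Record structure := Structure {
  domain :> Type;
  mem : domain -> domain -> Prop }.

Notation "x '∈' y" := (mem x y) (at level 70, no associativity).

(* First-order formulas of the language of set theory, with de Bruijn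
   variables; they are only needed for the axiom schemas of ZF. *)
Inductive formula :=
  | FMem of nat & nat
  | FEq of nat & nat
  | FBot
  | FImp of formula & formula
  | FAll of formula.

Definition scons (T : Type) (x : T) (e : nat -> T) (n : nat) : T :=
  if n is n'.+1 then e n' else x.

Fixpoint sat (M : structure) (e : nat -> M) (f : formula) : Prop :=
  match f with
  | FMem i j => e i ∈ e j
  | FEq i j => e i = e j
  | FBot => False
  | FImp f1 f2 => sat e f1 -> sat e f2
  | FAll f1 => forall x : M, sat (scons x e) f1
  end.

Section Universe.
Context {M : structure}.
Implicit Types (a b e f p s w x y z A B D S U : M).

Definition sub A B : Prop := forall x, x ∈ A -> x ∈ B.

Definition is_empty e : Prop := forall x, ~ x ∈ e.

Definition inductive w : Prop :=
  (exists e, is_empty e /\ e ∈ w) /\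
  forall x, x ∈ w -> exists y, y ∈ w /\ forall z, z ∈ y <-> (z ∈ x \/ z = x).

Definition is_omega w : Prop := inductive w /\ forall v : M, inductive v -> sub w v.

(* Definite description, with an arbitrary default value [x0]; it is only
   applied below to objects which exist and are unique in any model of ZF. *)
Definition the (x0 : M) (P : M -> Prop) : M :=
  if pselect (exists x, P x) is left h then projT1 (cid h) else x0.

Definition set_of (x0 : M) (P : M -> Prop) : M :=
  the x0 (fun s => forall x, x ∈ s <-> P x).

Definition upair a b : M := set_of a (fun x => x = a \/ x = b).

Definition opair a b : M := upair (upair a a) (upair a b).

Definition succ a : M := set_of a (fun x => x ∈ a \/ x = a).

Definition prod A B : M :=
  set_of A (fun p => exists x y, [/\ x ∈ A, y ∈ B & p = opair x y]).

Definition is_fun f A B : Prop :=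
  sub f (prod A B) /\ forall x, x ∈ A -> exists! y, opair x y ∈ f.

Definition app f x : M := the f (fun y => opair x y ∈ f).

Definition image f A : M := set_of f (fun y => exists x, x ∈ A /\ y = app f x).

Definition restr f A : M :=
  set_of f (fun p => p ∈ f /\ exists x y, x ∈ A /\ p = opair x y).

Definition injective_on f A : Prop :=
  forall x y, x ∈ A -> y ∈ A -> app f x = app f y -> x = y.

Definition countable A : Prop :=
  exists w f, [/\ is_omega w, is_fun f A w & injective_on f A].

End Universe.

Record ZF (M : structure) : Prop := {
  extensionality : forall a b : M, (forall x, x ∈ a <-> x ∈ b) -> a = b;
  foundation : forall a : M, (exists x, x ∈ a) ->
    exists x, x ∈ a /\ forall y, y ∈ x -> ~ y ∈ a;
  pairing : forall a b : M, exists c, forall x, x ∈ c <-> (x = a \/ x = b);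
  union : forall a : M, exists c, forall x, x ∈ c <-> exists y, y ∈ a /\ x ∈ y;
  power_set : forall a : M, exists c, forall x, x ∈ c <-> sub x a;
  infinity : exists w : M, inductive w;
  separation : forall (f : formula) (e : nat -> M) (a : M),
    exists c, forall x, x ∈ c <-> (x ∈ a /\ sat (scons x e) f);
  replacement : forall (f : formula) (e : nat -> M) (a : M),
    (forall x y z, x ∈ a -> sat (scons x (scons y e)) f ->
       sat (scons x (scons z e)) f -> y = z) ->
    exists c, forall y,
      y ∈ c <-> exists x, x ∈ a /\ sat (scons x (scons y e)) f }.

Definition DC (M : structure) : Prop :=
  forall w A r : M, is_omega w -> (exists x, x ∈ A) ->
    (forall x, x ∈ A -> exists y, y ∈ A /\ opair x y ∈ r) ->
    exists f, is_fun f w A /\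
      forall n, n ∈ w -> opair (app f n) (app f (succ n)) ∈ r.

Section Games.
Context {M : structure}.
Implicit Types (n w x A : M).

Definition even n : Prop := forall S : M,
  (forall e, is_empty e -> e ∈ S) ->
  (forall k, k ∈ S -> succ (succ k) ∈ S) -> n ∈ S.

(* Natural numbers are von Neumann ordinals: n is the set of its predecessors,
   so that [restr x n] is the sequence of the first n terms of x. *)
Definition finite_sequences w : M :=
  set_of w (fun s => exists n, n ∈ w /\ is_fun s n w).

Definition determined w A : Prop :=
  (exists sigma, is_fun sigma (finite_sequences w) w /\
     forall x, is_fun x w w ->
       (forall n, n ∈ w -> even n -> app x n = app sigma (restr x n)) ->
       x ∈ A) \/
  (exists tau, is_fun tau (finite_sequences w) w /\
     forall x, is_fun x w w ->
       (forall n, n ∈ w -> ~ even n -> app x n = app tau (restr x n)) ->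
       ~ x ∈ A).

End Games.

Definition AD (M : structure) : Prop :=
  forall w A : M, is_omega w -> (forall x, x ∈ A -> is_fun x w w) ->
    determined w A.

(* The real line of M, specified (up to isomorphism in M) as a complete ordered
   field of M; suprema are only required for subsets which are elements of M. *)
Record real_line (M : structure) := RealLine {
  K : M;
  zero : M;
  one : M;
  addf : M;
  mulf : M;
  ltr : M;
  add := fun x y : M => app addf (opair x y);
  mul := fun x y : M => app mulf (opair x y);
  lt := fun x y : M => opair x y ∈ ltr;
  le := fun x y : M => lt x y \/ x = y;
  zeroK : zero ∈ K;
  oneK : one ∈ K;
  addf_fun : is_fun addf (prod K K) K;
  mulf_fun : is_fun mulf (prod K K) K;
  addA : forall x y z, x ∈ K -> y ∈ K -> z ∈ K ->
    add x (add y z) = add (add x y) z;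
  addC : forall x y, x ∈ K -> y ∈ K -> add x y = add y x;
  add0 : forall x, x ∈ K -> add zero x = x;
  addN : forall x, x ∈ K -> exists y, y ∈ K /\ add x y = zero;
  mulA : forall x y z, x ∈ K -> y ∈ K -> z ∈ K ->
    mul x (mul y z) = mul (mul x y) z;
  mulC : forall x y, x ∈ K -> y ∈ K -> mul x y = mul y x;
  mul1 : forall x, x ∈ K -> mul one x = x;
  mulV : forall x, x ∈ K -> x <> zero -> exists y, y ∈ K /\ mul x y = one;
  mulD : forall x y z, x ∈ K -> y ∈ K -> z ∈ K ->
    mul x (add y z) = add (mul x y) (mul x z);
  one_neq0 : one <> zero;
  lt_irr : forall x, x ∈ K -> ~ lt x x;
  lt_trans : forall x y z, x ∈ K -> y ∈ K -> z ∈ K ->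
    lt x y -> lt y z -> lt x z;
  lt_total : forall x y, x ∈ K -> y ∈ K -> [\/ lt x y, x = y | lt y x];
  lt_add : forall x y z, x ∈ K -> y ∈ K -> z ∈ K ->
    lt x y -> lt (add x z) (add y z);
  lt_mul : forall x y, x ∈ K -> y ∈ K ->
    lt zero x -> lt zero y -> lt zero (mul x y);
  lub : forall S, sub S K -> (exists x, x ∈ S) ->
    (exists b, b ∈ K /\ forall x, x ∈ S -> le x b) ->
    exists b, [/\ b ∈ K, forall x, x ∈ S -> le x b &
      forall c, c ∈ K -> (forall x, x ∈ S -> le x c) -> le b c] }.

Section MetricSpaces.
Context {M : structure} (R : real_line M).
Implicit Types (X d U D h s w : M).

Definition is_metric X d : Prop :=
  [/\ is_fun d (prod X X) (K R),
      forall x y, x ∈ X -> y ∈ X -> (app d (opair x y) = zero R <-> x = y),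
      forall x y, x ∈ X -> y ∈ X -> app d (opair x y) = app d (opair y x)
    & forall x y z, x ∈ X -> y ∈ X -> z ∈ X ->
        le R (app d (opair x z))
             (add R (app d (opair x y)) (app d (opair y z)))].

Definition is_open X d U : Prop :=
  sub U X /\
  forall x, x ∈ U -> exists r, [/\ r ∈ K R, lt R (zero R) r &
    forall y, y ∈ X -> lt R (app d (opair x y)) r -> y ∈ U].

Definition dense X d D : Prop :=
  sub D X /\
  forall U, is_open X d U -> (exists x, x ∈ U) -> exists x, x ∈ D /\ x ∈ U.

Definition separable X d : Prop := exists D, countable D /\ dense X d D.

Definition homeomorphism X d h : Prop :=
  [/\ is_fun h X X, injective_on h X, image h X = X
    & forall U, sub U X -> (is_open X d U <-> is_open X d (image h U))].

Definition countable_dense_homogeneous X d : Prop :=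
  separable X d /\
  forall D D', countable D -> dense X d D -> countable D' -> dense X d D' ->
    exists h, homeomorphism X d h /\ image h D = D'.

(* For natural numbers, [sub N m] is the order relation N <= m. *)
Definition complete X d : Prop :=
  forall w s, is_omega w -> is_fun s w X ->
    (forall r, r ∈ K R -> lt R (zero R) r -> exists N, N ∈ w /\
       forall m n, m ∈ w -> n ∈ w -> sub N m -> sub N n ->
         lt R (app d (opair (app s m) (app s n))) r) ->
    exists l, l ∈ X /\
      forall r, r ∈ K R -> lt R (zero R) r -> exists N, N ∈ w /\
        forall n, n ∈ w -> sub N n -> lt R (app d (opair (app s n) l)) r.

Definition completely_metrizable X d : Prop :=
  exists d', [/\ is_metric X d',
    forall U, is_open X d U <-> is_open X d' U & complete X d'].

End MetricSpaces.

End ST.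

(* Main.v *)
Require Import Defs.
From HB Require Import structures.
From mathcomp Require Import all_boot all_order all_algebra.
From mathcomp Require Import all_classical all_reals all_analysis.
From mathcomp Require Import ring lra.

(** Why the theorem is true.  Let X be a separable metric space which is CDH.  Points
    of the completion are represented by nested sequences of coded balls, and three
    games are played in which a run produces such a sequence; the winner depends on
    whether the balls have a common point in X.  Determinacy of these games suffices.

    - Perfect set game on the meager part.  If the player who chooses between two
      meager balls wins, the meager part of X is countable
      ([locally_meager_countable]), and CDH excludes this as soon as it has a point
      ([locally_meager_uncountable]).  If the other player wins, there is a perfect
      set of locally meager points; CDH moves a dense set that meets every nowhere
      dense closed set of a given sequence in a finite set to a dense set through
      many points of the perfect set, and a fusion argument gives a contradiction
      ([perfect_set_absurd]).  So no ball of X is meager.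
    - Banach-Mazur game.  If player I wins, the first ball of player I is meager
      ([meager_sigma0]).  So player II wins, and there is a dense sequence of points
      around which player II can be followed ([generic_sequence]).
    - Wadge game between X, as a subset of its completion, and the set Q of the
      sequences that are eventually zero.  If player I wins, Q is the preimage of X
      under a continuous map into the completion; CDH moves the sequence of the
      previous step onto the countable image of Q, and the strategy of player II in
      the Banach-Mazur game produces a point of X that comes from a sequence outside
      Q ([wadge_absurd]).  If player II wins, a nested sequence of balls has a common
      point in X exactly when infinitely many answers of player II are nonzero
      ([wadge_run]); so X is a G-delta set in its completion, and a complete metric
      is obtained by making the reciprocals of suitable distance functions uniformly
      continuous ([wadge_complete]).

    The argument uses dependent choice, but no further choice.  It is therefore
    carried out in a [frame], which specifies the definable predicates and functions
    that a universe contains; all constructions are shown to be definable, and the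
    result is [cdh_completely_metrizable].

    For part (ii), a model of ZF + DC is a frame, whose definable predicates are those
    that are given by sets of the model; the axiom AD of the model determines the
    three games since their payoffs are definable ([model_determined]).

    For part (i), the ambient logic is a frame in which everything is definable, and
    the payoffs have to be projective.  They are built from conditions on finitely
    many moves by number quantifiers, except for the existence of a common point in
    X.  This one is expressed by a quantifier over names of points of a completion Y
    in which X is projective: the names form the Baire space, decoding is continuous,
    and every point of X has a name ([common_point_decode], [EP_common_point]). *)

Set Implicit Arguments.
Unset Strict Implicit.
Unset Printing Implicit Defensive.

Module Definability.
Import Order.TTheory GRing.Theory Num.Theory.
Local Open Scope ring_scope.

(** * Definability frames *)

(** A universe of definable predicates and functions inside the ambient logic.
    A frame may be thought of as a model of higher-order arithmetic with a real line:
    [sort] tells which types exist in it, quantification over power and function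
    sorts is allowed in definitions, and induction, dependent choice and suprema
    are only available for definable data. *)
Record frame := Frame {
  sort : Type -> Type;
  definable : forall T, sort T -> (T -> Prop) -> Prop;
  prod_sort : forall A B, sort A -> sort B -> sort (A * B)%type;
  dfun := fun A B (sA : sort A) (sB : sort B) (f : A -> B) =>
    definable (prod_sort sA sB) (fun p => p.2 = f p.1);
  def_bot : forall A (sA : sort A), definable sA (fun _ => False);
  def_imp : forall A (sA : sort A) (P Q : A -> Prop),
    definable sA P -> definable sA Q -> definable sA (fun a => P a -> Q a);
  def_all : forall A B (sA : sort A) (sB : sort B) (P : A -> B -> Prop),
    definable (prod_sort sA sB) (fun p => P p.1 p.2) ->
    definable sA (fun a => forall b, P a b);
  def_eq : forall A (sA : sort A),
    definable (prod_sort sA sA) (fun p => p.1 = p.2);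
  def_comp : forall A B (sA : sort A) (sB : sort B) (f : A -> B) (P : B -> Prop),
    dfun sA sB f -> definable sB P -> definable sA (fun a => P (f a));
  dfun_comp : forall A B C (sA : sort A) (sB : sort B) (sC : sort C)
      (f : A -> B) (g : B -> C),
    dfun sA sB f -> dfun sB sC g -> dfun sA sC (fun a => g (f a));
  dfun_fst : forall A B (sA : sort A) (sB : sort B),
    dfun (prod_sort sA sB) sA fst;
  dfun_snd : forall A B (sA : sort A) (sB : sort B),
    dfun (prod_sort sA sB) sB snd;
  dfun_pair : forall A B C (sA : sort A) (sB : sort B) (sC : sort C)
      (f : C -> A) (g : C -> B),
    dfun sC sA f -> dfun sC sB g ->
    dfun sC (prod_sort sA sB) (fun c => (f c, g c));
  dfun_cst : forall A B (sA : sort A) (sB : sort B) (b : B),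
    dfun sA sB (fun _ => b);
  pow_sort : forall A (sA : sort A), sort {P : A -> Prop | definable sA P};
  def_mem : forall A (sA : sort A),
    definable (prod_sort sA (pow_sort sA)) (fun p => sval p.2 p.1);
  fun_sort : forall A B (sA : sort A) (sB : sort B),
    sort {f : A -> B | dfun sA sB f};
  dfun_app : forall A B (sA : sort A) (sB : sort B),
    dfun (prod_sort (fun_sort sA sB) sA) sB (fun p => sval p.1 p.2);
  N : Type;
  N_sort : sort N;
  O : N;
  S : N -> N;
  ltN : N -> N -> Prop;
  dfun_S : dfun N_sort N_sort S;
  def_ltN : definable (prod_sort N_sort N_sort) (fun p => ltN p.1 p.2);
  nat_ind : forall P : N -> Prop, definable N_sort P ->
    P O -> (forall n, P n -> P (S n)) -> forall n, P n;
  ltN0 : forall n, ~ ltN n O;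
  ltNS : forall n m, ltN n (S m) <-> ltN n m \/ n = m;
  dc : forall A (sA : sort A) (P : A -> Prop) (R : A -> A -> Prop),
    definable sA P -> definable (prod_sort sA sA) (fun p => R p.1 p.2) ->
    (exists x, P x) -> (forall x, P x -> exists2 y, P y & R x y) ->
    exists2 f : N -> A, dfun N_sort sA f &
      forall n, P (f n) /\ R (f n) (f (S n));
  K : realFieldType;
  K_sort : sort K;
  dfun_add : dfun (prod_sort K_sort K_sort) K_sort (fun p => p.1 + p.2);
  dfun_mul : dfun (prod_sort K_sort K_sort) K_sort (fun p => p.1 * p.2);
  def_lt : definable (prod_sort K_sort K_sort) (fun p => p.1 < p.2);
  lub : forall P : K -> Prop, definable K_sort P -> (exists x, P x) ->
    (exists b, forall x, P x -> x <= b) ->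
    exists2 b, forall x, P x -> x <= b &
      forall c, (forall x, P x -> x <= c) -> b <= c }.

Existing Class sort.
#[global] Hint Mode sort - ! : typeclass_instances.
Arguments definable {f0 T} _ _.
#[global] Existing Instances prod_sort pow_sort fun_sort N_sort K_sort.
Arguments O {f0}. Arguments S {f0} _. Arguments ltN {f0} _ _.

Section Frame.
Context {fr : frame}.
Implicit Types A B C : Type.

Definition Def A {sA : sort fr A} (P : A -> Prop) := definable sA P.
Definition Dfun A B {sA : sort fr A} {sB : sort fr B} (f : A -> B) :=
  Def (fun p : A * B => p.2 = f p.1).

(** Functions and predicates of the frame, as opposed to those of the ambient
    logic; statements that quantify over them are again definable. *)
Definition Fn A B {sA : sort fr A} {sB : sort fr B} := {f : A -> B | Dfun f}.
Definition Pw A {sA : sort fr A} := {P : A -> Prop | Def P}.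
Arguments Fn : clear implicits.
Arguments Fn A B {sA sB}.
Arguments Pw : clear implicits.
Arguments Pw A {sA}.
Definition fapp A B {sA : sort fr A} {sB : sort fr B} (f : Fn A B) (x : A) : B :=
  sval f x.
Definition elt A {sA : sort fr A} (x : A) (P : Pw A) : Prop := sval P x.
End Frame.
Coercion fapp : Fn >-> Funclass.
Arguments Fn {fr} A B {sA sB}.
Arguments Pw {fr} A {sA}.

Section FrameTheory.
Context {fr : frame}.
Implicit Types A B C : Type.
Notation N := (N fr).
Notation K := (K fr).

#[global] Instance Fn_sort A B (sA : sort fr A) (sB : sort fr B) :
  sort fr (Fn A B) := fun_sort sA sB.
#[global] Instance Pw_sort A (sA : sort fr A) : sort fr (Pw A) := pow_sort sA.

Lemma Def_iff A (sA : sort fr A) (P Q : A -> Prop) :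
  (forall a, P a <-> Q a) -> Def P -> Def Q.
Proof. by move=> PQ; rewrite (_ : P = Q)//; apply/funext => a; apply/propext. Qed.

Section Rules.
Context A B C (sA : sort fr A) (sB : sort fr B) (sC : sort fr C).
Implicit Types P Q : A -> Prop.

Lemma Def_False : Def (fun _ : A => False).
Proof. exact: def_bot. Qed.

Lemma Def_imp P Q : Def P -> Def Q -> Def (fun a => P a -> Q a).
Proof. exact: def_imp. Qed.

Lemma Def_not P : Def P -> Def (fun a => ~ P a).
Proof. by move=> h; apply: Def_imp => //; apply: Def_False. Qed.

Lemma Def_cst (p : Prop) : Def (fun _ : A => p).
Proof.
case: (pselect p) => hp.
  by apply: (Def_iff _ (Def_not Def_False)) => a; split => [_|_ []].
by apply: (Def_iff _ Def_False) => a; split => [[]|/hp].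
Qed.

Lemma Def_or P Q : Def P -> Def Q -> Def (fun a => P a \/ Q a).
Proof.
move=> hP hQ; apply: (Def_iff _ (Def_imp (Def_not hP) hQ)) => a; split.
  by case: (pselect (P a)); [left | right; auto].
by case.
Qed.

Lemma Def_and P Q : Def P -> Def Q -> Def (fun a => P a /\ Q a).
Proof.
move=> hP hQ; apply: (Def_iff _ (Def_not (Def_or (Def_not hP) (Def_not hQ)))).
move=> a; split; last by case=> ? ? [].
by move=> h; split; apply: contrapT => h'; apply: h; [left | right].
Qed.

Lemma Def_equiv P Q : Def P -> Def Q -> Def (fun a => P a <-> Q a).
Proof. by move=> hP hQ; apply: Def_and; apply: Def_imp. Qed.

Lemma Def_all (P : A -> B -> Prop) :
  Def (fun p => P p.1 p.2) -> Def (fun a => forall b, P a b).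
Proof. exact: def_all. Qed.

Lemma Def_ex (P : A -> B -> Prop) :
  Def (fun p => P p.1 p.2) -> Def (fun a => exists b, P a b).
Proof.
move=> h; have h' : Def (fun p : A * B => ~ P p.1 p.2).
  exact: def_imp h (def_bot _).
apply: (Def_iff _ (Def_not (@Def_all (fun a b => ~ P a b) h'))) => a.
by split => [/existsNP [b /contrapT Pb]|[b Pb] /(_ b)]; first by exists b.
Qed.

Lemma Def_comp (f : A -> B) (P : B -> Prop) :
  Dfun f -> Def P -> Def (fun a => P (f a)).
Proof. exact: def_comp. Qed.

Lemma Dfun_fst : Dfun (@fst A B). Proof. exact: dfun_fst. Qed.
Lemma Dfun_snd : Dfun (@snd A B). Proof. exact: dfun_snd. Qed.
Lemma Dfun_cst (b : B) : Dfun (fun _ : A => b). Proof. exact: dfun_cst. Qed.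
Lemma Dfun_pair (f : C -> A) (g : C -> B) :
  Dfun f -> Dfun g -> Dfun (fun c => (f c, g c)).
Proof. exact: dfun_pair. Qed.
End Rules.

Section CompositionRules.
Context A B C (sA : sort fr A) (sB : sort fr B) (sC : sort fr C).

Lemma Dfun_id : Dfun (@id A).
Proof.
apply: (Def_iff _ (def_eq _)) => p; split => /esym //.
Qed.

Lemma Dfun_comp (f : A -> B) (g : B -> C) :
  Dfun f -> Dfun g -> Dfun (fun a => g (f a)).
Proof. exact: dfun_comp. Qed.
End CompositionRules.

Section BinaryRules.
Context A B C D (sA : sort fr A) (sB : sort fr B) (sC : sort fr C)
  (sD : sort fr D).

Lemma Def_eq (f g : A -> B) : Dfun f -> Dfun g -> Def (fun a => f a = g a).
Proof.
move=> hf hg; apply: (Def_comp (Dfun_pair hf hg) (P := fun p => p.1 = p.2)).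
exact: def_eq.
Qed.

Lemma Def_mem (f : A -> B) (g : A -> Pw B) :
  Dfun f -> Dfun g -> Def (fun a => elt (f a) (g a)).
Proof.
move=> hf hg.
by apply: (Def_comp (Dfun_pair hf hg) (P := fun p => elt p.1 p.2)); apply: def_mem.
Qed.

Lemma Dfun_app (f : A -> Fn B C) (g : A -> B) :
  Dfun f -> Dfun g -> Dfun (fun a => f a (g a)).
Proof.
move=> hf hg.
by apply: (Dfun_comp (Dfun_pair hf hg) (g := fun p => fapp p.1 p.2)); apply: dfun_app.
Qed.

Lemma Dfun_fst1 (f : A -> B * C) : Dfun f -> Dfun (fun a => (f a).1).
Proof. by move=> hf; apply: Dfun_comp hf (Dfun_fst _ _). Qed.
Lemma Dfun_snd1 (f : A -> B * C) : Dfun f -> Dfun (fun a => (f a).2).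
Proof. by move=> hf; apply: Dfun_comp hf (Dfun_snd _ _). Qed.

Lemma Dfun_comp2 (o : B -> C -> D) (f : A -> B) (g : A -> C) :
  Dfun (fun p => o p.1 p.2) -> Dfun f -> Dfun g -> Dfun (fun a => o (f a) (g a)).
Proof.
by move=> ho hf hg; apply: (Dfun_comp (Dfun_pair hf hg) (g := fun p => o p.1 p.2)).
Qed.
Lemma Def_comp2 (P : B -> C -> Prop) (f : A -> B) (g : A -> C) :
  Def (fun p => P p.1 p.2) -> Dfun f -> Dfun g -> Def (fun a => P (f a) (g a)).
Proof.
by move=> ho hf hg; apply: (Def_comp (Dfun_pair hf hg) (P := fun p => P p.1 p.2)).
Qed.
End BinaryRules.

Section NumberRules.
Context A (sA : sort fr A).
Lemma Dfun_S (f : A -> N) : Dfun f -> Dfun (fun a => S (f a)).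
Proof. by move=> hf; apply: Dfun_comp hf (dfun_S fr). Qed.
Lemma Def_ltN (f g : A -> N) : Dfun f -> Dfun g -> Def (fun a => ltN (f a) (g a)).
Proof. exact: (Def_comp2 (def_ltN fr)). Qed.
Lemma Def_lt (f g : A -> K) : Dfun f -> Dfun g -> Def (fun a => f a < g a).
Proof. exact: (Def_comp2 (P := fun x y : K => x < y) (def_lt fr)). Qed.
Lemma Dfun_add (f g : A -> K) : Dfun f -> Dfun g -> Dfun (fun a => f a + g a).
Proof. exact: (Dfun_comp2 (o := fun x y : K => x + y) (dfun_add fr)). Qed.
Lemma Dfun_mul (f g : A -> K) : Dfun f -> Dfun g -> Dfun (fun a => f a * g a).
Proof. exact: (Dfun_comp2 (o := fun x y : K => x * y) (dfun_mul fr)). Qed.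
Lemma Def_le (f g : A -> K) : Dfun f -> Dfun g -> Def (fun a => f a <= g a).
Proof.
move=> hf hg; apply: (Def_iff _ (Def_not (Def_lt hg hf))) => a.
by rewrite leNgt; split => [/negP //|/negP].
Qed.
End NumberRules.
Section OppositeRules.
Context A (sA : sort fr A).
Lemma Dfun_opp (f : A -> K) : Dfun f -> Dfun (fun a => - f a).
Proof.
move=> hf; have h : Def (fun p : A * K => p.2 + f p.1 = 0).
  apply: (@Def_eq _ _ _ _ (fun p : A * K => p.2 + f p.1) (fun=> 0)).
    apply: Dfun_add; first exact: Dfun_snd.
    exact: Dfun_comp (Dfun_fst _ _) hf.
  exact: Dfun_cst.
by apply: Def_iff h => p; split => [/eqP|->]; rewrite ?addNr // addr_eq0 => /eqP.
Qed.
End OppositeRules.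
End FrameTheory.

Section Preliminaries.
Context {fr : frame}.
Notation N := (N fr).
Definition leN (n m : N) := ltN n (S m).
Definition least (P : N -> Prop) (n : N) := P n /\ forall m, ltN m n -> ~ P m.
Definition mu (P : N -> Prop) : N :=
  if pselect (exists n, least P n) is left h then projT1 (cid h) else O.
Lemma Fn_Dfun A B (sA : sort fr A) (sB : sort fr B) (f : Fn A B) : Dfun f.
Proof. exact: (svalP f). Qed.

End Preliminaries.

Definition ite (A : Type) (P : Prop) (x y : A) : A := if pselect P then x else y.

Lemma iteT A (P : Prop) (x y : A) : P -> ite P x y = x.
Proof. by rewrite /ite; case: pselect. Qed.
Lemma iteF A (P : Prop) (x y : A) : ~ P -> ite P x y = y.
Proof. by rewrite /ite; case: pselect. Qed.

(** [def] proves that a predicate or function is definable by following its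
    syntax; [def_ext] is redefined whenever new definable notions appear. *)
Ltac def_ext := fail.
Ltac def_step :=
  cbv beta;
  match goal with
  | |- Def (fun _ => ?p) => apply Def_cst
  | h : Def ?P |- Def ?P => exact h
  | |- Def (fun a => _ <-> _) => apply Def_equiv
  | |- Def (fun a => _ /\ _) => apply Def_and
  | |- Def (fun a => _ \/ _) => apply Def_or
  | |- Def (fun a => ~ _) => apply Def_not
  | |- Def (fun a => @?P a -> @?Q a) => apply (@Def_imp _ _ _ P Q)
  | |- Def (fun a => forall _, _) => refine (Def_all _)
  | |- Def (fun a => exists _, _) => refine (Def_ex _)
  | |- Def (fun a => _ = _) => refine (Def_eq _ _)
  | |- Def (fun a => is_true (_ < _)) => apply Def_lt
  | |- Def (fun a => is_true (_ <= _)) => apply Def_le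
  | |- Def (fun a => ltN _ _) => apply Def_ltN
  | |- Def (fun a => leN _ _) => unfold leN
  | |- Def (fun a => elt _ _) => refine (Def_mem _ _)
  | |- Dfun (fun _ => ?b) => apply Dfun_cst
  | |- Dfun (fun a => a) => apply Dfun_id
  | |- Dfun fst => apply Dfun_fst
  | |- Dfun snd => apply Dfun_snd
  | h : Dfun ?f |- Dfun ?f => exact h
  | |- Dfun (fapp ?f) => apply Fn_Dfun
  | |- Dfun (fun a => (_, _)) => apply Dfun_pair
  | |- Dfun (fun a => fst _) => refine (Dfun_fst1 _)
  | |- Dfun (fun a => snd _) => refine (Dfun_snd1 _)
  | |- Dfun (fun a => fapp _ _) => refine (Dfun_app _ _)
  | |- Dfun (fun a => S _) => apply Dfun_S
  | |- Dfun (fun a => _ + _) => apply Dfun_add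
  | |- Dfun (fun a => _ * _) => apply Dfun_mul
  | |- Dfun (fun a => - _) => apply Dfun_opp
  | h : Def ?P |- Def (fun a => ?P (@?f a)) => refine (@Def_comp _ _ _ _ _ f P _ h)
  | h : Def (fun p => ?P p.1 p.2) |- Def (fun a => ?P (@?f a) (@?g a)) =>
      refine (@Def_comp2 _ _ _ _ _ _ _ P f g h _ _)
  | h : Dfun ?F |- Dfun (fun a => ?F (@?f a)) => refine (@Dfun_comp _ _ _ _ _ _ _ f F _ h)
  | h : Dfun (fun p => ?F p.1 p.2) |- Dfun (fun a => ?F (@?f a) (@?g a)) =>
      refine (@Dfun_comp2 _ _ _ _ _ _ _ _ _ F f g h _ _)
  | |- Def ?P => lazymatch P with fun _ => _ => fail | _ => change (Def (fun a => P a)) end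
  | |- Dfun ?f => lazymatch f with fun _ => _ => fail | _ => change (Dfun (fun a => f a)) end
  | _ => def_ext
  end.
Ltac defs := repeat def_step.
Ltac def := solve [defs].
Section Constructors.
Context {fr : frame}.
Notation N := (N fr).

Definition mkFn A B (sA : sort fr A) (sB : sort fr B) (f : A -> B) (hf : Dfun f) :
  Fn A B := exist _ f hf.
Definition mkPw A (sA : sort fr A) (P : A -> Prop) (hP : Def P) : Pw A := exist _ P hP.

Lemma Fn_ext A B (sA : sort fr A) (sB : sort fr B) (f g : Fn A B) :
  (forall x, f x = g x) -> f = g.
Proof.
case: f g => f hf [g hg] fg; have e : f = g by apply: funext.
by move: hg fg; rewrite -e => hg _; congr exist; apply: Prop_irrelevance.
Qed.

Lemma indN (P : N -> Prop) :
  Def P -> P O -> (forall n, P n -> P (S n)) -> forall n, P n.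
Proof. exact: nat_ind. Qed.

Lemma weak_dc A (sA : sort fr A) (P : A -> Prop) (R : A -> A -> Prop) :
  Def P -> Def (fun p => R p.1 p.2) ->
  (exists x, P x) -> (forall x, P x -> exists2 y, P y & R x y) ->
  exists2 f : N -> A, Dfun f & forall n, P (f n) /\ R (f n) (f (S n)).
Proof. exact: dc. Qed.

Lemma lubK (P : K fr -> Prop) : Def P -> (exists x, P x) ->
  (exists b, forall x, P x -> x <= b) ->
  exists2 b, forall x, P x -> x <= b & forall c, (forall x, P x -> x <= c) -> b <= c.
Proof. exact: lub. Qed.

Lemma Dfun_ite A B (sA : sort fr A) (sB : sort fr B) (P : A -> Prop) (f g : A -> B) :
  Def P -> Dfun f -> Dfun g -> Dfun (fun a => ite (P a) (f a) (g a)).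
Proof.
move=> hP hf hg.
have h : Def (fun p : A * B => (P p.1 /\ p.2 = f p.1) \/ (~ P p.1 /\ p.2 = g p.1)).
  have hP1 : Def (fun p : A * B => P p.1) by def.
  have hf1 : Dfun (fun p : A * B => f p.1) by def.
  have hg1 : Dfun (fun p : A * B => g p.1) by def.
  def.
apply: Def_iff h => p; case: (pselect (P p.1)) => hp.
  by rewrite iteT //; split => [[[]|[]]|]//; left.
by rewrite iteF //; split => [[[]|[]]|]//; right.
Qed.

(** The graph of a function is often equivalent to a relation which is built from
    definable notions although the function itself is not. *)
Lemma Dfun_graph A B (sA : sort fr A) (sB : sort fr B) (f : A -> B)
    (R : A -> B -> Prop) :
  (forall a b, R a b <-> b = f a) -> Def (fun p => R p.1 p.2) -> Dfun f.
Proof. by move=> h; apply: Def_iff => p; apply: h. Qed.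

End Constructors.

Section NTheory.
Context {fr : frame}.
Notation N := (N fr).
Implicit Types n m k : N.

Lemma ltNSn n : ltN n (S n). Proof. by apply/ltNS; right. Qed.
Hint Resolve ltNSn : core.

Lemma ltN_trans n m k : ltN n m -> ltN m k -> ltN n k.
Proof.
move=> nm; move: k; apply: indN; first def; first by move/ltN0.
move=> k IH /ltNS [/IH h|<-]; apply/ltNS; by left.
Qed.

Lemma ltN_irr n : ~ ltN n n.
Proof.
move: n; apply: indN; first def; first exact: ltN0.
move=> n IH /ltNS [h|h]; apply: IH.
  exact: ltN_trans (ltNSn n) h.
by rewrite -{2}h.
Qed.

Lemma ltN0S n : ltN O (S n).
Proof.
by move: n; apply: indN; [def | | move=> n h; apply/ltNS; left].
Qed.

Lemma ltNSS n m : ltN n m -> ltN (S n) (S m).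
Proof.
move: m; apply: indN; first def; first by move/ltN0.
by move=> m IH /ltNS [/IH h|->]//; apply/ltNS; left.
Qed.

Lemma S_inj n m : S n = S m -> n = m.
Proof.
move=> h; have := ltNSn n; rewrite h => /ltNS [nm|//].
have := ltNSn m; rewrite -h => /ltNS [mn|//].
by case: (@ltN_irr n); exact: ltN_trans nm mn.
Qed.

Lemma S_neq0 n : S n <> O.
Proof. by move=> h; have := ltNSn n; rewrite h => /ltN0. Qed.

Lemma ltNSS_inv n m : ltN (S n) (S m) -> ltN n m.
Proof. by move=> /ltNS [h|<- //]; exact: ltN_trans (ltNSn n) h. Qed.

Lemma N_case n : n = O \/ exists m, n = S m.
Proof.
by move: n; apply: indN; [def | left | move=> n _; right; exists n].
Qed.

Lemma ltN_total n m : [\/ ltN n m, n = m | ltN m n].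
Proof.
suff: ltN n m \/ n = m \/ ltN m n by case=> [|[]]; by constructor.
move: m; apply: indN; first def.
  by case: (N_case n) => [->|[k ->]]; right; [left | right; exact: ltN0S].
move=> m [h|[->|h]]; first by left; apply/ltNS; left.
  by left.
case: (N_case n) h => [->|[k ->]]; first by move/ltN0.
by move=> /ltNS [|->]; [right; right; apply: ltNSS | right; left].
Qed.

Lemma leN_eqVlt n m : leN n m <-> ltN n m \/ n = m. Proof. exact: ltNS. Qed.
Lemma leNn n : leN n n. Proof. exact: ltNSn. Qed.
Lemma le0N n : leN O n. Proof. exact: ltN0S. Qed.
Lemma ltNW n m : ltN n m -> leN n m. Proof. by move=> h; apply/ltNS; left. Qed.
Lemma leN_ltN_trans n m k : leN n m -> ltN m k -> ltN n k.
Proof. by move=> /ltNS [h|-> //]; exact: ltN_trans. Qed.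
Lemma ltN_leN_trans n m k : ltN n m -> leN m k -> ltN n k.
Proof. by move=> h /ltNS [h'|<- //]; exact: ltN_trans h h'. Qed.
Lemma leN_trans n m k : leN n m -> leN m k -> leN n k.
Proof. exact: leN_ltN_trans. Qed.
Lemma leNNgt n m : leN n m <-> ~ ltN m n.
Proof.
split; first by move=> h /(leN_ltN_trans h) /ltN_irr.
by case: (ltN_total n m) => [/ltNW|->|]// _; exact: leNn.
Qed.
Lemma ex_leN2 n m : exists k, leN n k /\ leN m k.
Proof.
by case: (ltN_total n m) => [h|->|h]; [exists m|exists m|exists n]; split;
  by [exact: leNn | exact: ltNW].
Qed.

Lemma strong_indN (P : N -> Prop) : Def P ->
  (forall n, (forall m, ltN m n -> P m) -> P n) -> forall n, P n.
Proof.
move=> hP h.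
have H : forall n m, ltN m n -> P m.
  apply: indN.
  - have hP' : Def (fun p : N * N => P p.2) by def.
    by def.
  - by move=> m /ltN0.
  - by move=> n IH m /ltNS [/IH//|->]; apply: h.
by move=> n; apply: h => m; apply: H.
Qed.

Lemma least_uniq (P : N -> Prop) n m : least P n -> least P m -> n = m.
Proof.
move=> [Pn hn] [Pm hm]; case: (ltN_total n m) => // h.
  by case: (hm _ h).
by case: (hn _ h).
Qed.

Lemma ex_least (P : N -> Prop) : Def P -> (exists n, P n) -> exists n, least P n.
Proof.
move=> hP [n Pn]; apply: contrapT => h.
have : ~ P n; last by [].
move: n {Pn}; apply: strong_indN; first def.
by move=> n hn Pn; apply: h; exists n; split.
Qed.

Lemma muP (P : N -> Prop) : Def P -> (exists n, P n) -> P (mu P).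
Proof.
move=> hP hex; rewrite /mu; case: pselect => [h|]; last by case; exact: ex_least.
by case: cid => /= n [].
Qed.

Lemma mu_least (P : N -> Prop) : (exists n, least P n) -> least P (mu P).
Proof. by move=> h; rewrite /mu; case: pselect => // h'; case: cid. Qed.

Lemma Dfun_mu A (sA : sort fr A) (P : A -> N -> Prop) :
  Def (fun p => P p.1 p.2) -> Dfun (fun a => mu (P a)).
Proof.
move=> hP.
apply: (@Dfun_graph _ _ _ _ _ _ (fun a n => least (P a) n \/
   (~ (exists m, least (P a) m) /\ n = O))).
  move=> a n; split => [[h|[h ->]]|->].
  - by exact: (least_uniq h (mu_least (ex_intro _ n h))).
  - by rewrite /mu; case: pselect.
  - case: (pselect (exists m, least (P a) m)) => h.
      by left; apply: mu_least.
    by right; split => //; rewrite /mu; case: pselect.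
have h1 : Def (fun p : A * N => least (P p.1) p.2).
  rewrite /least; apply: Def_and => //; apply: Def_all; apply: Def_imp; first def.
  apply: Def_not; apply: (@Def_comp2 _ _ _ _ _ _ _ P) => //; def.
apply: Def_or => //; apply: Def_and; last def.
apply: Def_not; apply: Def_ex.
apply: (@Def_comp2 _ _ _ _ _ _ _ (fun a n => least (P a) n)) => //; def.
Qed.
End NTheory.
Ltac def_choice := match goal with
  | |- Dfun (fun a => ite _ _ _) => apply Dfun_ite
  | |- Dfun (fun a => mu (@?P a)) => apply (@Dfun_mu _ _ _ P)
  end.
Ltac def_ext ::= def_choice.
#[global] Hint Resolve ltNSn leNn le0N : core.

Section Choice.
Context {fr : frame}.
Notation N := (N fr).
Notation fn A B := (@Fn fr A B _ _).
Implicit Types n m k : N.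

(** The first term of a choice sequence of the frame is arbitrary.  It can be
    prescribed by choosing finite partial runs instead, which are represented as a
    length together with a total sequence that is only meaningful up to it. *)
Lemma dep_choice A (sA : sort fr A) (P : A -> Prop) (R : A -> A -> Prop) (x0 : A) :
  Def P -> Def (fun p => R p.1 p.2) -> P x0 ->
  (forall x, P x -> exists2 y, P y & R x y) ->
  exists2 f : fn N A, f O = x0 & forall n, P (f n) /\ R (f n) (f (S n)).
Proof.
move=> hP hR Px0 step.
(* as elements of power sorts, [P] and [R] are accepted by [def] *)
pose PP := mkPw hP; pose RR := mkPw hR.
pose (Q := fun (t : N * fn N A) => t.2 O = x0 /\ forall i, leN i t.1 -> elt (t.2 i) PP /\
  (ltN i t.1 -> elt (t.2 i, t.2 (S i)) RR)).
pose (E := fun (t t' : N * fn N A) => t'.1 = S t.1 /\ forall i, leN i t.1 -> t'.2 i = t.2 i).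
have [] := @weak_dc fr (N * fn N A)%type _ Q E.
- by rewrite /Q; def.
- by rewrite /E; def.
- exists (O, mkFn (Dfun_cst _ _ x0)); split => //= i _; split => // /ltN0 [].
- move=> [n s] /= [s0 hs].
  have [Psn _] := hs n (leNn n); have [y Py Ry] := step _ Psn.
  have hf : Dfun (fun i => ite (leN i n) (s i) y) by def.
  exists (S n, mkFn hf); last first.
    by split => //= i hi; rewrite iteT.
  split => /=; first by rewrite iteT.
  move=> i /leN_eqVlt [hi|->].
    split; first by rewrite iteT //; case: (hs i hi).
    move=> _; rewrite /elt /= iteT //.
    case: (pselect (ltN i n)) => hin.
      by rewrite iteT; [case: (hs i hi) => _; apply | exact: ltNSS].
    have -> : i = n by case/leN_eqVlt: hi.
    by rewrite iteF // => /ltN_irr.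
  split; last by move/ltN_irr.
  by rewrite iteF // => /ltN_irr.
move=> f hf hfn.
pose F : fn N (N * fn N A) := mkFn hf.
have ht : Dfun (fun i : N => (F i).2 i) by def.
have hlen : forall i, leN i (F i).1.
  apply: indN; first def; first by [].
  by move=> i IH; have [_ [-> _]] := hfn i; apply: ltNSS.
exists (mkFn ht) => /=; first by have [[]] := hfn O.
move=> n; split.
  by have [[_ h] _] := hfn n; have [] := h _ (hlen n).
have [_ [e1 e2]] := hfn n; have [[_ h] _] := hfn (S n).
rewrite -[X in R X](e2 n (hlen n)).
have hn1 : ltN n (F (S n)).1 by rewrite /= e1; exact: hlen n.
by have [_ /(_ hn1)] := h n (ltNW hn1).
Qed.

Lemma recursion A (sA : sort fr A) (x0 : A) (g : N * A -> A) : Dfun g ->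
  exists2 f : fn N A, f O = x0 & forall n, f (S n) = g (n, f n).
Proof.
move=> hg.
pose R (t t' : N * A) := t'.1 = S t.1 /\ t'.2 = mkFn hg t.
have [||||F F0 FS] := @dep_choice (N * A) _ (fun=> True) R (O, x0) => //.
- def.
- by rewrite /R; def.
- by move=> t _; exists (S t.1, g t).
have F1 : forall n, (F n).1 = n.
  apply: indN; first def; first by rewrite F0.
  by move=> n IH; have [_ [-> _]] := FS n; rewrite IH.
have hf : Dfun (fun n => (F n).2) by def.
exists (mkFn hf) => /=; first by rewrite /= F0.
move=> n; have [_ [_ e]] := FS n.
by rewrite [LHS]e -[X in g (X, _)](F1 n) -surjective_pairing.
Qed.

Lemma countable_choice A (sA : sort fr A) (R : N -> A -> Prop) :
  Def (fun p => R p.1 p.2) -> (forall n, exists x, R n x) ->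
  exists f : fn N A, forall n, R n (f n).
Proof.
move=> hR hex.
pose RR := mkPw hR.
have [x0 hx0] := hex O.
have [||||F F0 FS] := @dep_choice (N * A) _ (fun t => elt t RR)
    (fun t t' => t'.1 = S t.1) (O, x0) => //.
- def.
- by move=> [n x] /= _; have [y hy] := hex (S n); exists (S n, y).
have F1 : forall n, (F n).1 = n.
  apply: indN; first def; first by rewrite F0.
  by move=> n IH; have [_ ->] := FS n; rewrite IH.
have hf : Dfun (fun n => (F n).2) by def.
exists (mkFn hf) => n; have [] := FS n; rewrite /elt /= F1; done.
Qed.
End Choice.

End Definability.

Module Coding.
Import Order.TTheory GRing.Theory Num.Theory.
Import Definability.
Local Open Scope ring_scope.

(** * Coding of sequences and determinacy *)

Section Coding.
Context {fr : frame}.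
Notation N := (N fr).
Notation fn A B := (@Fn fr A B _ _).
Notation seqN := (fn N N).
Implicit Types n m k i j : N.

(** The inverse of the pairing enumerates the pairs along the antidiagonals, which can
    be done by recursion without any arithmetic. *)
Lemma ex_pairing : exists (pr : fn (N * N) N) (un : fn N (N * N)),
  forall p, un (pr p) = p.
Proof.
have [add add0 addS] : exists2 add : fn N (fn N N), forall i, add O i = i &
    forall j i, add (S j) i = S (add j i).
  pose (g := fun (t : N * seqN) => mkFn (Dfun_S (Fn_Dfun t.2)) : seqN).
  have hg : Dfun g.
    apply: (Dfun_graph (R := fun (t : N * seqN) (f : seqN) => forall i, f i = S (t.2 i))).
      move=> t f; split.
        by move=> h; apply: Fn_ext => i; rewrite h.
      by move=> h i; rewrite h.
    def.
  have [f f0 fS] := recursion (mkFn (Dfun_id _)) hg.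
  by exists f => [i|j i]; rewrite ?f0 ?fS.
have addSr i j : add j (S i) = S (add j i).
  move: j; apply: indN; first def; first by rewrite !add0.
  by move=> j IH; rewrite !addS IH.
have addr0 k : add k O = k.
  move: k; apply: indN; first def; first by rewrite add0.
  by move=> k IH; rewrite addS IH.
pose pred n := mu (fun m => S m = n).
have predK n : pred (S n) = n.
  by apply: S_inj; apply: (@muP _ (fun m => S m = S n)); [def | exists n].
have hpred : Dfun pred by rewrite /pred; def.
pose next (t : N * (N * N)) : N * N :=
  ite (t.2.1 = O) (S t.2.2, O) (mkFn hpred t.2.1, S t.2.2).
have hnext : Dfun next by rewrite /next; def.
have [e e0 eS] := recursion (O, O) hnext.
pose R (p : N * N) := exists n, e n = p.
have Rnext p n : R p -> R (next (n, p)).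
  by move=> [m mE]; exists (S m); rewrite eS mE /next.
have Rdown : forall j i, R (add j i, O) -> R (i, j).
  apply: indN; first by rewrite /R; def.
    by move=> i; rewrite add0.
  move=> j IH i h; have /(Rnext _ O) : R (S i, j).
    by apply: IH; rewrite addSr -addS.
  by rewrite /next /= iteF; [rewrite predK|exact: S_neq0].
have R0 : forall k, R (k, O).
  apply: indN; first by rewrite /R; def.
    by exists O.
  move=> k IH; have /(Rnext _ O) : R (O, k) by apply: Rdown; rewrite addr0.
  by rewrite /next /= iteT.
have hR p : exists n, e n = p by case: p => i j; exact: Rdown (R0 _).
have hp : Dfun (fun p => mu (fun n => e n = p)) by def.
exists (mkFn hp), e => p /=.
by apply: (@muP _ (fun n => e n = p)); [def | exact: hR].
Qed.

Definition pr : fn (N * N) N := projT1 (cid ex_pairing).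
Definition un : fn N (N * N) := projT1 (cid (projT2 (cid ex_pairing))).
Lemma prK p : un (pr p) = p.
Proof. exact: (projT2 (cid (projT2 (cid ex_pairing)))). Qed.

Definition predN n := mu (fun m => S m = n).
Lemma predNK n : predN (S n) = n.
Proof. by apply: S_inj; apply: (@muP _ (fun m => S m = S n)); [def | exists n]. Qed.

Definition snoc c n : N := S (pr (c, n)).
Definition prev c : N := (un (predN c)).1.
Definition last c : N := (un (predN c)).2.
Lemma prev_snoc c n : prev (snoc c n) = c.
Proof. by rewrite /prev predNK prK. Qed.
Lemma last_snoc c n : last (snoc c n) = n.
Proof. by rewrite /last predNK prK. Qed.
Lemma snoc_inj c n c' n' : snoc c n = snoc c' n' -> c = c' /\ n = n'.
Proof. by move=> h; rewrite -(prev_snoc c n) -{2}(last_snoc c n) h prev_snoc last_snoc. Qed.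
Lemma snoc_neq0 c n : snoc c n <> O. Proof. exact: S_neq0. Qed.

Definition code_spec (x c : fn N N) := c O = O /\ forall k, c (S k) = snoc (c k) (x k).
Lemma ex_code (x : fn N N) : exists c, code_spec x c.
Proof.
have hg : Dfun (fun t : N * N => snoc t.2 (x t.1)).
  by rewrite /snoc; def.
by have [c c0 cS] := recursion O hg; exists c.
Qed.
(** [pcode x n] is the code of the finite sequence of the first [n] terms of [x]. *)
Definition pcode (x : fn N N) : fn N N := projT1 (cid (ex_code x)).
Lemma pcode0 x : pcode x O = O.
Proof. by rewrite /pcode; case: cid => c []. Qed.
Lemma pcodeS x n : pcode x (S n) = snoc (pcode x n) (x n).
Proof. by rewrite /pcode; case: cid => c []. Qed.

Lemma code_specE x c : code_spec x c -> c = pcode x.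
Proof.
move=> [c0 cS]; apply: Fn_ext; apply: indN; first def.
  by rewrite pcode0.
by move=> n IH; rewrite cS pcodeS IH.
Qed.

Lemma Dfun_pcode A (sA : sort fr A) (f : A -> seqN) :
  Dfun f -> Dfun (fun a => pcode (f a)).
Proof.
move=> hf; apply: (Dfun_graph (R := fun a c => code_spec (f a) c)).
  move=> a c; split => [/code_specE //|->].
  by split; [exact: pcode0 | exact: pcodeS].
rewrite /code_spec /snoc; def.
Qed.
End Coding.

Ltac def_codes := match goal with
  | |- Dfun (fun a => snoc _ _) => unfold snoc
  | |- Dfun (fun a => prev _) => unfold prev
  | |- Dfun (fun a => last _) => unfold last
  | |- Dfun (fun a => predN _) => unfold predN
  | |- Dfun (fun a => pcode _) => apply Dfun_pcode
  end.
Ltac def_ext ::= first [def_choice | def_codes].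

Section Runs.
Context {fr : frame}.
Notation N := (N fr).
Notation fn A B := (@Fn fr A B _ _).
Notation seqN := (fn N N).
Implicit Types (n m k i j c : N) (x y a b : seqN).

Lemma pcode_eq x y n : (forall i, ltN i n -> x i = y i) -> pcode x n = pcode y n.
Proof.
move: n; apply: indN; first def; first by rewrite !pcode0.
move=> n IH h; rewrite !pcodeS h ?IH // => i hi; apply: h; apply/ltNS; by left.
Qed.

Lemma pcode_inj x n y m : pcode x n = pcode y m ->
  n = m /\ forall i, ltN i n -> x i = y i.
Proof.
move: n m; apply: indN; first def.
  move=> m; case: (N_case m) => [->|[k ->]]; first by split => // i /ltN0.
  by rewrite pcode0 pcodeS => /esym /snoc_neq0.
move=> n IH m; case: (N_case m) => [->|[k ->]].
  by rewrite pcode0 pcodeS => /snoc_neq0.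
rewrite !pcodeS => /snoc_inj [/IH [-> h] e]; split => // i /ltNS [/h//|->].
by rewrite e.
Qed.

(** A rule which computes the next move from the code of the previous moves has
    a run inside the frame. *)
Lemma run (st : N * N -> N) : Dfun st ->
  exists x, forall n, x n = st (n, pcode x n).
Proof.
move=> hst.
have hg : Dfun (fun t : N * N => snoc t.2 (st t)) by def.
have [c c0 cS] := recursion O hg.
have hx : Dfun (fun n => st (n, c n)) by def.
exists (mkFn hx) => n.
by rewrite -(@code_specE _ (mkFn hx) c).
Qed.

Definition ext c c' := exists x n m, ltN n m /\ c = pcode x n /\ c' = pcode x m.

(** Codes do not give access to their entries by definition; the [i]-th term of the
    union is the value at [i] of some sequence that realizes a member of the chain. *)
Lemma chain (s : seqN) : s O = O -> (forall k, ext (s k) (s (S k))) ->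
  exists b, forall k, exists2 n, leN k n & s k = pcode b n.
Proof.
move=> s0 hs.
have len : forall k, exists x n, s k = pcode x n /\ leN k n.
  apply: indN; first def.
    by exists (mkFn (Dfun_id _)), O; rewrite s0 pcode0; split => //; apply: le0N.
  move=> k [x [n [e hn]]]; have [y [i [j [hij [e1 e2]]]]] := hs k.
  exists y, j; split => //.
  move: e; rewrite e1 => /pcode_inj [e _]; subst i.
  exact: ltNSS (leN_ltN_trans hn hij).
have mono k l : leN k l -> forall x n, s k = pcode x n ->
    exists y m, s l = pcode y m /\ leN n m /\ forall i, ltN i n -> y i = x i.
  move: l; apply: indN; first def.
    move=> /leN_eqVlt [/ltN0 //|->] x n e; exists x, n; by [].
  move=> l IH /leN_eqVlt [h|->] x n e; last by exists x, n.
  have [y [m [e1 [hm hy]]]] := IH h _ _ e.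
  have [z [i [j [hij [e2 e3]]]]] := hs l.
  exists z, j; split => //; move: e2; rewrite e1 => /pcode_inj [? hz]; subst i.
  split; first by apply: ltNW; exact: leN_ltN_trans hm hij.
  by move=> i hi; rewrite -hz ?hy //; exact: ltN_leN_trans hi hm.
pose V i v := exists x n k, s k = pcode x n /\ ltN i n /\ v = x i.
have hV : Def (fun p : N * N => V p.1 p.2) by rewrite /V; def.
have Vu k x n i v : s k = pcode x n -> ltN i n -> V i v -> v = x i.
  move=> e hi [y [m [l [e' [hi' ->]]]]].
  have : leN k l \/ leN l k.
    by case: (ltN_total k l) => [/ltNW|->|/ltNW]; auto.
  case=> h.
    have [z [j [e2 [hj hz]]]] := mono _ _ h _ _ e.
    by move: e2; rewrite e' => /pcode_inj [_ ->//]; exact: hz.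
  have [z [j [e2 [hj hz]]]] := mono _ _ h _ _ e'.
  by move: e2; rewrite e => /pcode_inj [_ ->//]; rewrite hz.
have Vex i : exists v, V i v.
  have [x [n [e h]]] := len (S i); exists (x i), x, n, (S i).
  by split => //; split => //; apply/ltNSS_inv.
have hb : Dfun (fun i => mu (V i)) by def.
exists (mkFn hb) => k; have [x [n [e h]]] := len k; exists n => //.
rewrite e; apply: pcode_eq => i hi /=; apply/esym; apply: (Vu k _ _ _ _ e hi).
by apply: (@muP _ (V i)); [def | exact: Vex].
Qed.

Lemma ex_dbl : exists D : seqN, D O = O /\ forall n, D (S n) = S (S (D n)).
Proof.
have h : Dfun (fun t : N * N => S (S t.2)) by def.
by have [D ? ?] := recursion O h; exists D.
Qed.
Definition dbl : seqN := projT1 (cid ex_dbl).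
Lemma dbl0 : dbl O = O. Proof. by rewrite /dbl; case: cid => ? []. Qed.
Lemma dblS n : dbl (S n) = S (S (dbl n)). Proof. by rewrite /dbl; case: cid => ? []. Qed.

Lemma parity n : (exists k, n = dbl k) \/ (exists k, n = S (dbl k)).
Proof.
move: n; apply: indN; first def; first by left; exists O; rewrite dbl0.
by move=> n [[k ->]|[k ->]]; [right; exists k | left; exists (S k); rewrite dblS].
Qed.

Lemma dbl_neq k l : dbl k <> S (dbl l).
Proof.
move: k l; apply: indN; first def; first by move=> l; rewrite dbl0 => /esym /S_neq0.
move=> k IH l; rewrite dblS => /S_inj.
case: (N_case l) => [->|[m ->]]; first by rewrite dbl0 => /S_neq0.
by rewrite dblS => /S_inj /esym; rewrite -/(dbl k) => e; apply: (IH m).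
Qed.

Lemma dbl_inj k l : dbl k = dbl l -> k = l.
Proof.
move: k l; apply: indN; first def.
  by move=> l; case: (N_case l) => [->//|[m ->]]; rewrite dblS dbl0 => /esym /S_neq0.
move=> k IH l; case: (N_case l) => [->|[m ->]]; first by rewrite dblS dbl0 => /S_neq0.
by rewrite !dblS => /S_inj /S_inj /IH ->.
Qed.

(** Strategies are functions on codes of positions; player I moves at even
    stages and wants the run to lie in [A]. *)
Definition determinedN (A : seqN -> Prop) :=
  (exists s : seqN, forall x, (forall k, x (dbl k) = s (pcode x (dbl k))) -> A x) \/
  (exists t : seqN, forall x,
     (forall k, x (S (dbl k)) = t (pcode x (S (dbl k)))) -> ~ A x).

Definition evens x : seqN := mkFn (Dfun_comp (Fn_Dfun dbl) (Fn_Dfun x)).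
Definition odds x : seqN :=
  mkFn (Dfun_comp (Dfun_S (Fn_Dfun dbl)) (Fn_Dfun x)).

Lemma Dfun_evens A (sA : sort fr A) (f : A -> seqN) : Dfun f -> Dfun (fun a : A => evens (f a)).
Proof.
move=> hf; apply: (Dfun_graph (R := fun (a : A) (y : seqN) => forall n, y n = f a (dbl n))).
  by move=> a y; split => [h|-> //]; apply: Fn_ext => n; rewrite h.
def.
Qed.
Lemma Dfun_odds A (sA : sort fr A) (f : A -> seqN) : Dfun f -> Dfun (fun a : A => odds (f a)).
Proof.
move=> hf; apply: (Dfun_graph (R := fun (a : A) (y : seqN) => forall n, y n = f a (S (dbl n)))).
  by move=> a y; split => [h|-> //]; apply: Fn_ext => n; rewrite h.
def.
Qed.

(** The run is split into the moves [a] of player I and the moves [b] of player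
    II.  The own moves of the player who follows a strategy are determined by the
    moves of the opponent, so that the strategy can be replaced by one which only
    looks at the latter; it searches for a run of the old strategy. *)
Lemma lipschitz_determinacy (W : seqN -> seqN -> Prop) :
  determinedN (fun x => W (evens x) (odds x)) ->
  (exists s : seqN, forall a b, (forall k, a k = s (pcode b k)) -> W a b) \/
  (exists t : seqN, forall a b, (forall k, b k = t (pcode a (S k))) -> ~ W a b).
Proof.
have half k : mu (fun i => S (dbl k) = S (dbl i)) = k.
  apply/esym/dbl_inj/S_inj.
  by apply: (@muP _ (fun i => S (dbl k) = S (dbl i))); [def | exists k].
have merge (u v : N * N -> N) : Dfun u -> Dfun v -> exists x,
    (forall k, x (dbl k) = u (k, pcode x (dbl k))) /\
    (forall k, x (S (dbl k)) = v (k, pcode x (S (dbl k)))).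
  move=> hu hv.
  have [|x hx] := @run (fun p => ite (exists k, p.1 = dbl k)
     (u (mu (fun i => S p.1 = S (dbl i)), p.2)) (v (mu (fun i => p.1 = S (dbl i)), p.2))).
    by def.
  exists x; split => k; rewrite hx /=.
    by rewrite iteT ?half //; exists k.
  by rewrite iteF ?half // => -[i /esym /dbl_neq].
case=> [[s hs]|[t ht]]; [left | right].
  pose rule x := forall k, x (dbl k) = s (pcode x (dbl k)).
  have same x y k : rule x -> rule y ->
      (forall i, ltN i k -> odds x i = odds y i) ->
      pcode x (dbl k) = pcode y (dbl k).
    move=> rx ry; move: k; apply: indN; first by defs; apply: Dfun_odds; def.
      by rewrite dbl0 !pcode0.
    move=> k IH h; have {}IH := IH (fun i hi => h i (ltNW hi)).
    rewrite dblS !pcodeS rx ry IH; congr snoc.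
    exact: (h k (ltNSn k)).
  pose G c m := exists x k, rule x /\ c = pcode (odds x) k /\ m = x (dbl k).
  have hG : Def (fun p : N * N => G p.1 p.2).
    by rewrite /G /rule; defs; apply: Dfun_odds; def.
  have hf : Dfun (fun c => mu (G c)) by def.
  exists (mkFn hf) => a b hab.
  have hs1 : Dfun (fun p : N * N => s p.2) by def.
  have hb1 : Dfun (fun p : N * N => b p.1) by def.
  have [x [rx ox]] := merge _ _ hs1 hb1.
  have eo : odds x = b by apply: Fn_ext => k; rewrite /= ox.
  suff ea : evens x = a by rewrite -eo -ea; apply: hs.
  apply: Fn_ext => k; rewrite hab /=.
  have : G (pcode b k) (mu (G (pcode b k))).
    apply: muP; first def.
    by exists (x (dbl k)), x, k; rewrite eo.
  move=> [y [j [ry [/pcode_inj [e h] ->]]]]; subst j.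
  rewrite [LHS]rx ry; congr (fapp s _); apply: same => // i hi.
  by rewrite eo h.
pose rule x := forall k, x (S (dbl k)) = t (pcode x (S (dbl k))).
have same x y k : rule x -> rule y ->
    (forall i, ltN i (S k) -> evens x i = evens y i) ->
    pcode x (S (dbl k)) = pcode y (S (dbl k)).
  move=> rx ry; move: k; apply: indN; first by defs; apply: Dfun_evens; def.
    move=> h; rewrite !pcodeS dbl0 !pcode0.
    by have := h O (ltNSn _); rewrite /fapp /= -!/(fapp _ _) dbl0 => ->.
  move=> k IH h; have {}IH := IH (fun i hi => h i (ltNW hi)).
  rewrite dblS !(pcodeS _ (S (S (dbl k)))) !(pcodeS _ (S (dbl k))) rx ry IH.
  by congr snoc; rewrite -dblS; apply: (h (S k) (ltNSn _)).
pose G c m := exists x k, rule x /\ c = pcode (evens x) (S k) /\ m = x (S (dbl k)).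
have hG : Def (fun p : N * N => G p.1 p.2).
  by rewrite /G /rule; defs; apply: Dfun_evens; def.
have hf : Dfun (fun c => mu (G c)) by def.
exists (mkFn hf) => a b hab.
have ht1 : Dfun (fun p : N * N => t p.2) by def.
have ha1 : Dfun (fun p : N * N => a p.1) by def.
have [x [ex rx]] := merge _ _ ha1 ht1.
have ea : evens x = a by apply: Fn_ext => k; rewrite /= ex.
suff eb : odds x = b by rewrite -ea -eb; apply: ht.
apply: Fn_ext => k; rewrite hab /=.
have : G (pcode a (S k)) (mu (G (pcode a (S k)))).
  apply: muP; first def.
  by exists (x (S (dbl k))), x, k; rewrite ea.
move=> [y [j [ry [/pcode_inj [/S_inj e h] ->]]]]; subst j.
rewrite [LHS]rx ry; congr (fapp t _); apply: same => // i hi.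
by rewrite ea h.
Qed.
End Runs.

End Coding.

Module Balls.
Import Order.TTheory GRing.Theory Num.Theory.
Import Definability Coding.
Local Open Scope ring_scope.

(** * Metric spaces and coded balls *)

Section Reals.
Context {fr : frame}.
Notation N := (N fr).
Notation K := (K fr).
Notation fn A B := (@Fn fr A B _ _).
Implicit Types (n m k : N) (r : K).

Lemma ex_eps : exists e : fn N K, e O = 1 /\ forall n, e (S n) = e n / 2.
Proof.
have h : Dfun (fun t : N * K => t.2 * 2^-1) by def.
by have [e ? ?] := recursion (1 : K) h; exists e.
Qed.
Definition eps : fn N K := projT1 (cid ex_eps).
Lemma eps0 : eps O = 1. Proof. by rewrite /eps; case: cid => ? []. Qed.
Lemma epsS n : eps (S n) = eps n / 2. Proof. by rewrite /eps; case: cid => ? []. Qed.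

Lemma eps_gt0 n : 0 < eps n.
Proof.
move: n; apply: indN; first def; first by rewrite eps0.
by move=> n h; rewrite epsS divr_gt0.
Qed.
Hint Resolve eps_gt0 : core.

Lemma eps_anti n m : leN n m -> eps m <= eps n.
Proof.
move: m; apply: indN; first def; first by move=> /leN_eqVlt [/ltN0|->].
move=> m IH /leN_eqVlt [/IH|->//]; rewrite epsS; have := eps_gt0 m; lra.
Qed.

Lemma eps_small r : 0 < r -> exists n, eps n < r.
Proof.
move=> r0; apply: contrapT => h.
have {}h n : r <= eps n by rewrite leNgt; apply/negP => hn; apply: h; exists n.
have [|||s hs hmin] := @lubK fr (fun t => forall n, t <= eps n).
- def.
- by exists r.
- by exists 1 => t /(_ O); rewrite eps0.
have s0 : r <= s by apply: hs.
suff : s + s <= s by lra.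
apply: hs => n; suff : s <= eps (S n) by rewrite epsS; lra.
by apply: hmin => t; apply.
Qed.

Lemma eps_small2 r m : 0 < r -> exists n, ltN m n /\ eps n < r.
Proof.
move=> /eps_small [n hn]; case: (ltN_total m n) => h; first by exists n.
  by exists (S m); split => //; rewrite h; apply: le_lt_trans hn; exact: eps_anti (ltNW _).
exists (S m); split => //; apply: le_lt_trans hn; apply: eps_anti.
exact: ltNW (ltN_trans h _).
Qed.
End Reals.
#[global] Hint Resolve eps_gt0 : core.

(** The dense sequence [q] makes the balls that matter countable, so that they can
    be played in games on numbers. *)
Record mspace (fr : frame) := MSpace {
  pt :> Type;
  pt_sort : sort fr pt;
  dist : pt -> pt -> K fr;
  dfun_dist : Dfun (fun p : pt * pt => dist p.1 p.2);
  dist_eq0 : forall x y, dist x y = 0 <-> x = y;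
  distC : forall x y, dist x y = dist y x;
  distT : forall x y z, dist x z <= dist x y + dist y z;
  q : @Fn fr (N fr) pt _ _;
  q_dense : forall x r, 0 < r -> exists n, dist x (q n) < r }.
#[global] Existing Instance pt_sort.
Arguments q {fr m}.

Section BallDefs.
Context {fr : frame} {X : mspace fr}.
Notation N := (N fr).
Notation K := (K fr).
Notation fn A B := (@Fn fr A B _ _).
Notation seqN := (fn N N).
Implicit Types (n m k i j b c : N) (a : seqN) (r : K) (x y z : X).

Lemma Dfun_dist A (sA : sort fr A) (f g : A -> X) :
  Dfun f -> Dfun g -> Dfun (fun a : A => dist (f a) (g a)).
Proof. exact: (Dfun_comp2 (dfun_dist X)). Qed.

(** Codes of open balls: [O] is the whole space and [S (pr (i, m))] is the ball of
    centre [q i] and radius [eps m]. *)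
Definition cen b : X := q (un (predN b)).1.
Definition lev b : N := (un (predN b)).2.
Definition rad b : K := eps (lev b).
Definition inb x b := b = O \/ dist x (cen b) < rad b.
Definition ball i m : N := S (pr (i, m)).

(** The closed ball is contained in the open one for a reason visible from the centres
    and radii; the radius decreases as well, so that descending sequences converge. *)
Definition inside b b' := b <> O /\
  (b' = O \/ (ltN (lev b') (lev b) /\ dist (cen b) (cen b') + rad b < rad b')).

(** A nested sequence of balls represents a point of the completion; it lies in
    the space when the balls have a common point there. *)
Definition lim a x := forall k, inb x (a k).
Definition nested a := inside (a O) O /\ forall k, inside (a (S k)) (a k).
End BallDefs.
Arguments cen {fr} X b.
Arguments inside {fr} X b b'.
Arguments nested {fr} X a.

Ltac def_balls := match goal with
  | |- Dfun (fun a => dist _ _) => apply Dfun_dist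
  | |- Dfun (fun a => cen _ _) => unfold cen
  | |- Dfun (fun a => lev _) => unfold lev
  | |- Dfun (fun a => rad _) => unfold rad
  | |- Dfun (fun a => ball _ _) => unfold ball
  | |- Def (fun a => inb _ _) => unfold inb
  | |- Def (fun a => inside _ _ _) => unfold inside
  | |- Def (fun a => lim _ _) => unfold lim
  | |- Def (fun a => nested _ _) => unfold nested
  | |- Def (fun a => ext _ _) => unfold ext
  end.
Ltac def_ext ::= first [def_choice | def_codes | def_balls].

Section Balls.
Context {fr : frame} {X : mspace fr}.
Notation N := (N fr).
Notation K := (K fr).
Notation fn A B := (@Fn fr A B _ _).
Notation seqN := (fn N N).
Implicit Types (n m k i j b c : N) (a : seqN) (r : K) (x y z : X).
Notation cen := (cen X).
Notation inside := (inside X).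
Notation nested := (nested X).

Lemma distxx x : dist x x = 0. Proof. exact/dist_eq0. Qed.
Lemma dist_ge0 x y : 0 <= dist x y.
Proof. by have := distT x y x; rewrite distxx (distC y); lra. Qed.
Lemma cen_ball i m : cen (ball i m) = q i. Proof. by rewrite /cen predNK prK. Qed.
Lemma lev_ball i m : lev (ball i m) = m. Proof. by rewrite /lev predNK prK. Qed.

Lemma inb0 x : inb x O. Proof. by left. Qed.
Lemma inb_cen b : inb (cen b) b.
Proof. by right; rewrite distxx; exact: eps_gt0. Qed.

Lemma inb_closed x b b' : inside b b' ->
  (forall r, 0 < r -> exists y, inb y b /\ dist x y < r) -> inb x b'.
Proof.
move=> [b0 [->|[_ h]]] hx; first by left.
right; have [|y [[//|hy] xy]] := hx (rad b' - dist (cen b) (cen b') - rad b); first lra.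
have := distT x y (cen b'); have := distT y (cen b) (cen b'); lra.
Qed.

Lemma inside_inb x b b' : inside b b' -> inb x b -> inb x b'.
Proof.
by move=> h hx; apply: (inb_closed h) => r r0; exists x; rewrite distxx.
Qed.

Lemma inside_lev b b' : inside b b' -> b' <> O -> ltN (lev b') (lev b).
Proof. by move=> [_ [->|[]]]. Qed.

Lemma inside_trans b1 b2 b3 : inside b1 b2 -> inside b2 b3 -> inside b1 b3.
Proof.
move=> [h1 h12] [h2 h23]; split => //; case: h23 => [->|[l23 h23]]; first by left.
case: h12 => [//|[l12 h12]]; right; split; first exact: ltN_trans l23 l12.
have := distT (cen b1) (cen b2) (cen b3); have := eps_gt0 (lev b2).
rewrite -/(rad b2); lra.
Qed.

Lemma inb_small x y b : b <> O -> inb x b -> inb y b -> dist x y < rad b + rad b.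
Proof.
move=> b0 [//|hx] [//|hy]; have := distT x (cen b) y; rewrite (distC (cen b)); lra.
Qed.

Lemma small_ball x b m r : inb x b -> 0 < r ->
  exists b', [/\ inside b' b, inb x b', ltN m (lev b') & rad b' < r].
Proof.
move=> hx r0; case: (pselect (b = O)) => [->|b0].
  have [n [mn nr]] := eps_small2 m r0; have [i hi] := q_dense x (eps_gt0 n).
  exists (ball i n); split; rewrite ?lev_ball ?/rad ?lev_ball //.
    by split; [exact: S_neq0 | left].
  by right; rewrite cen_ball /rad lev_ball.
case: hx => // hx.
have t0 : 0 < Num.min r ((rad b - dist x (cen b)) / 2).
  by rewrite lt_min r0 /=; lra.
have [l [ml lbl]] := ex_leN2 m (lev b).
have [n [ln]] := eps_small2 l t0; rewrite lt_min => /andP[nr nt].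
have [i hi] := q_dense x (eps_gt0 n).
exists (ball i n); split; rewrite ?lev_ball /rad ?lev_ball //.
- split; first exact: S_neq0.
  right; rewrite cen_ball /rad !lev_ball; split; first exact: leN_ltN_trans lbl ln.
  rewrite -/(rad b); have := distT (q i) x (cen b); rewrite (distC (q i) x); lra.
- by right; rewrite cen_ball /rad lev_ball.
- exact: leN_ltN_trans ml ln.
Qed.

Lemma sub_ball x b : inb x b -> exists b', inside b' b /\ inb x b'.
Proof. by move=> h; have [b' []] := small_ball O h (@ltr01 K); exists b'. Qed.

Lemma nbhd_ball x b r : inb x b -> 0 < r ->
  exists b', inside b' b /\ inb x b' /\ forall y, inb y b' -> dist x y < r.
Proof.
move=> hx r0; have r20 : 0 < r / 2 by lra.
have [b' [h1 h2 _ h3]] := small_ball O hx r20; exists b'; split => //; split => // y hy.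
by have := inb_small (proj1 h1) h2 hy; lra.
Qed.

Lemma inb_open x b : inb x b -> exists r, 0 < r /\ forall y, dist x y < r -> inb y b.
Proof.
move=> [->|h]; first by exists 1; split => // y _; left.
exists (rad b - dist x (cen b)); split => [|y hy]; first by lra.
by right; have := distT y x (cen b); rewrite (distC y x); lra.
Qed.

Lemma nested_lev a k : nested a -> leN k (lev (a k)).
Proof.
move=> [h0 h]; move: k; apply: indN; first (rewrite /lev; def); first exact: le0N.
move=> k IH; apply: ltNSS; apply: (leN_ltN_trans IH).
apply: inside_lev (h k) _; move: {IH} k.
have h0' : a O <> O by case: h0.
move=> k; case: (N_case k) => [->//|[m ->]]; by case: (h m).
Qed.

Lemma nested_neq0 a k : nested a -> a k <> O.
Proof. by move=> [h0 h]; case: (N_case k) => [->|[m ->]]; [case: h0 | case: (h m)]. Qed.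

Lemma nested_small a r : nested a -> 0 < r -> exists k, rad (a k) < r.
Proof.
move=> ha /eps_small [k hk]; exists k; apply: le_lt_trans hk; apply: eps_anti.
exact: nested_lev.
Qed.

Lemma lim_conv a x r : nested a -> lim a x -> 0 < r ->
  exists k, forall y, inb y (a k) -> dist x y < r.
Proof.
move=> ha hx r0; have r20 : 0 < r / 2 by lra.
have [k hk] := nested_small ha r20; exists k => y hy.
have := inb_small (nested_neq0 ha) (hx k) hy; lra.
Qed.

Lemma inb_sep x y : x <> y -> exists r, 0 < r /\ forall b b', inb x b -> inb y b' ->
  b <> O -> b' <> O -> rad b < r -> rad b' < r -> forall z, inb z b -> ~ inb z b'.
Proof.
move=> xy; have d0 : 0 < dist x y.
  by rewrite lt_neqAle dist_ge0 andbT eq_sym; apply/eqP => /dist_eq0.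
exists (dist x y / 4); split => [|b b' hx hy b0 b'0 hb hb' z hz hz']; first lra.
have := inb_small b0 hx hz; have := inb_small b'0 hy hz'.
have := distT x z y; rewrite (distC z y); lra.
Qed.
End Balls.

End Balls.

Module BallGames.
Import Order.TTheory GRing.Theory Num.Theory.
Import Definability Coding Balls.
Local Open Scope ring_scope.

(** * Ball games *)

Section GameDefs.
Context {fr : frame} {X : mspace fr}.
Notation N := (N fr).
Notation K := (K fr).
Notation fn A B := (@Fn fr A B _ _).
Notation seqN := (fn N N).
Implicit Types (n m k i j b : N) (a t : seqN) (x y z : X).

Definition dense_seq (D : fn N X) := forall x r, 0 < r -> exists n, dist x (D n) < r.

Definition cont (f : fn X X) :=
  forall x r, 0 < r -> exists s, 0 < s /\ forall y, dist x y < s -> dist (f x) (f y) < r.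

Definition cdh := forall D E : fn N X, dense_seq D -> dense_seq E ->
  exists h h' : fn X X, [/\ cancel h h', cancel h' h, cont h, cont h' &
    (forall n, exists m, h (D n) = E m) /\ (forall m, exists n, h (D n) = E m)].

(** In round [k] of a ball game player I plays [a k] and then player II plays
    [t k]; the balls [stage w a t k] are computed from the rounds played so far,
    and player I has to obey the rule [v] in each round. *)
Definition stage (w : fn (N * N) N) a t k : N :=
  ite (k = O) O (w (a (predN k), t (predN k))).
Definition common_point (s : N -> N) := exists x : X, forall k, inb x (s k).
Definition legal (v : @Pw fr (N * N) _) w a t :=
  forall k, elt (stage w a t k, a k) v.
Definition zero_tail t := exists n, forall k, leN n k -> t k = O.

(** The payoffs of the Banach-Mazur game, of the perfect set game and of the Wadge
    game, for arbitrary rules. *)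
Definition ball_games_determined := forall v w,
  [/\ determinedN (fun u : seqN => legal v w (evens u) (odds u) /\
        ~ common_point (stage w (evens u) (odds u))),
      determinedN (fun u : seqN => legal v w (evens u) (odds u) /\
        common_point (stage w (evens u) (odds u)))
    & determinedN (fun u : seqN => legal v w (evens u) (odds u) /\
        (zero_tail (odds u) <-> common_point (stage w (evens u) (odds u))))].

(** [Phi] is a sequence of dense open sets: the [n]-th one is the union of the
    balls [Phi (n, g)]. *)
Definition thin (Phi : fn (N * N) N) := forall n g, inside X (Phi (n, g)) g.
Definition outside (Phi : fn (N * N) N) x n := forall g, ~ inb x (Phi (n, g)).
Definition meager b := exists Phi, thin Phi /\
  forall x, inb x b -> exists n, outside Phi x n.
(** The largest meager open set, which is shown to be empty by the perfect set
    game. *)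
Definition locally_meager x := exists b, inb x b /\ meager b.
End GameDefs.
Arguments cdh {fr} X.
Arguments common_point {fr} X s.
Arguments meager {fr} X b.
Arguments thin {fr} X Phi.
Arguments ball_games_determined {fr} X.

Ltac def_games := match goal with
  | |- Dfun (fun a => evens _) => apply Dfun_evens
  | |- Dfun (fun a => odds _) => apply Dfun_odds
  | |- Dfun (fun a => stage _ _ _ _) => unfold stage
  | |- Def (fun a => common_point _ _) => unfold common_point
  | |- Def (fun a => legal _ _ _ _) => unfold legal
  | |- Def (fun a => zero_tail _) => unfold zero_tail
  | |- Def (fun a => thin _ _) => unfold thin
  | |- Def (fun a => outside _ _ _) => unfold outside
  | |- Def (fun a => meager _ _) => unfold meager
  | |- Def (fun a => locally_meager _) => unfold locally_meager
  end.
Ltac def_ext ::= first [def_choice | def_codes | def_balls | def_games].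

Section Games.
Context {fr : frame} {X : mspace fr}.
Notation N := (N fr).
Notation K := (K fr).
Notation fn A B := (@Fn fr A B _ _).
Notation seqN := (fn N N).
Implicit Types (n m k i j c g b : N) (a t u s : seqN) (x y z : X).
Notation cen := (cen X).
Notation inside := (inside X).
Notation nested := (nested X).
Notation meager := (meager X).
Notation thin := (thin X).
Notation common_point := (common_point X).

Lemma stage0 w a t : stage w a t O = O.
Proof. by rewrite /stage iteT. Qed.
Lemma stageS w a t k : stage w a t (S k) = w (a k, t k).
Proof. by rewrite /stage iteF ?predNK //; apply: S_neq0. Qed.

Definition genuine c := exists (u : seqN) n, c = pcode u n.

Lemma genuine0 : genuine O.
Proof. by exists (mkFn (Dfun_id _)), O; rewrite pcode0. Qed.

Lemma pcode_upd u n m : exists u', pcode u' n = pcode u n /\ u' n = m /\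
  forall i, i <> n -> u' i = u i.
Proof.
have h : Dfun (fun i => ite (i = n) m (u i)) by def.
exists (mkFn h); split; last by split => [|i hi] /=; [rewrite /= iteT|rewrite /= iteF].
apply: pcode_eq => i hi /=; rewrite iteF // => e; move: hi; rewrite e; exact: ltN_irr.
Qed.

Lemma pcode_snoc u n m : exists u', pcode u' (S n) = snoc (pcode u n) m /\
  forall i, ltN i n -> u' i = u i.
Proof.
have [u' [e [e1 h]]] := pcode_upd u n m; exists u'; rewrite pcodeS e e1; split => // i hi.
by apply: h => ei; move: hi; rewrite ei; exact: ltN_irr.
Qed.

Lemma genuine_snoc c m : genuine c -> genuine (snoc c m).
Proof. by move=> [u [n ->]]; have [u' [e _]] := pcode_snoc u n m; exists u', (S n). Qed.

Lemma snoc_chain s : s O = O -> (forall k, exists m, s (S k) = snoc (s k) m) ->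
  exists u, forall k, pcode u k = s k.
Proof.
move=> s0 hs; have h : Dfun (fun k => last (s (S k))) by def.
exists (mkFn h); apply: indN; first def; first by rewrite pcode0.
by move=> k IH; rewrite pcodeS IH /=; have [m e] := hs k; rewrite /= e last_snoc.
Qed.

Lemma descending_mono s l m x : (forall k, inside (s (S k)) (s k)) -> leN l m ->
  inb x (s m) -> inb x (s l).
Proof.
move=> hs; move: m; apply: indN; first def; first by move=> /leN_eqVlt [/ltN0|->].
move=> m IH /leN_eqVlt [/IH h|-> //] hx; apply: h; exact: inside_inb (hs m) hx.
Qed.

Lemma descending_small s x r : (forall k, inside (s (S k)) (s k)) ->
  (forall k, inb x (s k)) -> 0 < r ->
  exists l, forall m, leN l m -> forall y, inb y (s m) -> dist x y < r.
Proof.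
move=> hs hx r0; pose a := mkFn (Dfun_comp (dfun_S fr) (Fn_Dfun s)).
have na : nested a.
  split; first by split; [case: (hs O) | left].
  by move=> k; exact: (hs (S k)).
have [|l hl] := lim_conv na _ r0 (x := x); first by move=> k; exact: hx.
exists (S l) => m lm y hy; apply: hl; exact: (descending_mono hs lm).
Qed.

Lemma cont_ball (f : fn X X) x b b0 : cont f -> inb (f x) b -> inb x b0 ->
  exists b', inside b' b0 /\ inb x b' /\ forall y, inb y b' -> inb (f y) b.
Proof.
move=> hf /inb_open [r [r0 hr]] hx; have [t [t0 ht]] := hf x r r0.
have [b' [h1 [h2 h3]]] := nbhd_ball hx t0; exists b'; split => //; split => // y /h3 /ht.
exact: hr.
Qed.

Lemma common_ball x b b' : inb x b -> inb x b' ->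
  exists g, inside g b /\ inside g b' /\ inb x g.
Proof.
move=> hx hx'; case: (pselect (b' = O)) => [->|b'0].
  have [g [h1 h2]] := sub_ball hx; exists g; split => //; split => //.
  by split; [case: h1 | left].
case: hx' => // hx'; have r0 : 0 < (rad b' - dist x (Balls.cen X b')) / 2 by lra.
have [g [h1 h2 h3 h4]] := small_ball (lev b') hx r0; exists g; split => //; split => //.
split; first by case: h1.
right; split => //; case: (h2) => [e|h5]; first by case: h1.
have := distT (cen g) x (cen b'); rewrite (distC (cen g) x); lra.
Qed.

(** ** Banach-Mazur games *)

(** An illegal answer [p.2] to the ball [p.1] is replaced by some legal one. *)
Definition shrink g := mu (fun b => inside b g).
Lemma shrinkP g : inside (shrink g) g.
Proof.
apply: (@muP _ (fun b => inside b g)); first def.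
by have [b [h _]] := sub_ball (inb_cen (X := X) g); exists b.
Qed.

Lemma legalize_Dfun : Dfun (fun p : N * N => ite (inside p.2 p.1) p.2 (shrink p.1)).
Proof. by rewrite /shrink; def. Qed.
Definition legalize := mkFn legalize_Dfun.
Lemma legalizeP m n : inside (legalize (m, n)) m.
Proof.
rewrite /legalize /=; case: (pselect (inside n m)) => h; first by rewrite /= iteT.
by rewrite /= iteF //; exact: shrinkP.
Qed.
Lemma legalizeT m n : inside n m -> legalize (m, n) = n.
Proof. by move=> h; rewrite /legalize /= iteT. Qed.

Lemma nest_rule_Def : Def (fun p : N * N => inside p.2 p.1).
Proof. def. Qed.
Definition nest_rule := mkPw nest_rule_Def.

Section BanachMazurII.
Context (tau : seqN)
  (tauP : forall a t, (forall k, t k = tau (pcode a (S k))) ->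
    ~ (legal nest_rule legalize a t /\ ~ common_point (stage legalize a t))).

(** The ball in which player II, following [tau], leaves the game when [c] codes
    the moves of player I. *)
Definition bm_ball c := ite (c = O) O (legalize (last c, tau c)).

Lemma bm_ball0 : bm_ball O = O. Proof. by rewrite /bm_ball iteT. Qed.
Lemma bm_ballS c m : bm_ball (snoc c m) = legalize (m, tau (snoc c m)).
Proof. by rewrite /bm_ball iteF ?last_snoc //; exact: snoc_neq0. Qed.
Lemma bm_ball_inside c m : inside (bm_ball (snoc c m)) m.
Proof. by rewrite bm_ballS; exact: legalizeP. Qed.

Definition valid c := exists a k, c = pcode a k /\
  forall i, ltN i k -> inside (a i) (bm_ball (pcode a i)).

Lemma valid0 : valid O.
Proof. by exists (mkFn (Dfun_id _)), O; rewrite pcode0; split => // i /ltN0. Qed.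

Lemma valid_snoc c m : valid c -> inside m (bm_ball c) -> valid (snoc c m).
Proof.
move=> [a [k [-> h]]] hm; have [a' [e h']] := pcode_snoc a k m.
exists a', (S k); split => //.
have e' i : leN i k -> pcode a' i = pcode a i.
  by move=> hi; apply: pcode_eq => j hj; apply: h'; exact: ltN_leN_trans hj hi.
move=> i /ltNS [hi|->]; first by rewrite h' // e'; [exact: h | exact: ltNW].
by rewrite e'; [move: e; rewrite pcodeS => /snoc_inj [_ ->] | exact: leNn].
Qed.

Lemma bm_chain s : s O = O ->
  (forall k, exists m, s (S k) = snoc (s k) m /\ inside m (bm_ball (s k))) ->
  exists x : X, forall k, inb x (bm_ball (s k)).
Proof.
move=> s0 hs; have [|a ha] := snoc_chain s0.
  by move=> k; have [m [? _]] := hs k; exists m.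
have ht : Dfun (fun k => tau (pcode a (S k))) by def.
pose t := mkFn ht.
have st k : stage legalize a t k = bm_ball (pcode a k).
  case: (N_case k) => [->|[m ->]]; first by rewrite stage0 pcode0 bm_ball0.
  by rewrite stageS pcodeS bm_ballS -pcodeS.
have := @tauP a t (fun=> erefl) => /not_andP [|/contrapT [x hx]].
  case=> k; rewrite /nest_rule /elt /= st ha; have [m [e h]] := hs k.
  by move: e; rewrite -!ha pcodeS => /snoc_inj [_ ->]; rewrite ha.
by exists x => k; rewrite -ha -st.
Qed.

(** Such a point can be followed through a run against [tau]. *)
Definition generic x := forall c, valid c -> inb x (bm_ball c) ->
  exists m, inside m (bm_ball c) /\ inb x (bm_ball (snoc c m)).

(** All positions are coded by numbers, and a descending sequence of balls is built
    that takes care of one of them in each step.  The sequence is itself a play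
    against [tau], so that the balls have a common point. *)
Lemma generic_dense b : exists x, inb x b /\ generic x.
Proof.
pose Req k h := valid k -> (exists m, inside m (bm_ball k) /\ inside h (bm_ball (snoc k m))) \/
  (forall y, inb y h -> ~ inb y (bm_ball k)).
have hReq : Def (fun p : N * N => Req p.1 p.2) by rewrite /Req /valid /bm_ball; def.
pose P (p : N * N) := p.2 = O \/ inside (bm_ball p.2) b.
pose R (p p' : N * N) := p'.1 = S p.1 /\ exists h, inside h b /\ inside h (bm_ball p.2) /\
  Req p.1 h /\ p'.2 = snoc p.2 h.
have [||||f f0 hf] := @dep_choice _ _ _ P R (O, O).
- by rewrite /P /bm_ball; def.
- by rewrite /R /bm_ball; def.
- by left.
- move=> [k s] Ps.
  have [b1 [h1 h2]] : exists b1, inside b1 b /\ inside b1 (bm_ball s).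
    case: Ps => /= [->|hs].
      by exists (shrink b); rewrite bm_ball0; split; [exact: shrinkP | split; [case: (shrinkP b)|left]].
    exists (shrink (bm_ball s)); split; last exact: shrinkP.
    exact: inside_trans (shrinkP _) hs.
  have [h [h3 h4]] : exists h, inside h b1 /\ Req k h.
    case: (pselect (valid k /\ exists y, inb y b1 /\ inb y (bm_ball k))) => [[vk [y [y1 y2]]]|no].
      have [m [m1 [m2 m3]]] := common_ball y1 y2.
      exists (shrink (bm_ball (snoc k m))); split.
        by apply: inside_trans (shrinkP _) _; apply: inside_trans (bm_ball_inside k m) m1.
      by move=> _; left; exists m; split => //; exact: shrinkP.
    exists (shrink b1); split; first exact: shrinkP.
    move=> vk; right => y hy hyk; apply: no; split => //; exists y; split => //.
    exact: inside_inb (shrinkP b1) hy.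
  have hb : inside h b by exact: inside_trans h3 h1.
  exists (S k, snoc s h); first by right; apply: inside_trans (bm_ball_inside s h) hb.
  by split => //; exists h; split => //; split; [exact: inside_trans h3 h2 | split].
have f1 k : (f k).1 = k.
  by move: k; apply: indN; [def | rewrite f0 | move=> k IH; have [_ [-> _]] := hf k; rewrite IH].
have hs : Dfun (fun k => (f k).2) by def.
have [||x hx] := @bm_chain (mkFn hs); first by rewrite /= f0.
  move=> k; have [_ [_ [h [_ [h2 [_ e]]]]]] := hf k; by exists h.
exists x; split.
  have [_ [_ [h [h1 [_ [_ e]]]]]] := hf O; have := hx (S O); rewrite /= e => hx1.
  exact: inside_inb h1 (inside_inb (bm_ball_inside _ _) hx1).
move=> c vc xc; have [_ [_ [h [_ [_ [hc e]]]]]] := hf c.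
have := hx (S c); rewrite /= e => /(inside_inb (bm_ball_inside _ _)) xh.
rewrite f1 in hc; case: (hc vc) => [[m [m1 m2]]|no]; last by case: (no x xh xc).
by exists m; split => //; exact: inside_inb m2 xh.
Qed.

Lemma generic_sequence : exists D : fn N X, dense_seq D /\ forall n, generic (D n).
Proof.
have [|D hD] := @countable_choice _ _ _ (fun n x => inb x n /\ generic x) _ generic_dense.
  by rewrite /generic /valid /bm_ball; def.
exists D; split; last by move=> n; case: (hD n).
move=> x r r0; have [b [_ [_ hb]]] := nbhd_ball (inb0 x) r0.
by exists b; apply: hb; case: (hD b).
Qed.
End BanachMazurII.

Section BanachMazurI.
Context (sigma : seqN)
  (sigmaP : forall a t, (forall k, a k = sigma (pcode t k)) ->
    legal nest_rule legalize a t /\ ~ common_point (stage legalize a t)).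

Let move_of t : seqN := mkFn (Dfun_comp (Fn_Dfun (pcode t)) (Fn_Dfun sigma)).

Lemma sigma_inside c g : genuine c -> inside g (sigma c) -> inside (sigma (snoc c g)) g.
Proof.
move=> [u [n ->]] hg; have [u' [e hu]] := pcode_snoc u n g.
have [h _] := sigmaP (a := move_of u') (t := u') (fun=> erefl).
have : inside (sigma (pcode u' (S n))) (stage legalize (move_of u') u' (S n)) := h (S n).
have e1 : move_of u' n = sigma (pcode u' n) by [].
have [e2 e3] : pcode u' n = pcode u n /\ u' n = g.
  by move: e; rewrite pcodeS => /snoc_inj.
by rewrite stageS e1 e2 e3 legalizeT // e.
Qed.

(** For each position [c], the balls that player I can still be made to play after
    [c] form a dense open subset of [sigma c].  A point in all these sets could be
    followed for ever, which would be a loss for player I; so these sets witness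
    that the first ball of player I is meager. *)
Lemma meager_sigma0 : meager (sigma O).
Proof.
pose good (p : N * N) g' := inside (sigma (snoc p.1 g')) p.2.
have hPhi : Dfun (fun p : N * N =>
    ite (exists g', good p g') (sigma (snoc p.1 (mu (good p)))) (shrink p.2)).
  by rewrite /good /shrink; def.
exists (mkFn hPhi); split.
  move=> n g; rewrite /= ; case: (pselect (exists g', good (n, g) g')) => h.
    by rewrite /= iteT //; apply: (@muP _ (good (n, g)) _ h); rewrite /good; def.
  by rewrite /= iteF //; exact: shrinkP.
move=> x x0; apply: contrapT => no.
have step c : genuine c -> inb x (sigma c) -> exists m, inb x (sigma (snoc c m)).
  move=> gc xc; apply: contrapT => hm; apply: no; exists c => g.
  rewrite /=; case: (pselect (exists g', good (c, g) g')) => h.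
    by rewrite /= iteT // => hx; apply: hm; eexists; exact: hx.
  rewrite /= iteF // => /(inside_inb (shrinkP g)) xg; apply: h.
  have [g' [h1 [h2 _]]] := common_ball xg xc; exists g'.
  exact: inside_trans (sigma_inside gc h2) h1.
have [||||f f0 hf] := @dep_choice _ _ _ (fun c => genuine c /\ inb x (sigma c))
  (fun c c' => exists m, c' = snoc c m) O.
- by rewrite /genuine; def.
- def.
- by split => //; exact: genuine0.
- move=> c [gc xc]; have [m hm] := step c gc xc; exists (snoc c m); last by exists m.
  by split => //; exact: genuine_snoc.
have [|u hu] := snoc_chain f0; first by move=> k; case: (hf k).
have [_] := sigmaP (a := move_of u) (t := u) (fun=> erefl); apply.
have {}hf k : inb x (sigma (pcode u k)) by rewrite hu; case: (hf k) => -[].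
exists x => k; case: (N_case k) => [->|[m ->]]; first by rewrite stage0; left.
have [h _] := sigmaP (a := move_of u) (t := u) (fun=> erefl).
have : inside (sigma (pcode u (S m))) (stage legalize (move_of u) u (S m)) := h (S m).
by move/inside_inb; apply; exact: hf.
Qed.
End BanachMazurI.

(** ** The meager part *)

Lemma meager_sub b b' : (forall x : X, inb x b' -> inb x b) -> meager b -> meager b'.
Proof. by move=> h [Phi [h1 h2]]; exists Phi; split => // x /h /h2. Qed.

(** Witnesses for all meager balls are combined into a single one. *)
Lemma locally_meager_thin : exists Phi, thin Phi /\
  forall x : X, locally_meager x -> exists n, outside Phi x n.
Proof.
pose R b (Phi : fn (N * N) N) := thin Phi /\
  (meager b -> forall x : X, inb x b -> exists n, outside Phi x n).
have [||F hF] := @countable_choice fr (fn (N * N) N) _ R.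
- by rewrite /R; def.
- move=> b; case: (pselect (meager b)) => [[Phi [h1 h2]]|h]; first by exists Phi.
  have hs : Dfun (fun p : N * N => shrink p.2) by rewrite /shrink; def.
  by exists (mkFn hs); split => // n g; exact: shrinkP.
have hPhi : Dfun (fun p : N * N => F (un p.1).1 ((un p.1).2, p.2)) by def.
exists (mkFn hPhi); split; first by move=> n g; case: (hF (un n).1) => h _; exact: h.
move=> x [b [xb mb]]; have [_ /(_ mb x xb) [n hn]] := hF b.
by exists (pr (b, n)) => g; rewrite /= prK; apply: hn.
Qed.

(** A dense sequence whose [n]-th term lies in the first [n] dense open sets; in
    particular its range meets each of the closed sets [outside Phi ^~ i] in
    finitely many points. *)
Lemma thin_sequence Phi : thin Phi -> exists D : fn N X, dense_seq D /\
  forall n i, leN i n -> exists g, inb (D n) (Phi (i, g)).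
Proof.
move=> hPhi.
have H b m : exists g, inside g b /\
    forall i, ltN i m -> exists g', inside g (Phi (i, g')) \/ g = Phi (i, g').
  move: m; apply: indN; first def; first by exists (shrink b); split => [|i /ltN0 //]; exact: shrinkP.
  move=> m [g [gb hg]]; exists (Phi (m, g)); split.
    exact: inside_trans (hPhi m g) gb.
  move=> i /ltNS [/hg [g' h]|->]; last by exists g; right.
  exists g'; left; case: h => [h|<-]; last exact: hPhi.
  exact: inside_trans (hPhi m g) h.
have [||D hD] := @countable_choice fr X _ (fun n x => inb x n /\
    forall i, leN i n -> exists g, inb x (Phi (i, g))).
- def.
- move=> n; have [g [gn hg]] := H n (S n); exists (cen g); split.
    exact: inside_inb gn (inb_cen g).
  move=> i /hg [g' h]; exists g'; case: h => [h|<-]; last exact: inb_cen.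
  exact: inside_inb h (inb_cen g).
exists D; split; last by move=> n; case: (hD n).
move=> x r r0; have [b [_ [_ hb]]] := nbhd_ball (inb0 x) r0.
by exists b; apply: hb; case: (hD b).
Qed.

(** A homeomorphism transports dense open sets; in the codes this is done by
    shrinking a ball into the source, entering the dense open set there and
    shrinking again so as to come back inside. *)
Lemma locally_meager_homeo (h h' : fn X X) : cancel h h' -> cancel h' h -> cont h -> cont h' ->
  forall x, locally_meager x -> locally_meager (h x).
Proof.
move=> hK h'K hc h'c x [b [xb [Phi [tPhi cPhi]]]].
have h'x : inb (h' (h x)) b by rewrite hK.
have [b' [_ [xb' hb']]] := cont_ball h'c h'x (inb0 _).
exists b'; split => //.
pose Q1 g b1 := forall y, inb y b1 -> inb (h y) g.
pose Q2 g b2 b3 := inside b3 g /\ forall y, inb y b3 -> inb (h' y) b2.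
pose b2 (p : N * N) := Phi (p.1, mu (Q1 p.2)).
have hPsi : Dfun (fun p : N * N => mu (Q2 p.2 (b2 p))).
  by rewrite /Q2 /b2 /Q1; def.
have Q1P g : Q1 g (mu (Q1 g)).
  apply: (@muP _ (Q1 g)); first by rewrite /Q1; def.
  have hg : inb (h (h' (cen g))) g by rewrite h'K; exact: inb_cen.
  by have [b1 [_ [_ hb1]]] := cont_ball hc hg (inb0 _); exists b1.
have Q2P n g : Q2 g (b2 (n, g)) (mu (Q2 g (b2 (n, g)))).
  apply: (@muP _ (Q2 g (b2 (n, g)))); first by rewrite /Q2 /b2 /Q1; def.
  pose y := cen (b2 (n, g)).
  have yg : inb (h y) g by apply: (Q1P g); exact: inside_inb (tPhi _ _) (inb_cen _).
  have hy : inb (h' (h y)) (b2 (n, g)) by rewrite hK; exact: inb_cen.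
  by have [b3 [h1 [_ h2]]] := cont_ball h'c hy yg; exists b3.
exists (mkFn hPsi); split; first by move=> n g; case: (Q2P n g).
move=> y /hb' /cPhi [n hn]; exists n => g; rewrite /= => hy.
by have [_ /(_ _ hy)] := Q2P n g; exact: hn.
Qed.

(** ** Perfect set games *)

(** Player I plays two disjoint meager balls, coded as a pair, and player II chooses
    one of them. *)
Definition select (p : N * N) : N := ite (p.2 = O) (un p.1).1 (un p.1).2.
Lemma pick_Dfun : Dfun select. Proof. by rewrite /select; def. Qed.
Definition pick := mkFn pick_Dfun.

Definition split_rule (p : N * N) :=
  (inside (un p.2).1 p.1 /\ inside (un p.2).2 p.1) /\
  (meager (un p.2).1 /\ meager (un p.2).2) /\
  forall x : X, inb x (un p.2).1 -> ~ inb x (un p.2).2.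
Lemma splitting_Def : Def split_rule. Proof. by rewrite /split_rule; def. Qed.
Definition splitting := mkPw splitting_Def.

Lemma pick_inside g m n : split_rule (g, m) -> inside (pick (m, n)) g.
Proof.
move=> [[h1 h2] _]; rewrite /pick /= /select /=.
by case: (pselect (n = O)) => h; [rewrite iteT | rewrite iteF].
Qed.
Lemma pick_meager g m n : split_rule (g, m) -> meager (pick (m, n)).
Proof.
move=> [_ [[h1 h2] _]]; rewrite /pick /= /select /=.
by case: (pselect (n = O)) => h; [rewrite iteT | rewrite iteF].
Qed.

Section PerfectSetII.
Context (tau : seqN)
  (tauP : forall a t, (forall k, t k = tau (pcode a (S k))) ->
    ~ (legal splitting pick a t /\ common_point (stage pick a t))).

(** The ball that player II, following [tau], has chosen when [c] codes the moves
    of player I. *)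
Definition chosen_ball c := ite (c = O) O (pick (last c, tau c)).
Lemma chosen_ballS c m : chosen_ball (snoc c m) = pick (m, tau (snoc c m)).
Proof. by rewrite /chosen_ball iteF ?last_snoc //; exact: snoc_neq0. Qed.
Lemma chosen_ball0 : chosen_ball O = O. Proof. by rewrite /chosen_ball iteT. Qed.

Definition stuck c x := inb x (chosen_ball c) /\
  forall m, split_rule (chosen_ball c, m) -> ~ inb x (chosen_ball (snoc c m)).

(** If player I could always continue with the point [x] in the chosen ball, player
    II would lose that run. *)
Lemma locally_meager_stuck x : locally_meager x -> exists c, stuck c x.
Proof.
move=> mx; apply: contrapT => no.
have [||||f f0 hf] := @dep_choice _ _ _ (fun c => inb x (chosen_ball c))
  (fun c c' => exists m, c' = snoc c m /\ split_rule (chosen_ball c, m)) O.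
- by rewrite /chosen_ball; def.
- rewrite /chosen_ball /split_rule; have hm : Def meager by def.
  def.
- by rewrite chosen_ball0; left.
- move=> c xc; apply: contrapT => hm; apply: no; exists c; split => // m cm xm.
  by apply: hm; exists (snoc c m) => //; exists m.
have [|a ha] := snoc_chain f0; first by move=> k; have [_ [m [? _]]] := hf k; exists m.
have ht : Dfun (fun k => tau (pcode a (S k))) by def.
pose t := mkFn ht.
have st k : stage pick a t k = chosen_ball (pcode a k).
  case: (N_case k) => [->|[m ->]]; first by rewrite stage0 pcode0 chosen_ball0.
  by rewrite stageS pcodeS chosen_ballS -pcodeS.
apply: (@tauP a t) => //; split.
  move=> k; rewrite st ha; have [_ [m [e h]]] := hf k.
  by move: e; rewrite -!ha pcodeS => /snoc_inj [_ ->]; rewrite ha.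
by exists x => k; rewrite st ha; case: (hf k).
Qed.

(** Two points which are stuck at the same position could be separated by the next
    move of player I; whichever ball player II chooses, one of them is not stuck. *)
Lemma stuck_uniq c x y : locally_meager x -> locally_meager y -> stuck c x -> stuck c y -> x = y.
Proof.
move=> [bx [xbx mx]] [bY [yby my]] [xc sx] [yc sy]; apply: contrapT => xy.
have [r [r0 hr]] := inb_sep xy.
have [g1 [g1c [g1x x1]]] := common_ball xc xbx.
have [g2 [g2c [g2y y2]]] := common_ball yc yby.
have [l [l1 xl _ lr]] := small_ball O x1 r0.
have [l' [l1' yl _ lr']] := small_ball O y2 r0.
have rule : split_rule (chosen_ball c, pr (l, l')).
  rewrite /split_rule /= prK /=; split; first by split; [exact: inside_trans l1 g1c|
    exact: inside_trans l1' g2c].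
  split; last exact: hr xl yl (proj1 l1) (proj1 l1') lr lr'.
  split.
    apply: meager_sub mx => z /(inside_inb l1); exact: inside_inb g1x.
  apply: meager_sub my => z /(inside_inb l1'); exact: inside_inb g2y.
have := sx _ rule; have := sy _ rule; rewrite !chosen_ballS /pick /= /select /= prK /=.
by case: (pselect (tau (snoc c (pr (l, l'))) = O)) => h;
  [rewrite iteT | rewrite iteF].
Qed.

Lemma locally_meager_countable : exists E : fn N X, forall x, locally_meager x -> exists n, E n = x.
Proof.
have [||E hE] := @countable_choice _ X _ (fun c x => (exists y, locally_meager y /\ stuck c y) ->
    locally_meager x /\ stuck c x).
- rewrite /stuck /locally_meager /split_rule /chosen_ball; have hm : Def meager by def.
  def.
- move=> c; case: (pselect (exists y, locally_meager y /\ stuck c y)) => [[y hy]|h].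
    by exists y.
  by exists (q O).
exists E => x mx; have [c cx] := locally_meager_stuck mx; exists c.
have [|m1 s1] := hE c; first by exists x.
exact: stuck_uniq s1 cx.
Qed.
End PerfectSetII.

Definition merge (E F : fn N X) n : X := ite ((un n).1 = O) (E (un n).2) (F (un n).2).
Lemma ex_merge (E F : fn N X) : exists G : fn N X, (forall n, G n = merge E F n) /\
  (forall n, exists m, G m = E n) /\ (forall n, exists m, G m = F n).
Proof.
have h : Dfun (merge E F) by rewrite /merge; def.
exists (mkFn h); split => //; split => n.
  by exists (pr (O, n)); rewrite /= /merge prK /= iteT.
by exists (pr (S O, n)); rewrite /= /merge prK /= iteF //; exact: S_neq0.
Qed.

Lemma ex_dense_merge (E : fn N X) : exists G : fn N X,
  dense_seq G /\ forall n, exists m, G m = E n.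
Proof.
have [G [_ [h1 h2]]] := ex_merge E q; exists G; split => // x r r0.
by have [n hn] := q_dense x r0; have [m hm] := h2 n; exists m; rewrite hm.
Qed.

Section CDH.
Context (hcdh : cdh X).

(** A locally meager point [p] is not isolated, so some dense sequence avoids [p]; the
    homeomorphism that sends it onto a dense sequence through all locally meager
    points sends [p] to one of these, which is a term of the sequence. *)
Lemma locally_meager_uncountable (E : fn N X) : (forall x, locally_meager x -> exists n, E n = x) ->
  forall x, ~ locally_meager x.
Proof.
move=> hE p mp; have [Phi [tPhi cPhi]] := locally_meager_thin.
have [D hD] : exists D : fn N X, forall n, inb (D n) n /\ D n <> p.
  apply: (@countable_choice fr X _ (fun n x => inb x n /\ x <> p)); first def.
  move=> n; apply: contrapT => no; have [i /(_ n)] := cPhi p mp; apply.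
  have -> : p = cen (Phi (i, n)).
    apply: contrapT => h; apply: no; exists (cen (Phi (i, n))); split; last exact/nesym.
    exact: inside_inb (tPhi _ _) (inb_cen _).
  exact: inb_cen.
have dD : dense_seq D.
  move=> x r r0; have [b [_ [_ hb]]] := nbhd_ball (inb0 x) r0.
  by exists b; apply: hb; case: (hD b).
have [G [dG EG]] := ex_dense_merge E.
have [h [h' [hK h'K hc h'c [_ hG]]]] := hcdh dD dG.
have [n en] := hE _ (locally_meager_homeo hK h'K hc h'c mp).
have [m em] := EG n; have [l el] := hG m.
by have [_] := hD l; apply; apply: (can_inj hK); rewrite el em en.
Qed.

Section PerfectSetI.
Context (sigma : seqN)
  (sigmaP : forall a t, (forall k, a k = sigma (pcode t k)) ->
    legal splitting pick a t /\ common_point (stage pick a t)).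

Let move_of t : seqN := mkFn (Dfun_comp (Fn_Dfun (pcode t)) (Fn_Dfun sigma)).

(** The ball reached when player I follows [sigma] and [c] codes the choices of
    player II. *)
Definition branch_ball c := ite (c = O) O (pick (sigma (prev c), last c)).
Lemma branch_ballS c m : branch_ball (snoc c m) = pick (sigma c, m).
Proof. by rewrite /branch_ball iteF ?last_snoc ?prev_snoc //; exact: snoc_neq0. Qed.
Lemma branch_ball0 : branch_ball O = O. Proof. by rewrite /branch_ball iteT. Qed.

Lemma stage_branch_ball t k : stage pick (move_of t) t k = branch_ball (pcode t k).
Proof.
case: (N_case k) => [->|[m ->]]; first by rewrite stage0 pcode0 branch_ball0.
by rewrite stageS pcodeS branch_ballS.
Qed.

Lemma sigma_rule c : genuine c -> split_rule (branch_ball c, sigma c).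
Proof.
move=> [u [n ->]]; have [h _] := sigmaP (a := move_of u) (t := u) (fun=> erefl).
by have := h n; rewrite stage_branch_ball.
Qed.

Lemma branch_ball_inside c m : genuine c -> inside (branch_ball (snoc c m)) (branch_ball c).
Proof. by move=> /sigma_rule h; rewrite branch_ballS; exact: pick_inside. Qed.

Lemma branch t : exists x : X, forall k, inb x (branch_ball (pcode t k)).
Proof.
have [_ [x hx]] := sigmaP (a := move_of t) (t := t) (fun=> erefl).
by exists x => k; rewrite -stage_branch_ball.
Qed.
Lemma branch_ball_Dfun : Dfun branch_ball.
Proof. by rewrite /branch_ball /prev /last; def. Qed.

Let balls t : seqN := mkFn (Dfun_comp (Fn_Dfun (pcode t)) branch_ball_Dfun).

Lemma balls_inside t k : inside (balls t (S k)) (balls t k).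
Proof.
change (inside (branch_ball (pcode t (S k))) (branch_ball (pcode t k))).
by rewrite pcodeS; apply: branch_ball_inside; exists t, k.
Qed.

Lemma branch_ball_mono t l m x : leN l m ->
  inb x (branch_ball (pcode t m)) -> inb x (branch_ball (pcode t l)).
Proof. exact: (descending_mono (balls_inside t)). Qed.

Lemma branch_nbhd t x r : (forall k, inb x (branch_ball (pcode t k))) -> 0 < r ->
  exists l, forall m, leN l m -> forall y, inb y (branch_ball (pcode t m)) -> dist x y < r.
Proof. exact: (descending_small (balls_inside t)). Qed.

(** The branches form a perfect set [C] of locally meager points.  Let [E c] be the
    branch that continues the position [c] with zeros, and let the homeomorphism
    [h] send a sequence [D] as in [thin_sequence] onto a sequence through all the
    points [E c].  Given a position, player II can avoid the points [h (D i)] with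
    [i < k]; then the next [E c] is some [h (D i)] with [i >= k], and a later ball
    around it is mapped by [h'] into the [k]-th dense open set.  In the limit this
    gives a branch [x] such that [h' x] lies in all these dense open sets, although
    [h' x] is locally meager. *)
Lemma perfect_set_absurd : False.
Proof.
have [E hE] : exists E : fn N X, forall c, genuine c -> exists (u : seqN) n,
    c = pcode u n /\ (forall i, leN n i -> u i = O) /\ forall k, inb (E c) (branch_ball (pcode u k)).
  apply: (@countable_choice fr X _ (fun c x => genuine c -> exists (u : seqN) n,
    c = pcode u n /\ (forall i, leN n i -> u i = O) /\ forall k, inb x (branch_ball (pcode u k)))).
    by rewrite /genuine /branch_ball; def.
  move=> c; case: (pselect (genuine c)) => [[v [n ->]]|h]; last by exists (q O).
  have hu : Dfun (fun i => ite (ltN i n) (v i) O) by def.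
  have [x hx] := branch (mkFn hu).
  exists x => _; exists (mkFn hu), n; split.
    by apply: pcode_eq => i hi; rewrite /= iteT.
  by split => // i /leNNgt hi; rewrite /= iteF.
have [Phi [tPhi cPhi]] := locally_meager_thin; have [D [dD hD]] := thin_sequence tPhi.
have [G [dG EG]] := ex_dense_merge E.
have [h [h' [hK h'K hc h'c [_ hG]]]] := hcdh dD dG.
pose U k c := forall y, inb y (branch_ball c) -> exists g, inb (h' y) (Phi (k, g)).
pose P (p : N * N) := genuine p.2 /\ forall i, ltN i p.1 -> ~ inb (h (D i)) (branch_ball p.2).
pose R (p p' : N * N) := p'.1 = S p.1 /\ ext p.2 p'.2 /\ U p.1 p'.2.
have [||||f f0 hf] := @dep_choice _ _ _ P R (O, O).
- by rewrite /P /genuine /branch_ball; def.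
- by rewrite /R /U /branch_ball; def.
- by split => [|i /ltN0 //]; exact: genuine0.
- move=> [k s] [gs hs].
  have [m hm] : exists m, ~ inb (h (D k)) (branch_ball (snoc s m)).
    apply: contrapT => no; have [_ [_ dj]] := sigma_rule gs.
    have in1 m : inb (h (D k)) (branch_ball (snoc s m)).
      by apply: contrapT => hm; apply: no; exists m.
    have := dj (h (D k)); apply.
      by have := in1 O; rewrite branch_ballS /pick /= /select /= iteT.
    by have := in1 (S O); rewrite branch_ballS /pick /= /select /= iteF //; exact: S_neq0.
  have [u [n [e1 [_ hx]]]] := hE _ (genuine_snoc m gs).
  set x := E (snoc s m) in hx *.
  have [j ej] := EG (snoc s m); have [i ei] := hG j.
  have ki : leN k i.
    apply/leNNgt => ik; apply: (hs i ik); rewrite ei ej.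
    by apply: inside_inb (branch_ball_inside m gs) _; move: (hx n); rewrite -e1.
  have [g hg] := hD i k ki.
  have xg : inb (h' x) (Phi (k, g)) by rewrite /x -ej -ei hK.
  have [b' [_ [/inb_open [r [r0 hr]] hb']]] := cont_ball h'c xg (inb0 _).
  have [l hl] := branch_nbhd hx r0.
  have [n' en] : exists n', n = S n' /\ s = pcode u n'.
    case: (N_case n) e1 => [->|[n' ->]]; first by rewrite pcode0 => /snoc_neq0.
    by rewrite pcodeS => /snoc_inj [e _]; exists n'.
  have [L [nL lL]] := ex_leN2 n l.
  exists (S k, pcode u L); split => /=.
  - by exists u, L.
  - move=> i' hi /(branch_ball_mono nL); rewrite -e1 => hin.
    case/ltNS: hi => [hi|e]; last by apply: hm; rewrite -e.
    exact: (hs i' hi) (inside_inb (branch_ball_inside m gs) hin).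
  - by [].
  - split; first exists u, n', L.
      case: en => en ->; split; last by [].
      by apply: ltN_leN_trans nL; rewrite en; exact: ltNSn.
    by move=> y /(hl L lL) /hr /hb' hy; exists g.
have f1 k : (f k).1 = k.
  by move: k; apply: indN; [def | rewrite f0 | move=> k IH; have [_ [-> _]] := hf k; rewrite IH].
have hs : Dfun (fun k => (f k).2) by def.
have [||u hu] := @chain fr (mkFn hs); first by rewrite /= f0.
  by move=> k; have [_ [_ []]] := hf k.
have [x hx] := branch u.
have xU k : exists g, inb (h' x) (Phi (k, g)).
  have [_ [_ [_ hU]]] := hf k; rewrite f1 in hU; apply: hU.
  by have [n _ e] := hu (S k); rewrite (e : (f (S k)).2 = _).
have mx : locally_meager x.
  exists (branch_ball (pcode u (S O))); split; first exact: hx.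
  by rewrite pcodeS branch_ballS; apply: pick_meager (sigma_rule _); exists u, O.
have [i hi] := cPhi _ (locally_meager_homeo h'K hK h'c hc mx).
by have [g] := xU i; exact: hi.
Qed.
End PerfectSetI.
End CDH.
End Games.

End BallGames.

Module WadgeGames.
Import Order.TTheory GRing.Theory Num.Theory.
Import Definability Coding Balls BallGames.
Local Open Scope ring_scope.

(** * Wadge games *)

Section Wadge.
Context {fr : frame} {X : mspace fr}.
Notation N := (N fr).
Notation K := (K fr).
Notation fn A B := (@Fn fr A B _ _).
Notation seqN := (fn N N).
Implicit Types (n m k i j c g b : N) (a t u s : seqN) (x y z : X).
Notation cen := (cen X).
Notation inside := (inside X).
Notation nested := (nested X).
Notation meager := (meager X).
Notation thin := (thin X).
Notation common_point := (common_point X).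
Notation legalize := (legalize (X := X)).
Notation nest_rule := (nest_rule (X := X)).

Definition fstN : fn (N * N) N := mkFn (@Dfun_fst fr N N _ _).

Lemma stage_fst a t k : stage fstN a t (S k) = a k.
Proof. by rewrite stageS. Qed.

Section WadgeI.
Context (sigma : seqN)
  (sigmaP : forall a t, (forall k, a k = sigma (pcode t k)) ->
    legal nest_rule fstN a t /\ (zero_tail t <-> common_point (stage fstN a t))).

Let move_of t : seqN := mkFn (Dfun_comp (Fn_Dfun (pcode t)) (Fn_Dfun sigma)).

Lemma move_inside t k : inside (move_of t (S k)) (move_of t k).
Proof.
have [h _] := sigmaP (a := move_of t) (t := t) (fun=> erefl).
by have := h (S k); rewrite stage_fst.
Qed.

Lemma sigma_desc c m : genuine c -> inside (sigma (snoc c m)) (sigma c).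
Proof.
move=> [u [n ->]]; have [u' [<- hu]] := pcode_snoc u n m.
have -> : pcode u n = pcode u' n by apply: pcode_eq => i hi; rewrite hu.
exact: move_inside.
Qed.

(** Player I reduces the set of the sequences with a zero tail, which plays the part of
    the rationals, to the space. *)
Lemma zero_tail_common_point t : zero_tail t <-> exists x, forall k, inb x (sigma (pcode t k)).
Proof.
have [_ ->] := sigmaP (a := move_of t) (t := t) (fun=> erefl); split=> [[x hx]|[x hx]].
  by exists x => k; have := hx (S k); rewrite stage_fst.
exists x => k; case: (N_case k) => [->|[m ->]]; first by rewrite stage0; left.
by rewrite stage_fst; exact: hx.
Qed.

(** [E c] is the point that player I reaches when player II continues the
    position [c] with zeros. *)
Lemma zero_points : exists E : fn N X, forall c, genuine c -> exists u n,
  c = pcode u n /\ forall k, inb (E c) (sigma (pcode u k)).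
Proof.
apply: (@countable_choice fr X _ (fun c x => genuine c -> exists u n,
    c = pcode u n /\ forall k, inb x (sigma (pcode u k)))).
  by rewrite /genuine; def.
move=> c; case: (pselect (genuine c)) => [[v [n ->]]|h]; last by exists (q O).
have hu : Dfun (fun i => ite (ltN i n) (v i) O) by def.
have [|x hx] := (zero_tail_common_point (mkFn hu)).1.
  by exists n => i /leNNgt hi; rewrite /= iteF.
exists x => _; exists (mkFn hu), n; split => //.
by apply: pcode_eq => i hi; rewrite /= iteT.
Qed.

Section Fusion.
Context (hcdh : cdh X) (tau : seqN)
  (tauP : forall a t, (forall k, t k = tau (pcode a (S k))) ->
    ~ (legal nest_rule legalize a t /\ ~ common_point (stage legalize a t))).
Notation bm_ball := (bm_ball (X := X) tau).
Notation valid := (valid (X := X) tau).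

(** The homeomorphism [h] sends generic points to the points [E c]; so a run of
    the Wadge game and a run of the Banach-Mazur game can be built together, the
    balls of the second one being traced by [h'] from those of the first one.
    Player II wins the latter, which puts the point of the former into the space;
    but player II has played infinitely many nonzero moves there. *)
Lemma wadge_absurd : False.
Proof.
have [E hE] := zero_points.
have [D [dD gD]] := generic_sequence tauP.
have [G [dG EG]] := ex_dense_merge E.
have [h [h' [hK h'K hc h'c [_ hG]]]] := hcdh dD dG.
pose maps (s c : N) := forall y, inb y (sigma s) -> inb (h' y) (bm_ball c).
pose P (p : N * N) := genuine p.1 /\ valid p.2 /\ inb (h' (E p.1)) (bm_ball p.2) /\ maps p.1 p.2.
pose grows (s s' : N) := exists (u : seqN) n m, (ltN n m /\ s = pcode u n /\ s' = pcode u m) /\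
  exists i, leN n i /\ ltN i m /\ u i <> O.
pose R (p p' : N * N) := grows p.1 p'.1 /\
  exists m, p'.2 = snoc p.2 m /\ inside m (bm_ball p.2).
have hB : Dfun bm_ball by rewrite /bm_ball; def.
have hvalid : Def valid by rewrite /valid; def.
have [||||f f0 hf] := @dep_choice _ _ _ P R (O, O).
- by rewrite /P /maps /genuine; def.
- by rewrite /R /grows; def.
- split; first exact: genuine0.
  split; first exact: valid0.
  by rewrite /maps /= bm_ball0; split => [|y _]; left.
- move=> [s c] [/= gs [vc [xc _]]].
  have [j ej] := EG s; have [i ei] := hG j.
  have eD : D i = h' (E s) by rewrite -ej -ei hK.
  have := gD i c vc; rewrite eD => /(_ xc) [m [mc xm]].
  have [b' [_ [/inb_open [r [r0 hr]] hb']]] := cont_ball h'c xm (inb0 _).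
  have [u [n [es hx]]] := hE s gs.
  have [l hl] := descending_small (move_inside u) hx r0.
  have [L [nL lL]] := ex_leN2 n l.
  have [u' [eu' hu']] := pcode_snoc u L (S O).
  have eL : pcode u' L = pcode u L /\ u' L = S O.
    by move: eu'; rewrite pcodeS => /snoc_inj.
  have en : pcode u' n = pcode u n.
    by apply: pcode_eq => i' hi'; apply: hu'; exact: ltN_leN_trans hi' nL.
  have mp : maps (pcode u' (S L)) (snoc c m).
    move=> y hy; apply: hb'; apply: hr; apply: (hl L lL).
    by apply: inside_inb hy; rewrite eu'; apply: sigma_desc; exists u, L.
  exists (pcode u' (S L), snoc c m); last first.
    split; last by exists m.
    exists u', n, (S L); split.
      by split; [exact: leN_ltN_trans nL (ltNSn L) | rewrite es en].
    by exists L; split => //; split => //; rewrite (proj2 eL); exact: S_neq0.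
  have gs' : genuine (pcode u' (S L)) by exists u', (S L).
  split => //; split; first exact: valid_snoc.
  split => //; apply: mp; have [v [k [ev hv]]] := hE _ gs'.
  by rewrite {2}ev; exact: hv.
have hc1 : Dfun (fun k => (f k).2) by def.
have hs1 : Dfun (fun k => (f k).1) by def.
have [||x hx] := bm_chain tauP (s := mkFn hc1); first by rewrite /= f0.
  by move=> k; have [_ [_ [m hm]]] := hf k; exists m.
have [||u hu] := @chain fr (mkFn hs1); first by rewrite /= f0.
  by move=> k; have [_ [[v [n [m [h1 _]]]] _]] := hf k; exists v, n, m.
have hBk : Dfun (fun k => bm_ball (f k).2) by def.
have descB k : inside (mkFn hBk (S k)) (mkFn hBk k).
  have [_ [_ [m [e hm]]]] := hf k; rewrite /= /fapp /= -!/(fapp _ _) e.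
  exact: inside_trans (bm_ball_inside _ _ _) hm.
have hz k : inb (h x) (sigma (pcode u k)).
  apply: (inb_closed (move_inside u k)) => r r0.
  have [d [d0 hd]] := hc x r r0.
  have [l hl] := descending_small descB hx d0.
  have [j [lj kj]] := ex_leN2 l (S k).
  have [[gj [_ [xj _]]] _] := hf j.
  have [n jn en] := hu j.
  exists (E (f j).1); split.
    apply: (descending_mono (move_inside u) (m := n)); first exact: leN_trans kj jn.
    have [v [n' [ev hv]]] := hE _ gj.
    by change (inb (E (f j).1) (sigma (pcode u n))); rewrite -en; have := hv n'; rewrite -ev.
  rewrite -[E _]h'K; apply: hd; exact: (hl j lj).
have [n0 hn0] := (zero_tail_common_point u).2 (ex_intro _ _ hz).
have [_ [[v [n [m [[nm [e1 e2]] [i [ni [im vi]]]]]]] _]] := hf n0; apply: vi.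
have [n1 h1 e3] := hu n0; have [m1 _ e4] := hu (S n0).
have /pcode_inj [en _] : pcode v n = pcode u n1 by rewrite -e1 -e3.
have /pcode_inj [_ ev] : pcode v m = pcode u m1 by rewrite -e2 -e4.
by rewrite ev //; apply: hn0; apply: leN_trans ni; rewrite en.
Qed.
End Fusion.
End WadgeI.

Section WadgeII.
Context (tau : seqN)
  (tauP : forall a t, (forall k, t k = tau (pcode a (S k))) ->
    ~ (legal nest_rule fstN a t /\ (zero_tail t <-> common_point (stage fstN a t)))).

Definition tip c := ite (c = O) O (last c).
Lemma tip0 : tip O = O. Proof. by rewrite /tip iteT. Qed.
Lemma tipS c m : tip (snoc c m) = m.
Proof. by rewrite /tip iteF ?last_snoc //; exact: snoc_neq0. Qed.

Definition descends c := exists a k, c = pcode a k /\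
  forall i, ltN i k -> inside (a i) (tip (pcode a i)).
Definition hit c c' := ext c c' /\ descends c' /\ tau c' <> O.

Lemma hit_neq0 c c' : hit c c' -> tip c' <> O.
Proof.
move=> [[u [n [m [nm [_ e]]]]] [[a [k [e' ha]]] _]]; rewrite e'.
have ek : k = m by move: e'; rewrite e => /pcode_inj [].
case: (N_case k) => [e0|[k' ek']]; first by move: nm; rewrite -ek e0 => /ltN0.
have hk : ltN k' k by rewrite ek'; exact: ltNSn.
by rewrite ek' pcodeS tipS; have [] := ha k' hk.
Qed.

(** For player II following [tau], the balls of player I have a common point in the
    space exactly when infinitely many answers are nonzero; this makes the space a
    G-delta set in its completion. *)
Lemma wadge_run a : (forall k, inside (a k) (tip (pcode a k))) ->
  (forall n, exists k, leN n k /\ tau (pcode a (S k)) <> O) <->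
  exists x, forall k, inb x (a k).
Proof.
move=> ha; have ht : Dfun (fun k => tau (pcode a (S k))) by def.
pose t := mkFn ht.
have st k : stage fstN a t k = tip (pcode a k).
  case: (N_case k) => [->|[m ->]]; first by rewrite stage0 pcode0 tip0.
  by rewrite stage_fst pcodeS tipS.
have lg : legal nest_rule fstN a t by move=> k; rewrite st; exact: (ha k).
have eX : common_point (stage fstN a t) <-> exists x, forall k, inb x (a k).
  split=> [[x hx]|[x hx]]; exists x => k; first by rewrite -(stage_fst a t); exact: hx.
  by case: (N_case k) => [->|[m ->]]; rewrite ?stage0 ?stage_fst //; left.
have := @tauP a t (fun=> erefl); rewrite -eX => nP.
have nz : (forall n, exists k, leN n k /\ tau (pcode a (S k)) <> O) <-> ~ zero_tail t.
  split=> [hn [n hz]|hz n]; first by have [k [nk]] := hn n; apply; exact: (hz k nk).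
  apply: contrapT => no; apply: hz; exists n => k nk.
  by apply: contrapT => h; apply: no; exists k.
rewrite nz; split => h; last by move=> hz; apply: nP.
by apply: contrapT => h'; apply: nP; split => //; split => [/h|/h'].
Qed.

(** The hits after [c] are the positions where player II has answered with a further
    nonzero move; their balls form an open set, which contains the points of the
    space in [tip c] by [wadge_run]. *)
Lemma next_hit c x : descends c -> inb x (tip c) -> exists c', hit c c' /\ inb x (tip c').
Proof.
move=> [a0 [k0 [-> ha0]]] x0.
have hst : Dfun (fun p : N * N => ite (ltN p.1 k0) (a0 p.1)
    (mu (fun b => inside b (tip p.2) /\ inb x b))) by rewrite /tip; def.
have [a ea] := run hst.
have agree k : leN k k0 -> pcode a k = pcode a0 k.
  move=> hk; apply: pcode_eq => i hi; rewrite ea /= iteT //.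
  exact: ltN_leN_trans hi hk.
have tail k : leN k0 k -> inb x (tip (pcode a k)) ->
    inside (a k) (tip (pcode a k)) /\ inb x (a k).
  move=> /leNNgt hk hx; rewrite ea /= iteF //.
  apply: (@muP _ (fun b => inside b (tip (pcode a k)) /\ inb x b)); first by rewrite /tip; def.
  exact: sub_ball.
have inx : forall k, leN k0 k -> inb x (tip (pcode a k)).
  apply: indN; first by rewrite /tip; def.
    by move=> _; rewrite pcode0 tip0; left.
  move=> k IH /leN_eqVlt [h|<-]; last by rewrite agree //; exact: leNn.
  by have [_] := tail k h (IH h); rewrite pcodeS tipS.
have ha k : inside (a k) (tip (pcode a k)).
  case: (pselect (ltN k k0)) => hk; last by case: (tail k) => //; [exact/leNNgt|apply: inx; exact/leNNgt].
  by rewrite agree; [rewrite ea /= iteT //; exact: ha0 | exact: ltNW].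
have desc k : inside (a (S k)) (a k) by have := ha (S k); rewrite pcodeS tipS.
have xa k : inb x (a k).
  case: (pselect (ltN k k0)) => hk; last first.
    by case: (tail k) => //; [exact/leNNgt|apply: inx; exact/leNNgt].
  apply: (descending_mono desc (ltNW hk)).
  by case: (tail k0 (leNn _) (inx _ (leNn _))).
have [k [hk tk]] := (wadge_run ha).2 (ex_intro _ x xa) k0.
exists (pcode a (S k)); split; last by rewrite pcodeS tipS.
split; last by split => //; exists a, (S k).
by exists a, k0, (S k); split => //; rewrite agree //; exact: leNn.
Qed.

(** The margin [r] makes this property stable under small changes of [v]. *)
Definition settles (v : fn N X) b := exists r, 0 < r /\ exists n0, forall n, leN n0 n ->
  b = O \/ dist (v n) (cen b) + r < rad b.

Lemma settles_inb v b : settles v b -> exists n0, forall n, leN n0 n -> inb (v n) b.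
Proof.
move=> [r [r0 [n0 h]]]; exists n0 => n /h [->|hn]; first by left.
by right; lra.
Qed.

(** The converse of [next_hit] in the completion: a sequence that keeps passing through
    hits traces a run in which player II answers infinitely often with nonzero
    moves, so that the balls of the run have a common point. *)
Lemma hits_converge (v : fn N X) :
  (forall c, descends c -> settles v (tip c) -> exists c', hit c c' /\ settles v (tip c')) ->
  exists x, forall r, 0 < r -> exists n0, forall n, leN n0 n -> dist x (v n) < r.
Proof.
move=> hv.
have [||||f f0 hf] := @dep_choice fr N _ (fun c => descends c /\ settles v (tip c)) hit O.
- by rewrite /descends /settles /tip; def.
- by rewrite /hit /descends /tip; def.
- split; first by exists (mkFn (Dfun_id _)), O; rewrite pcode0; split => // i /ltN0.
  exists 1; split => //; exists O => n _; left; exact: tip0.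
- move=> c [dc sc]; have [c' [h1 h2]] := hv c dc sc; exists c' => //.
  by split => //; case: h1 => _ [].
have [|a ha] := chain f0; first by move=> k; case: (hf k) => _ [].
have desc k n : f k = pcode a n -> forall i, ltN i n -> inside (a i) (tip (pcode a i)).
  move=> e i hi; have [[[a1 [n1 [e1 h1]]] _] _] := hf k.
  have [en ea] : n1 = n /\ forall i, ltN i n1 -> a1 i = a i.
    by apply: pcode_inj; rewrite -e1 -e.
  rewrite -ea ?en // (_ : pcode a i = pcode a1 i).
    by apply: h1; rewrite en.
  by apply: pcode_eq => j hj; rewrite ea // en; exact: ltN_trans hj hi.
have {}desc i : inside (a i) (tip (pcode a i)).
  have [n hn e] := ha (S i); exact: (desc _ _ e i (ltNSS_inv hn)).
have descS k : inside (a (S k)) (a k) by have := desc (S k); rewrite pcodeS tipS.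
have [|x hx] := (wadge_run desc).1.
  move=> n; have [m hm e] := ha (S n); have [_ [_ [_ tn]]] := hf n.
  case: (N_case m) hm e => [->|[k ->]] hm e; first by case: (ltN0 (ltNSS_inv hm)).
  by exists k; split; [exact: ltNSS_inv | rewrite -e].
exists x => r r0; have [l hl] := descending_small descS hx r0.
have [m hm e] := ha (S l); case: (N_case m) hm e => [->|[k ->]] hm e; first by case: (ltN0 (ltNSS_inv hm)).
have [[_ sl] _] := hf (S l); have [n0 hn0] := settles_inb sl.
exists n0 => n /hn0; rewrite e pcodeS tipS => /hl; apply; exact: ltNSS_inv.
Qed.
End WadgeII.
End Wadge.

End WadgeGames.

Module CompleteMetrics.
Import Order.TTheory GRing.Theory Num.Theory.
Import Definability Coding Balls BallGames WadgeGames.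
Local Open Scope ring_scope.

(** * Complete metrics *)

Section Suprema.
Context {fr : frame}.
Notation K := (K fr).

Definition islub (P : K -> Prop) b :=
  (forall x, P x -> x <= b) /\ forall c, (forall x, P x -> x <= c) -> b <= c.
Definition supK (P : K -> Prop) : K :=
  if pselect (exists b, islub P b) is left h then projT1 (cid h) else 0.

Lemma supK_lub (P : K -> Prop) : (exists b, islub P b) -> islub P (supK P).
Proof. by move=> h; rewrite /supK; case: pselect => // h'; case: cid. Qed.

Lemma supKP (P : K -> Prop) : Def P -> (exists x, P x) ->
  (exists b, forall x, P x -> x <= b) -> islub P (supK P).
Proof. by move=> hP h1 h2; apply: supK_lub; have [b] := lubK hP h1 h2; exists b. Qed.

Lemma islub_uniq (P : K -> Prop) a b : islub P a -> islub P b -> a = b.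
Proof. by move=> [a1 a2] [b1 b2]; apply/eqP; rewrite eq_le a2 // b2. Qed.

Lemma Dfun_sup A (sA : sort fr A) (P : A -> K -> Prop) :
  Def (fun p => P p.1 p.2) -> Dfun (fun a => supK (P a)).
Proof.
move=> hP; apply: (Dfun_graph (R := fun (a : A) (b : K) => islub (P a) b \/
   (~ (exists c, islub (P a) c) /\ b = 0))).
  move=> a n; split => [[h|[h ->]]|->].
  - by exact: (islub_uniq h (supK_lub (ex_intro _ n h))).
  - by rewrite /supK; case: pselect.
  - case: (pselect (exists m, islub (P a) m)) => h; first by left; exact: supK_lub.
    by right; split => //; rewrite /supK; case: pselect.
by rewrite /islub; def.
Qed.

Lemma Dfun_inv A (sA : sort fr A) (f : A -> K) : Dfun f -> Dfun (fun a => (f a)^-1).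
Proof.
move=> hf; apply: (Dfun_graph (R := fun (a : A) (b : K) =>
  (f a = 0 /\ b = 0) \/ f a * b = 1)); last def.
move=> a b; split=> [[[-> ->]|h]|->]; first by rewrite invr0.
  have f0 : f a != 0 by apply/eqP => e; move: h; rewrite e mul0r => /esym/eqP; rewrite oner_eq0.
  by apply: (mulfI f0); rewrite h divff.
by case: (eqVneq (f a) 0) => [->|h]; [left; rewrite invr0 | right; rewrite divff].
Qed.
End Suprema.

Section Metrizable.
Context {fr : frame} (X : mspace fr).
Notation N := (N fr).
Notation K := (K fr).
Notation fn A B := (@Fn fr A B _ _).
Notation seqN := (fn N N).

Definition completely_metrizable_in := exists rho : X -> X -> K,
  [/\ Dfun (fun p : X * X => rho p.1 p.2),
      [/\ forall x y, rho x y = 0 <-> x = y, forall x y, rho x y = rho y x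
        & forall x y z, rho x z <= rho x y + rho y z],
      forall x y, dist x y <= rho x y,
      forall x r, 0 < r -> exists s, 0 < s /\ forall y, dist x y < s -> rho x y < r
    & forall u : fn N X,
        (forall r, 0 < r -> exists n0, forall m n, leN n0 m -> leN n0 n ->
           rho (u m) (u n) < r) ->
        exists x, forall r, 0 < r -> exists n0, forall n, leN n0 n -> rho x (u n) < r].
End Metrizable.

Ltac def_reals := match goal with
  | |- Dfun (fun a => supK (@?P a)) => apply (@Dfun_sup _ _ _ P)
  | |- Dfun (fun a => _^-1) => apply Dfun_inv
  | |- Dfun (fun a => tip _) => unfold tip
  end.
Ltac def_ext ::= first [def_choice | def_codes | def_balls | def_games | def_reals].

Section Metric.
Context {fr : frame} (X : mspace fr).
Notation N := (N fr).
Notation K := (K fr).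
Notation fn A B := (@Fn fr A B _ _).
Notation seqN := (fn N N).
Implicit Types (n m k i j c g b : N) (u : fn N X) (x y z : X) (r s t : K).

Section Refine.
Context (G : fn (N * X) K).
Context (Gcont : forall j x r, 0 < r -> exists s, 0 < s /\ forall y, dist x y < s ->
  G (j, x) - G (j, y) < r /\ G (j, y) - G (j, x) < r).

(** The metric refines [dist] so that all functions [G (j, _)] become uniformly
    continuous: it is the supremum of [dist x y] and of the numbers
    [min (eps j) |G (j, x) - G (j, y)|], described by its lower bounds. *)
Definition below x y t := t <= dist x y \/
  exists j, t <= eps j /\ (t <= G (j, x) - G (j, y) \/ t <= G (j, y) - G (j, x)).
Definition rho x y := supK (below x y).

Lemma rho_lub x y : islub (below x y) (rho x y).
Proof.
apply: supKP; first by rewrite /below; def.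
  by exists (dist x y); left.
exists (dist x y + 1) => t [h|[j [h _]]]; first lra.
have := eps_anti (le0N j); rewrite eps0; have := dist_ge0 x y; lra.
Qed.

Lemma rhoC x y : rho x y = rho y x.
Proof.
rewrite /rho; congr supK; apply: funext => t; apply: propext; rewrite /below distC.
by split=> [[h|[j [h [h1|h1]]]]|[h|[j [h [h1|h1]]]]];
  solve [by left | by right; exists j; split => //; right | by right; exists j; split => //; left].
Qed.

Lemma dist_rho x y : dist x y <= rho x y.
Proof. by apply: (proj1 (rho_lub x y)); left. Qed.

Lemma rho_eq0 x y : rho x y = 0 <-> x = y.
Proof.
split=> [h|->].
  by apply/dist_eq0/eqP; rewrite eq_le dist_ge0 -h dist_rho.
apply/eqP; rewrite eq_le; apply/andP; split; last by rewrite -(distxx y) dist_rho.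
apply: (proj2 (rho_lub y y)) => t [|[j [_ [|]]]]; first by rewrite distxx.
  by rewrite subrr.
by rewrite subrr.
Qed.

Lemma rho_small j x y : rho x y < eps j -> G (j, x) < G (j, y) + eps j.
Proof.
move=> h; rewrite ltNge; apply/negP => h'.
have : eps j <= rho x y by apply: (proj1 (rho_lub x y)); right; exists j; split => //; left; lra.
lra.
Qed.

Lemma rhoT x y z : rho x z <= rho x y + rho y z.
Proof.
apply: (proj2 (rho_lub x z)) => t [h|[j [tj h]]].
  by have := distT x y z; have := dist_rho x y; have := dist_rho y z; lra.
have r1 := dist_rho x y; have r2 := dist_rho y z.
have d1 := dist_ge0 x y; have d2 := dist_ge0 y z.
case: (ltP (rho x y) (eps j)) => [h1|]; last lra.
case: (ltP (rho y z) (eps j)) => [h2|]; last lra.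
have up v w t' : t' <= eps j -> t' <= G (j, v) - G (j, w) -> t' <= rho v w.
  by move=> ? ?; apply: (proj1 (rho_lub v w)); right; exists j; split => //; left.
have near v w : rho v w < eps j -> G (j, v) - G (j, w) <= rho v w.
  by move=> hv; apply: up => //; have := rho_small hv; lra.
have n1 := near x y h1; have n2 := near y z h2.
have n3 : G (j, y) - G (j, x) <= rho x y by rewrite rhoC; apply: near; rewrite rhoC.
have n4 : G (j, z) - G (j, y) <= rho y z by rewrite rhoC; apply: near; rewrite rhoC.
by case: h => h; lra.
Qed.

Lemma rho_cont x r : 0 < r -> exists s, 0 < s /\ forall y, dist x y < s -> rho x y < r.
Proof.
move=> r0; have r20 : 0 < r / 2 by lra.
have [J hJ] := eps_small r20.
have [s [s0 hs]] : exists s, 0 < s /\ forall j, ltN j J -> forall y, dist x y < s ->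
    G (j, x) - G (j, y) < r / 2 /\ G (j, y) - G (j, x) < r / 2.
  move: J {hJ}; apply: indN; first def.
    by exists 1; split => // j /ltN0.
  move=> J [s [s0 IH]]; have [s' [s'0 hs']] := Gcont J x r20.
  exists (Num.min s s'); split; first by rewrite lt_min s0.
  by move=> j /ltNS [hj|->] y; rewrite lt_min => /andP[h1 h2]; [exact: IH | exact: hs'].
exists (Num.min s (r / 2)); split; first by rewrite lt_min s0.
move=> y; rewrite lt_min => /andP[h1 h2].
suff : rho x y <= r / 2 by lra.
apply: (proj2 (rho_lub x y)) => t [h|[j [tj h]]]; first lra.
case: (pselect (ltN j J)) => [hj|/leNNgt hj].
  by have [] := hs j hj y h1; case: h; lra.
have := eps_anti hj; lra.
Qed.
End Refine.

(** The reciprocals of functions [g j] that are positive and 1-Lipschitz are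
    continuous, and along a Cauchy sequence for [rho] they stay bounded, so that
    each [g j] stays away from zero.  Here [g j x] is the supremum of the numbers
    [t] with [T j x t]. *)
Section Barriers.
Context (T : N -> X -> K -> Prop).
Context (TDef : Def (fun p : N * X * K => T p.1.1 p.1.2 p.2)).
Context (T_le1 : forall j x t, T j x t -> t <= 1)
  (T_down : forall j x s t, s <= t -> T j x t -> T j x s)
  (T_lip : forall j x y t, T j x t -> T j y (t - dist x y))
  (T_pos : forall j x, exists t, 0 < t /\ T j x t).
Context (T_complete : forall u,
  (forall r, 0 < r -> exists n0, forall m n, leN n0 m -> leN n0 n -> dist (u m) (u n) < r) ->
  (forall j, exists t, 0 < t /\ exists n0, forall n, leN n0 n -> T j (u n) t) ->
  exists x, forall r, 0 < r -> exists n0, forall n, leN n0 n -> dist x (u n) < r).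

Definition height j x := supK (T j x).

Lemma height_lub j x : islub (T j x) (height j x).
Proof.
apply: supKP; last by exists 1 => t; exact: T_le1.
  have -> : T j x = fun t => T (j, x, t).1.1 (j, x, t).1.2 (j, x, t).2 by [].
  have h := TDef; pose P := mkPw h.
  by change (Def (fun t => elt (j, x, t) P)); def.
by have [t [_ h]] := T_pos j x; exists t.
Qed.

Lemma height_gt0 j x : 0 < height j x.
Proof. have [t [t0 /(proj1 (height_lub j x))]] := T_pos j x; lra. Qed.

Lemma height_lip j x y : height j x <= height j y + dist x y.
Proof.
apply: (proj2 (height_lub j x)) => t /(T_lip y) /(proj1 (height_lub j y)); lra.
Qed.

Lemma height_Dfun : Dfun (fun p : N * X => (height p.1 p.2)^-1).
Proof.
rewrite /height; have h := TDef; pose P := mkPw h.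
have hP : Def (fun p : N * X * K => T p.1.1 p.1.2 p.2) by [].
apply: Dfun_inv; apply: (Dfun_sup (P := fun (p : N * X) t => T p.1 p.2 t)); exact: hP.
Qed.
Let G : fn (N * X) K := mkFn height_Dfun.

(** A modulus of continuity of the reciprocal at [a]. *)
Lemma inv_close (a b e r : K) : 0 < a -> 0 < b -> 0 < r -> a <= b + e -> b <= a + e ->
  e < a / 2 -> e < r * (a * a / 2) -> a^-1 - b^-1 < r /\ b^-1 - a^-1 < r.
Proof.
move=> a0 b0 r0 h1 h2 h3 h4.
have ab0 : 0 < a * b by exact: mulr_gt0.
have h5 : e < r * (a * b).
  apply: (lt_le_trans h4); rewrite ler_pM2l // -mulrA ler_pM2l //; lra.
have aN : a != 0 by rewrite gt_eqF.
have bN : b != 0 by rewrite gt_eqF.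
have -> : a^-1 - b^-1 = (b - a) / (a * b) by field; rewrite aN bN.
have -> : b^-1 - a^-1 = (a - b) / (a * b) by field; rewrite aN bN.
by rewrite !ltr_pdivrMr //; split; lra.
Qed.

Lemma height_cont j x r : 0 < r -> exists s, 0 < s /\ forall y, dist x y < s ->
  G (j, x) - G (j, y) < r /\ G (j, y) - G (j, x) < r.
Proof.
move=> r0; have h0 := height_gt0 j x; set a := height j x in h0.
exists (Num.min (a / 2) (r * (a * a / 2))); split.
  by rewrite lt_min divr_gt0 //= mulr_gt0 // divr_gt0 // mulr_gt0.
move=> y; rewrite lt_min => /andP[h1 h2].
apply: (inv_close h0 (height_gt0 j y) r0 _ _ h1 h2); first exact: height_lip.
by rewrite distC; exact: height_lip.
Qed.

Theorem barriers_complete : completely_metrizable_in X.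
Proof.
exists (rho G); split.
- by rewrite /rho /below; def.
- by split; [exact: rho_eq0 | exact: rhoC | exact: rhoT].
- exact: dist_rho.
- exact: (rho_cont height_cont).
move=> u hu.
have [||x hx] := T_complete (u := u).
- move=> r /hu [n0 h]; exists n0 => m n hm hn.
  exact: le_lt_trans (dist_rho _ _ _) (h m n hm hn).
- move=> j; have [n0 hn0] := hu (eps j) (eps_gt0 j).
  pose c := (height j (u n0))^-1 + eps j.
  have c0 : 0 < c by rewrite addr_gt0 ?invr_gt0 ?height_gt0 ?eps_gt0.
  exists (c^-1 / 2); split; first by rewrite divr_gt0 ?invr_gt0.
  exists n0 => n hn.
  have : (height j (u n))^-1 < c := rho_small (hn0 n n0 hn (leNn n0)).
  rewrite invf_plt ?posrE ?height_gt0 // => hc.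
  apply: contrapT => no.
  have : height j (u n) <= c^-1 / 2.
    apply: (proj2 (height_lub j (u n))) => t ht; rewrite leNgt; apply/negP => lt.
    by apply: no; apply: T_down ht; exact: ltW.
  have : 0 < c^-1 by rewrite invr_gt0.
  lra.
exists x => r r0; have [s [s0 hs]] := rho_cont height_cont x r0.
by have [n0 hn0] := hx s s0; exists n0 => n /hn0; exact: hs.
Qed.
End Barriers.

Section GDelta.
Context (tau : seqN)
  (tauP : forall a t : seqN, (forall k, t k = tau (pcode a (S k))) ->
    ~ (legal (nest_rule (X := X)) fstN a t /\ (zero_tail t <-> common_point X (stage fstN a t)))).
Notation hit := (hit (X := X) tau).
Notation descends := (descends (X := X)).

(** The barrier with index [pr (c, m)] is the set of points which lie in the
    ball of the position [c] but in no hit after [c]; the number [m] accounts for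
    the complement of an open ball being an intersection of countably many open
    sets. *)
Definition clear j x t := t <= 1 /\
  (~ descends (un j).1 \/
   (tip (un j).1 <> O /\
    t <= dist x (cen X (tip (un j).1)) - rad (tip (un j).1) + eps (un j).2) \/
   exists c, hit (un j).1 c /\ t <= rad (tip c) - dist x (cen X (tip c))).

Theorem wadge_complete : completely_metrizable_in X.
Proof.
apply: (@barriers_complete clear).
- by rewrite /clear /hit /WadgeGames.hit /WadgeGames.descends; def.
- by move=> j x t [].
- move=> j x s t st [t1 h]; split; first lra.
  case: h => [|[[h1 h2]|[c [h1 h2]]]]; first by left.
    by right; left; split => //; lra.
  by right; right; exists c; split => //; lra.
- move=> j x y t [t1 h]; have := dist_ge0 x y; split; first lra.
  case: h => [|[[h1 h2]|[c [h1 h2]]]]; first by left.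
    right; left; split => //; have := distT x y (cen X (tip (un j).1)); lra.
  right; right; exists c; split => //.
  have := distT y x (cen X (tip c)); rewrite (distC y x); lra.
- move=> j x; set c := (un j).1; set m := (un j).2.
  case: (pselect (descends c)) => dc; last by exists 1; split => //; split => //; left.
  case: (pselect (inb x (tip c))) => hx.
    have [c' [h1 [/(hit_neq0 h1) //|h2]]] := next_hit tauP dc hx.
    exists (Num.min 1 (rad (tip c') - dist x (cen X (tip c')))); split.
      by rewrite lt_min ltr01 /=; lra.
    split; first by rewrite ge_min lexx.
    by right; right; exists c'; split => //; rewrite ge_min lexx orbT.
  exists (Num.min 1 (eps m)); split; first by rewrite lt_min ltr01 eps_gt0.
  split; first by rewrite ge_min lexx.
  right; left; split; first by move=> e; apply: hx; rewrite e; left.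
  have : rad (tip c) <= dist x (cen X (tip c)).
    by rewrite leNgt; apply/negP => h; apply: hx; right.
  have : Num.min 1 (eps m) <= eps m by rewrite ge_min lexx orbT.
  rewrite -/c -/m; lra.
move=> u cu hT; apply: (hits_converge tauP) => c dc [r [r0 [n0 hn0]]].
have [m hm] := eps_small r0; have [t [t0 [n1 hn1]]] := hT (pr (c, m)).
have t20 : 0 < t / 2 by lra.
have [n2 hn2] := cu _ t20.
have [n [n0n [n1n n2n]]] : exists n, leN n0 n /\ leN n1 n /\ leN n2 n.
  have [a [h1 h2]] := ex_leN2 n0 n1; have [b [h3 h4]] := ex_leN2 a n2.
  by exists b; split; [exact: leN_trans h1 h3|split; [exact: leN_trans h2 h3|]].
have [_] := hn1 n n1n; rewrite prK /= => -[//|[[tc h]|[c' [h1 h2]]]].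
  by have [//|h'] := hn0 n n0n; lra.
exists c'; split => //; exists (t / 4); split; first lra.
exists n2 => k hk; right; have := hn2 k n hk n2n.
have := distT (u k) (u n) (cen X (tip c')); lra.
Qed.
End GDelta.

(** * The theorem for a definability frame *)

(** The three games are played in turn.  Perfect set games exclude meager balls, then
    player II wins the Banach-Mazur game, and then player II wins the Wadge game. *)
Theorem cdh_completely_metrizable :
  ball_games_determined X -> cdh X -> completely_metrizable_in X.
Proof.
move=> det hcdh.
have none_meager x : ~ locally_meager x.
  have [_ d _] := det (splitting (X := X)) pick.
  have := lipschitz_determinacy (W := fun a t : seqN => legal (splitting (X := X)) pick a t /\
    common_point X (stage pick a t)) d.
  case=> [[s hs]|[t ht]]; first by case: (perfect_set_absurd hcdh hs).
  by have [E hE] := locally_meager_countable ht; exact: (locally_meager_uncountable hcdh hE).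
have [d _ _] := det (nest_rule (X := X)) (legalize (X := X)).
have := lipschitz_determinacy (W := fun a t : seqN => legal (nest_rule (X := X)) (legalize (X := X)) a t /\
    ~ common_point X (stage (legalize (X := X)) a t)) d.
case=> [[s hs]|[tau htau]].
  case: (none_meager (cen X (s O))); exists (s O); split; first exact: inb_cen.
  exact: meager_sigma0 hs.
have [_ _ d'] := det (nest_rule (X := X)) fstN.
have := lipschitz_determinacy (W := fun a t : seqN => legal (nest_rule (X := X)) fstN a t /\
    (zero_tail t <-> common_point X (stage fstN a t))) d'.
case=> [[s hs]|[tau' htau']]; first by case: (wadge_absurd hs hcdh htau).
exact: wadge_complete htau'.
Qed.
End Metric.

End CompleteMetrics.

Module ModelSorts.
Import Order.TTheory GRing.Theory Num.Theory.
Import Definability Coding Balls BallGames WadgeGames CompleteMetrics.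
Local Open Scope ring_scope.

Import ST.

(** * Models of ZF *)

Section Formulas.
Context (M : structure).
Implicit Types P Q : (nat -> M) -> Prop.

(** Predicates on environments that are given by formulas; working with them avoids
    writing down formulas with de Bruijn variables. *)
Definition fo P := exists f, forall e, P e <-> sat e f.

Lemma fo_mem i j : fo (fun e => e i ∈ e j).
Proof. by exists (FMem i j). Qed.
Lemma fo_eq i j : fo (fun e => e i = e j).
Proof. by exists (FEq i j). Qed.
Lemma fo_bot : fo (fun e => False).
Proof. by exists FBot. Qed.
Lemma fo_imp P Q : fo P -> fo Q -> fo (fun e => P e -> Q e).
Proof. by move=> [f hf] [g hg]; exists (FImp f g) => e /=; rewrite hf hg. Qed.
Lemma fo_all P : fo P -> fo (fun e => forall x, P (scons x e)).
Proof. by move=> [f hf]; exists (FAll f) => e /=; split => h x; apply/hf. Qed.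
Lemma fo_iff P Q : (forall e, P e <-> Q e) -> fo P -> fo Q.
Proof. by move=> PQ [f hf]; exists f => e; rewrite -PQ. Qed.
Lemma fo_not P : fo P -> fo (fun e => ~ P e).
Proof. by move=> h; apply: fo_imp h fo_bot. Qed.
Lemma fo_or P Q : fo P -> fo Q -> fo (fun e => P e \/ Q e).
Proof.
move=> hP hQ; apply: (fo_iff _ (fo_imp (fo_not hP) hQ)) => e; split.
  by case: (pselect (P e)); [left | right; auto].
by case.
Qed.
Lemma fo_and P Q : fo P -> fo Q -> fo (fun e => P e /\ Q e).
Proof.
move=> hP hQ; apply: (fo_iff _ (fo_not (fo_imp hP (fo_not hQ)))) => e; split.
  by move=> h; split; apply: contrapT => h'; apply: h => // ? ?.
by case=> p q h; exact: (h p).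
Qed.
Lemma fo_equiv P Q : fo P -> fo Q -> fo (fun e => P e <-> Q e).
Proof. by move=> hP hQ; apply: fo_and; apply: fo_imp. Qed.
Lemma fo_ex P : fo P -> fo (fun e => exists x, P (scons x e)).
Proof.
move=> hP; apply: (fo_iff _ (fo_not (fo_all (fo_not hP)))) => e.
by split => [/existsNP [x /contrapT h]|[x h] /(_ x)]; first by exists x.
Qed.
End Formulas.

(** In the cases of quantifiers, the bound variable becomes the entry 0 of the
    extended environment and the other entries are shifted. *)
Ltac fo_step :=
  cbv beta;
  match goal with
  | |- fo (fun e => False) => apply fo_bot
  | |- fo (fun e => _ <-> _) => apply fo_equiv
  | |- fo (fun e => _ /\ _) => apply fo_and
  | |- fo (fun e => _ \/ _) => apply fo_or
  | |- fo (fun e => ~ _) => apply fo_not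
  | |- fo (fun e => @?P e -> @?Q e) => apply (@fo_imp _ P Q)
  | |- @fo ?M (fun e => forall x, @?P e x) =>
      apply (@fo_all M (fun e' => P (fun i => e' i.+1) (e' 0)))
  | |- @fo ?M (fun e => exists x, @?P e x) =>
      apply (@fo_ex M (fun e' => P (fun i => e' i.+1) (e' 0)))
  | |- fo (fun e => _ = _) => apply fo_eq
  | |- fo (fun e => mem _ _) => apply fo_mem
  end.
Ltac fo := solve [repeat fo_step].

Section Basics.
Context {M : structure} (hZF : ZF M).
Implicit Types (a b c p s x y z : M).

Lemma ext_eq a b : (forall x, x ∈ a <-> x ∈ b) -> a = b.
Proof. exact: (extensionality hZF). Qed.

Lemma sep (P : (nat -> M) -> Prop) e a : fo P ->
  exists c, forall x, x ∈ c <-> (x ∈ a /\ P (scons x e)).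
Proof.
move=> [f hf]; have [c hc] := separation hZF f e a; exists c => x.
by rewrite hc hf.
Qed.

Lemma set_ofP x0 (P : M -> Prop) : (exists s, forall x, x ∈ s <-> P x) ->
  forall x, x ∈ set_of x0 P <-> P x.
Proof.
move=> h; rewrite /set_of /the; case: pselect => [h'|//].
by case: cid.
Qed.

Lemma theP x0 (P : M -> Prop) y : (forall x, P x <-> x = y) -> the x0 P = y.
Proof.
move=> h; rewrite /the; case: pselect => [h'|]; last by case; exists y; apply/h.
by case: cid => z /= /h.
Qed.

Lemma upairP a b x : x ∈ upair a b <-> (x = a \/ x = b).
Proof. by apply: set_ofP; exact: pairing hZF a b. Qed.

Lemma upair_eq a b c : c = upair a b <-> forall x, x ∈ c <-> (x = a \/ x = b).
Proof.
split=> [-> x|h]; first exact: upairP.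
by apply: ext_eq => x; rewrite h upairP.
Qed.

Lemma opairP a b x : x ∈ opair a b <-> (x = upair a a \/ x = upair a b).
Proof. exact: upairP. Qed.

Lemma upair_inj a b c : upair a b = upair a c -> b = c.
Proof.
move=> h; have : b ∈ upair a c by rewrite -h upairP; right.
have : c ∈ upair a b by rewrite h upairP; right.
by rewrite !upairP => -[->|->] [].
Qed.

Lemma opair_inj a b c d : opair a b = opair c d -> a = c /\ b = d.
Proof.
move=> h; have ac : a = c.
  have : upair a a ∈ opair c d by rewrite -h opairP; left.
  rewrite opairP => -[e|e].
    by have : c ∈ upair a a by [rewrite e upairP; left]; rewrite upairP => -[].
  by have : c ∈ upair a a by [rewrite e upairP; left]; rewrite upairP => -[].
subst c; split => //.
have h1 : upair a b ∈ opair a d by rewrite -h opairP; right.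
have h2 : upair a d ∈ opair a b by rewrite h opairP; right.
move: h1 h2; rewrite !opairP => -[h1|/upair_inj//] [h2|/upair_inj//].
have : b ∈ upair a a by rewrite -h1 upairP; right.
have : d ∈ upair a a by rewrite -h2 upairP; right.
by rewrite !upairP => -[->|->] [->|->].
Qed.

Lemma fo_upair i j k : fo (fun e : nat -> M => e i = upair (e j) (e k)).
Proof.
apply: (fo_iff (P := fun e => forall x, x ∈ e i <-> (x = e j \/ x = e k))); last fo.
by move=> e; rewrite upair_eq.
Qed.

Lemma fo_opair i j k : fo (fun e : nat -> M => e i = opair (e j) (e k)).
Proof.
apply: (fo_iff (P := fun e => forall x, x ∈ e i <->
  ((forall y, y ∈ x <-> (y = e j \/ y = e j)) \/
   (forall y, y ∈ x <-> (y = e j \/ y = e k))))); last fo.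
move=> e; rewrite /opair (upair_eq (upair _ _)).
by split => h x; rewrite h -!upair_eq.
Qed.

Lemma powerP a : exists c, forall x, x ∈ c <-> sub x a.
Proof. exact: power_set hZF a. Qed.

Lemma prodP A B x : x ∈ prod A B <-> exists a b, a ∈ A /\ b ∈ B /\ x = opair a b.
Proof.
have -> : (exists a b, a ∈ A /\ b ∈ B /\ x = opair a b) <->
    (exists a b, [/\ a ∈ A, b ∈ B & x = opair a b]).
  by split=> [[a [b [? [? ?]]]]|[a [b [? ? ?]]]]; exists a, b.
rewrite /prod; apply: set_ofP.
have [U hU] := union hZF (upair A B); have [P1 hP1] := powerP U.
have [P2 hP2] := powerP P1.
have hsep : fo (fun e : nat -> M => exists a, exists b,
  a ∈ e 1 /\ b ∈ e 2 /\ e 0 = opair a b).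
  do 2 fo_step; do 2 (fo_step; [fo|]).
  exact: fo_opair.
have [c hc] := sep (scons A (fun _ => B)) P2 hsep.
exists c => y; rewrite hc /=; split; first by move=> [_ [a [b [? [? ?]]]]]; exists a, b.
move=> [a [b [ha hb ->]]]; split; last by exists a, b.
have aU : a ∈ U by apply/hU; exists A; split => //; apply/upairP; left.
have bU : b ∈ U by apply/hU; exists B; split => //; apply/upairP; right.
apply/hP2 => z /opairP [->|->]; apply/hP1 => w /upairP [->|->] //.
Qed.
End Basics.

Ltac fo_step' hZF := first [fo_step | cbv beta; match goal with
  | |- fo (fun e => _ = upair _ _) => apply (fo_upair hZF)
  | |- fo (fun e => _ = opair _ _) => apply (fo_opair hZF) end].
Ltac fof hZF := solve [repeat (fo_step' hZF)].

(** ** The sets of the model as sorts *)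

Section Sorts.
Context {M : structure} (hZF : ZF M).

(** The types that exist in the model: those which are identified with the elements of
    one of its sets. *)
Record msort (T : Type) := MSort {
  carrier : M;
  val : T -> M;
  val_injective : forall x y, val x = val y -> x = y;
  carrierP : forall m, m ∈ carrier <-> exists t, val t = m }.

Lemma val_inj T (s : msort T) x y : val s x = val s y -> x = y.
Proof. exact: val_injective. Qed.

Lemma val_in T (s : msort T) t : val s t ∈ carrier s.
Proof. by apply/carrierP; exists t. Qed.
Hint Resolve val_in : core.

(** Every predicate which is the trace of a set of the model is definable; no formula
    is involved. *)
Definition mdef T (s : msort T) (P : T -> Prop) :=
  exists S : M, forall t, P t <-> val s t ∈ S.

(** By separation, it suffices to describe the predicate by a formula with
    parameters [e]. *)
Lemma mdef_fo T (s : msort T) (P : T -> Prop) (Q : (nat -> M) -> Prop) e :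
  fo Q -> (forall t, P t <-> Q (scons (val s t) e)) -> mdef s P.
Proof.
move=> hQ PQ; have [c hc] := sep hZF e (carrier s) hQ; exists c => t.
by rewrite hc PQ; split => [|[]//]; split.
Qed.

#[local] Obligation Tactic := idtac.
Program Definition mprod A B (sA : msort A) (sB : msort B) : msort (A * B) :=
  @MSort (A * B) (prod (carrier sA) (carrier sB))
    (fun p => opair (val sA p.1) (val sB p.2)) _ _.
Next Obligation.
move=> A B sA sB [a b] [a' b'] /= /(opair_inj hZF) [e1 e2].
by rewrite (val_inj e1) (val_inj e2).
Qed.
Next Obligation.
move=> A B sA sB m; rewrite (prodP hZF); split.
  by move=> [a [b [/carrierP [x <-] [/carrierP [y <-] ->]]]]; exists (x, y).
by move=> [[a b] <-] /=; exists (val sA a), (val sB b).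
Qed.

Definition mfun A B (sA : msort A) (sB : msort B) (f : A -> B) :=
  mdef (mprod sA sB) (fun p => p.2 = f p.1).

Lemma mfunP A B (sA : msort A) (sB : msort B) (f : A -> B) : mfun sA sB f ->
  exists G, forall a b, b = f a <-> opair (val sA a) (val sB b) ∈ G.
Proof. by move=> [G hG]; exists G => a b; exact: (hG (a, b)). Qed.

Section Rules.
Context A B C (sA : msort A) (sB : msort B) (sC : msort C).

Lemma mdef_bot : mdef sA (fun _ => False).
Proof. by apply: (@mdef_fo _ _ _ (fun _ => False) (fun=> carrier sA)); [fo|]. Qed.

Lemma mdef_imp (P Q : A -> Prop) : mdef sA P -> mdef sA Q -> mdef sA (fun a => P a -> Q a).
Proof.
move=> [S hS] [S' hS'].
apply: (@mdef_fo _ _ _ (fun e => e 0 ∈ e 1 -> e 0 ∈ e 2) (scons S (fun=> S'))); first fo.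
by move=> a /=; rewrite hS hS'.
Qed.

Lemma mdef_all (P : A -> B -> Prop) : mdef (mprod sA sB) (fun p => P p.1 p.2) ->
  mdef sA (fun a => forall b, P a b).
Proof.
move=> [S hS]; apply: (@mdef_fo _ _ _ (fun e => forall y, y ∈ e 1 ->
  forall p, p = opair (e 0) y -> p ∈ e 2) (scons (carrier sB) (fun=> S))); first fof hZF.
move=> a /=; split => [h _ /carrierP [b <-] _ ->|h b]; first exact/(hS (a, b)).
by apply/(hS (a, b)); exact: h.
Qed.

Lemma mdef_eq : mdef (mprod sA sA) (fun p => p.1 = p.2).
Proof.
apply: (@mdef_fo _ _ _ (fun e => exists x, e 0 = opair x x) (fun=> carrier sA));
  first fof hZF.
move=> [a b] /=; split => [->|[x /(opair_inj hZF) [e1 e2]]]; first by exists (val sA b).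
by apply: (@val_inj _ sA); rewrite e1.
Qed.

Lemma mdef_comp (f : A -> B) (P : B -> Prop) :
  mfun sA sB f -> mdef sB P -> mdef sA (fun a => P (f a)).
Proof.
move=> /mfunP [G hG] [S hS].
apply: (@mdef_fo _ _ _ (fun e => exists y, y ∈ e 1 /\ y ∈ e 2 /\
  exists p, p = opair (e 0) y /\ p ∈ e 3) (scons (carrier sB) (scons S (fun=> G))));
  first fof hZF.
move=> a /=; split => [h|[_ [/carrierP [b <-] [h [p [-> /hG ab]]]]]].
  exists (val sB (f a)); split => //; split; first exact/hS.
  by exists (opair (val sA a) (val sB (f a))); split => //; apply/hG.
by rewrite -ab; apply/hS.
Qed.

Lemma mfun_comp (f : A -> B) (g : B -> C) :
  mfun sA sB f -> mfun sB sC g -> mfun sA sC (fun a => g (f a)).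
Proof.
move=> /mfunP [G hG] /mfunP [G' hG'].
apply: (@mdef_fo _ _ _ (fun e => exists x, exists y, exists z, exists p, exists p',
  y ∈ e 1 /\ e 0 = opair x z /\ p = opair x y /\ p' = opair y z /\ p ∈ e 2 /\ p' ∈ e 3)
  (scons (carrier sB) (scons G (fun=> G')))); first fof hZF.
move=> [a c] /=; split => [->|].
  exists (val sA a), (val sB (f a)), (val sC (g (f a))).
  exists (opair (val sA a) (val sB (f a))), (opair (val sB (f a)) (val sC (g (f a)))).
  do 4 (split => //); split; first exact/hG.
  exact/hG'.
move=> [x [y [z [p [p' [/carrierP [b <-] [/(opair_inj hZF) [<- <-] [-> [-> [h1 h2]]]]]]]]]].
by move/hG: h1 => <-; apply/hG'.
Qed.

Lemma mfun_fst : mfun (mprod sA sB) sA fst.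
Proof.
apply: (@mdef_fo _ _ _ (fun e => exists x, exists y, exists p,
  p = opair x y /\ e 0 = opair p x) (fun=> carrier sA)); first fof hZF.
move=> [[a b] a'] /=; split => [->|].
  by exists (val sA a), (val sB b), (opair (val sA a) (val sB b)).
move=> [x [y [p [-> /(opair_inj hZF) [/(opair_inj hZF) [e _] e']]]]].
by apply: (@val_inj _ sA); rewrite e e'.
Qed.

Lemma mfun_snd : mfun (mprod sA sB) sB snd.
Proof.
apply: (@mdef_fo _ _ _ (fun e => exists x, exists y, exists p,
  p = opair x y /\ e 0 = opair p y) (fun=> carrier sA)); first fof hZF.
move=> [[a b] b'] /=; split => [->|].
  by exists (val sA a), (val sB b), (opair (val sA a) (val sB b)).
move=> [x [y [p [-> /(opair_inj hZF) [/(opair_inj hZF) [_ e] e']]]]].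
by apply: (@val_inj _ sB); rewrite e e'.
Qed.

Lemma mfun_pair (f : C -> A) (g : C -> B) :
  mfun sC sA f -> mfun sC sB g -> mfun sC (mprod sA sB) (fun c => (f c, g c)).
Proof.
move=> /mfunP [G hG] /mfunP [G' hG'].
apply: (@mdef_fo _ _ _ (fun e => exists x, exists y, exists z, exists q, exists p, exists p',
  q = opair y z /\ e 0 = opair x q /\ p = opair x y /\ p' = opair x z /\ p ∈ e 1 /\ p' ∈ e 2)
  (scons G (fun=> G'))); first fof hZF.
move=> [c [a b]] /=; split => [[-> ->]|].
  exists (val sC c), (val sA (f c)), (val sB (g c)), (opair (val sA (f c)) (val sB (g c))).
  exists (opair (val sC c) (val sA (f c))), (opair (val sC c) (val sB (g c))).
  do 4 (split => //); split; first exact/hG.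
  exact/hG'.
move=> [x [y [z [q [p [p' [-> [/(opair_inj hZF) [<- /(opair_inj hZF) [<- <-]]]]]]]]]].
by move=> [-> [-> [/hG <- /hG' <-]]].
Qed.

Lemma mfun_cst (b : B) : mfun sA sB (fun _ => b).
Proof.
apply: (@mdef_fo _ _ _ (fun e => exists x, e 0 = opair x (e 1)) (fun=> val sB b));
  first fof hZF.
move=> [a b'] /=; split => [->|[x h]]; first by exists (val sA a).
exact: val_inj (proj2 (opair_inj hZF h)).
Qed.
End Rules.

Section Powers.
Context A (sA : msort A).

Lemma extent_ex (P : {P : A -> Prop | mdef sA P}) :
  exists S, forall m, m ∈ S <-> exists a, sval P a /\ val sA a = m.
Proof.
case: P => P [S hS]; have [c hc] := sep hZF (fun=> S) (carrier sA) (fo_mem M 0 1).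
exists c => m; rewrite hc /=; split => [[/carrierP [a <-] /hS Pa]|[a [/hS h <-]]] //.
by exists a.
Qed.
Definition extent P : M := projT1 (cid (extent_ex P)).
Lemma extentP P m : m ∈ extent P <-> exists a, sval P a /\ val sA a = m.
Proof. exact: (projT2 (cid (extent_ex P))). Qed.
Lemma extent_mem P a : val sA a ∈ extent P <-> sval P a.
Proof.
by rewrite extentP; split => [[b [h e]]|h]; [rewrite -(val_inj e) | exists a].
Qed.

Program Definition mpow : msort {P : A -> Prop | mdef sA P} :=
  @MSort _ (projT1 (cid (powerP hZF (carrier sA)))) extent _ _.
Next Obligation.
move=> P Q h; case: P h => P hP; case: Q => Q hQ h.
have e : P = Q.
  apply: funext => a; apply: propext.
  have h1 := extent_mem (exist _ P hP) a; have h2 := extent_mem (exist _ Q hQ) a.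
  by rewrite h in h1; split => p; [exact/h2/h1 | exact/h1/h2].
by move: hP h; rewrite e => hP _; congr exist; apply: Prop_irrelevance.
Qed.
Next Obligation.
move=> m; case: cid => c hc /=; rewrite hc; split => [h|[P <-] x].
  have hP : mdef sA (fun a => val sA a ∈ m) by exists m.
  exists (exist _ _ hP); apply: (ext_eq hZF) => x; rewrite extentP /=.
  by split => [[a [? <-]]|hx] //; have /carrierP [a e] := h x hx; exists a; rewrite e.
by move=> /extentP [a [_ <-]].
Qed.

Lemma mdef_mem : mdef (mprod sA mpow) (fun p => sval p.2 p.1).
Proof.
apply: (@mdef_fo _ _ _ (fun e => exists x, exists y, e 0 = opair x y /\ x ∈ y)
  (fun=> carrier sA)); first fof hZF.
move=> [a P] /=; rewrite -extent_mem; split => [h|[x [y [/(opair_inj hZF) [-> ->]]]]] //.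
by exists (val sA a), (extent P).
Qed.
End Powers.

Section Functions.
Context A B (sA : msort A) (sB : msort B).

Lemma graph_ex (f : {f : A -> B | mfun sA sB f}) : exists G, forall m,
  m ∈ G <-> exists a, m = opair (val sA a) (val sB (sval f a)).
Proof.
case: f => f hf; pose P := exist (mdef (mprod sA sB)) (fun p => p.2 = f p.1) hf.
exists (extent P) => m; rewrite extentP /=.
split => [[[a b] /= [-> <-]]|[a ->]]; first by exists a.
by exists (a, f a).
Qed.
Definition graph f : M := projT1 (cid (graph_ex f)).
Lemma graphP f m : m ∈ graph f <-> exists a, m = opair (val sA a) (val sB (sval f a)).
Proof. exact: (projT2 (cid (graph_ex f))). Qed.
Lemma graph_mem f a b : opair (val sA a) (val sB b) ∈ graph f <-> b = sval f a.
Proof.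
rewrite graphP; split => [[x /(opair_inj hZF) [e1 e2]]|->]; last by exists a.
by rewrite (val_inj e1) (val_inj e2).
Qed.

Lemma is_fun_graph f : is_fun (graph f) (carrier sA) (carrier sB).
Proof.
split => [m /graphP [a ->]|m /carrierP [a <-]].
  by apply/(prodP hZF); exists (val sA a), (val sB (sval f a)).
exists (val sB (sval f a)); split; first exact/graph_mem.
by move=> y /graphP [b /(opair_inj hZF) [e ->]]; rewrite (val_inj e).
Qed.

Lemma app_is_fun f a : is_fun f (carrier sA) (carrier sB) ->
  exists b, ST.app f (val sA a) = val sB b /\
    forall y, opair (val sA a) y ∈ f <-> y = val sB b.
Proof.
move=> [h1 h2]; have [y [hy uy]] := h2 _ (val_in sA a).
have /(prodP hZF) [x [z [_ [/carrierP [b <-] /(opair_inj hZF) [_ e]]]]] := h1 _ hy.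
exists b; have hb z' : opair (val sA a) z' ∈ f <-> z' = val sB b.
  by rewrite -e; split => [/uy //|->].
by split => //; apply: theP.
Qed.

Lemma app_graph f a : ST.app (graph f) (val sA a) = val sB (sval f a).
Proof.
have [b [-> h]] := app_is_fun a (is_fun_graph f); congr val.
by apply/graph_mem/h.
Qed.

(** The functions of the model are exactly the graphs of definable functions; this is
    why quantification over them is quantification over a sort. *)
Lemma is_funP m : is_fun m (carrier sA) (carrier sB) <-> exists f, graph f = m.
Proof.
split => [h|[f <-]]; last exact: is_fun_graph.
pose f a := projT1 (cid (app_is_fun a h)).
have hf a y : opair (val sA a) y ∈ m <-> y = val sB (f a).
  by rewrite /f; case: cid => b [].
have mf : mfun sA sB f.
  by exists m => -[a b] /=; rewrite hf; split => [->|e] //; exact: val_inj e.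
exists (exist _ f mf); apply: (ext_eq hZF) => p; rewrite graphP /=; split.
  by move=> [a ->]; apply/hf.
move=> hp; have [h1 _] := h; have /(prodP hZF) := h1 _ hp.
by move=> [x [y [/carrierP [a <-] [_ e]]]]; exists a; move: hp; rewrite e => /hf ->.
Qed.

Lemma fun_set_ex : exists F, forall m, m ∈ F <-> is_fun m (carrier sA) (carrier sB).
Proof.
have [c hc] := powerP hZF (prod (carrier sA) (carrier sB)).
have h : fo (fun e : nat -> M => forall x, x ∈ e 1 -> exists y,
    (exists p, p = opair x y /\ p ∈ e 0) /\
    forall y', (exists p, p = opair x y' /\ p ∈ e 0) -> y = y') by fof hZF.
have [F hF] := sep hZF (fun=> carrier sA) c h.
have E m x y : (exists p, p = opair x y /\ p ∈ m) <-> opair x y ∈ m.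
  by split => [[p [->]]|] //; exists (opair x y).
exists F => m; rewrite hF hc /=; split => -[h1 h2]; split => // x hx.
  by have [y [/E h3 h4]] := h2 x hx; exists y; split => // y' /E /h4.
by have [y [h3 h4]] := h2 x hx; exists y; split => [|y' /E /h4//]; apply/E.
Qed.

Program Definition mfn : msort {f : A -> B | mfun sA sB f} :=
  @MSort _ (projT1 (cid fun_set_ex)) graph _ _.
Next Obligation.
move=> f g h; have e : sval f = sval g.
  by apply: funext => a; apply/graph_mem; rewrite -h; apply/graph_mem.
case: f g e {h} => f hf [g hg] /= e; move: hf; rewrite e => hf.
by congr exist; apply: Prop_irrelevance.
Qed.
Next Obligation.
by move=> m; case: cid => F hF /=; rewrite hF is_funP.
Qed.

Lemma mfun_app : mfun (mprod mfn sA) sB (fun p => sval p.1 p.2).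
Proof.
apply: (@mdef_fo _ _ _ (fun e => exists f, exists a, exists b, exists q, exists r,
  e 0 = opair q b /\ q = opair f a /\ r = opair a b /\ r ∈ f) (fun=> carrier sA));
  first fof hZF.
move=> [[f a] b] /=; split => [->|].
  exists (graph f), (val sA a), (val sB (sval f a)), (opair (graph f) (val sA a)).
  exists (opair (val sA a) (val sB (sval f a))); do 3 (split => //).
  exact/graph_mem.
move=> [f' [a' [b' [q [r [/(opair_inj hZF) [<- <-] [/(opair_inj hZF) [<- <-] [-> h]]]]]]]].
exact/graph_mem.
Qed.
End Functions.
End Sorts.

(** ** Natural numbers, dependent choice and the real field of the model *)

Section Omega.
Context {M : structure} (hZF : ZF M).
Implicit Types (a b c p s w x y z : M).

Lemma succP a x : x ∈ succ a <-> (x ∈ a \/ x = a).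
Proof.
apply: set_ofP; have [c hc] := union hZF (upair a (upair a a)).
exists c => y; rewrite hc; split.
  by move=> [z [/(upairP hZF) [->|->]]]; [left | rewrite (upairP hZF) => -[]; right].
case=> h; [exists a | exists (upair a a)]; rewrite !(upairP hZF); split; by auto.
Qed.

Lemma succ_eq a b : b = succ a <-> forall x, x ∈ b <-> (x ∈ a \/ x = a).
Proof.
split=> [-> x|h]; first exact: succP.
by apply: (ext_eq hZF) => x; rewrite h succP.
Qed.

Lemma fo_succ i j : fo (fun e : nat -> M => e i = succ (e j)).
Proof.
apply: (fo_iff (P := fun e => forall x, x ∈ e i <-> (x ∈ e j \/ x = e j))); last fo.
by move=> e; rewrite succ_eq.
Qed.

Lemma empty_ex : exists z : M, is_empty z.
Proof. by have [w [[z [h _]] _]] := infinity hZF; exists z. Qed.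

Lemma empty_uniq x y : is_empty x -> is_empty y -> x = y.
Proof. by move=> h h'; apply: (ext_eq hZF) => z; split => [/h|/h']. Qed.

Lemma inductiveP w : inductive w <->
  (exists z, is_empty z /\ z ∈ w) /\ forall x, x ∈ w -> succ x ∈ w.
Proof.
split=> -[h1 h2]; split => // x /h2; last first.
  by move=> h; exists (succ x); split => // z; rewrite succP.
by move=> [y [yw /succ_eq <-]].
Qed.

Lemma omega_ex : exists w : M, is_omega w.
Proof.
have [I hI] := infinity hZF.
have hfo : fo (fun e : nat -> M => forall v, ((exists z, (forall x, ~ x ∈ z) /\ z ∈ v) /\
  forall x, x ∈ v -> exists y, y ∈ v /\ forall z, z ∈ y <-> (z ∈ x \/ z = x)) -> e 0 ∈ v) by fo.
have [w hw] := sep hZF (fun=> I) I hfo.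
have wP x : x ∈ w <-> forall v, inductive v -> x ∈ v.
  by rewrite hw; split => [[_ h] v /h //|h]; split => //; apply: h.
exists w; split; last by move=> v hv x /wP; apply.
apply/inductiveP; split.
  have [z hz] := empty_ex; exists z; split => //; apply/wP => v [[z' [h1 h2]] _].
  by rewrite (empty_uniq hz h1).
by move=> x /wP hx; apply/wP => v hv; have [_] := (inductiveP v).1 hv; apply; apply: hx.
Qed.

Lemma omega_uniq w w' : is_omega w -> is_omega w' -> w = w'.
Proof.
by move=> [h1 h2] [h3 h4]; apply: (ext_eq hZF) => x; split; [apply: h2 | apply: h4].
Qed.

Definition msub s : @msort M {x : M | x ∈ s}.
Proof.
apply: (@MSort M _ s sval).
  by move=> [x hx] [y hy] /= e; subst y; congr exist; apply: Prop_irrelevance.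
by move=> m; split => [h|[[x hx] <- //]]; exists (exist _ m h).
Defined.

Context {w : M} (hw : is_omega w).
Definition Nat := {x : M | x ∈ w}.
Definition nat_sort : @msort M Nat := msub w.

Lemma zero_ex : exists n : Nat, is_empty (sval n).
Proof. by have [[[z [h1 h2]] _] _] := hw; exists (exist _ z h2). Qed.
Definition nzero := projT1 (cid zero_ex).
Lemma nzeroP : is_empty (sval nzero). Proof. by rewrite /nzero; case: cid. Qed.

Lemma omega_succ n : n ∈ w -> succ n ∈ w.
Proof. by have [/inductiveP [_ h] _] := hw; exact: h. Qed.
Definition nsucc (n : Nat) : Nat := exist _ (succ (sval n)) (omega_succ (svalP n)).
Definition nlt (n m : Nat) := sval n ∈ sval m.

Lemma sub_inj s (x y : {x : M | x ∈ s}) : sval x = sval y -> x = y.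
Proof. exact: (val_inj (s := msub s)). Qed.

Lemma mfun_nsucc : mfun hZF nat_sort nat_sort nsucc.
Proof.
apply: (@mdef_fo _ hZF _ _ _ (fun e => exists x, exists y, e 0 = opair x y /\ y = succ x)
  (fun=> w)).
  do 2 fo_step; apply: fo_and; first exact: fo_opair.
  exact: fo_succ.
move=> [n m] /=; split => [->|[x [y [/(opair_inj hZF) [<- <-] e]]]].
  by exists (sval n), (succ (sval n)).
exact: (@sub_inj w m (nsucc n) e).
Qed.

Lemma mdef_nlt : mdef (mprod hZF nat_sort nat_sort) (fun p : Nat * Nat => nlt p.1 p.2).
Proof.
apply: (@mdef_fo _ hZF _ _ _ (fun e => exists x, exists y, e 0 = opair x y /\ x ∈ y)
  (fun=> w)); first fof hZF.
move=> [n m] /=; split => [h|[x [y [/(opair_inj hZF) [<- <-] h]]]] //.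
by exists (sval n), (sval m).
Qed.

Lemma nat_induction (P : Nat -> Prop) : mdef nat_sort P -> P nzero ->
  (forall n, P n -> P (nsucc n)) -> forall n, P n.
Proof.
move=> [S hS] P0 PS n.
have [c hc] := sep hZF (fun=> S) w (fo_mem M 0 1).
suff hci : inductive c.
  by have [_ /(_ _ hci) h] := hw; apply/hS; have /hc [] := h _ (svalP n).
apply/inductiveP; split.
  exists (sval nzero); split; first exact: nzeroP.
  by apply/hc; split; [exact: (svalP nzero) | exact: ((hS nzero).1 P0)].
move=> x /hc [xw xS]; apply/hc; split; first exact: omega_succ.
have Px : P (exist _ x xw) by exact: ((hS (exist _ x xw)).2 xS).
exact: ((hS _).1 (PS _ Px)).
Qed.

Lemma nlt0 n : ~ nlt n nzero. Proof. exact: nzeroP. Qed.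
Lemma nltS n m : nlt n (nsucc m) <-> nlt n m \/ n = m.
Proof.
by rewrite /nlt /= succP; split => -[|e]; auto; right; [exact: sub_inj | rewrite e].
Qed.

Context (hDC : DC M).
(** Dependent choice of the model, applied to the set that a definable predicate cuts
    out of the carrier. *)
Lemma model_dc A (sA : @msort M A) (P : A -> Prop) (R : A -> A -> Prop) :
  mdef sA P -> mdef (mprod hZF sA sA) (fun p : A * A => R p.1 p.2) ->
  (exists t, P t) -> (forall t, P t -> exists2 u, P u & R t u) ->
  exists2 f : Nat -> A, mfun hZF nat_sort sA f &
    forall n, P (f n) /\ R (f n) (f (nsucc n)).
Proof.
move=> [S hS] [r hr] [x0 Px0] step.
have [c hc] := sep hZF (fun=> S) (carrier sA) (fo_mem M 0 1).
have cP (a : A) : val sA a ∈ c <-> P a.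
  by rewrite hc /= hS; split => [[]|h] //; split => //; exact: val_in.
have [||f [hf hfr]] := hDC (w := w) (A := c) (r := r) hw.
- by exists (val sA x0); apply/cP.
- move=> x xc; have /hc [/carrierP [a ea] _] := xc; rewrite -ea in xc *.
  have [b Pb Rab] := step a ((cP a).1 xc); exists (val sA b); split; first exact/cP.
  exact/(hr (a, b)).
have hfA : is_fun f (carrier nat_sort) (carrier sA).
  case: hf => h1 h2; split => // p /h1; rewrite !(prodP hZF).
  by move=> [x [y [hx [/hc [hy _] e]]]]; exists x, y.
have [g hg] := (is_funP hZF _ _ _).1 hfA.
exists (sval g); first exact: svalP.
move=> n; have en m : ST.app f (sval m) = val sA (sval g m).
  by rewrite -hg; exact: app_graph.
have Pn m : P (sval g m).
  have [h1 h2] := hf; have [y [hy _]] := h2 _ (svalP m).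
  have /(prodP hZF) [x [z [_ [zc /(opair_inj hZF) [_ e]]]]] := h1 _ hy.
  apply/cP; suff -> : val sA (sval g m) = y by rewrite e.
  move: hy; rewrite -hg => /graphP [k /(opair_inj hZF) [ek ->]].
  by congr (val sA (sval g _)); exact: sub_inj.
split => //; apply/(hr (_, _)) => /=; rewrite -!en; exact: hfr (svalP n).
Qed.
End Omega.

Section RealField.
Context {M : structure} (hZF : ZF M) (R : real_line M).
(** The elements of the real line of the model form an ordered field in the ambient
    logic; it is complete only with respect to sets of the model. *)
Definition Kt (_ : ZF M) := {x : M | x ∈ K R}.
Local Notation T := (Kt hZF).

HB.instance Definition _ := gen_eqMixin T.
HB.instance Definition _ := gen_choiceMixin T.

Lemma op_in f (x y : T) : is_fun f (prod (K R) (K R)) (K R) ->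
  ST.app f (opair (sval x) (sval y)) ∈ K R /\
  forall z, opair (opair (sval x) (sval y)) z ∈ f <->
    z = ST.app f (opair (sval x) (sval y)).
Proof.
have h := @app_is_fun _ hZF _ _ (mprod hZF (msub (K R)) (msub (K R))) (msub (K R)) f (x, y).
move=> /h [b [/= -> hb]]; split => //; exact: (svalP b).
Qed.

Definition kmk (m : M) (h : m ∈ K R) : T := exist (fun m => m ∈ K R) m h.
Definition kadd (x y : T) : T := kmk (proj1 (op_in x y (addf_fun R))).
Definition kmul (x y : T) : T := kmk (proj1 (op_in x y (mulf_fun R))).
Definition k0 : T := kmk (zeroK R).
Definition k1 : T := kmk (oneK R).
Lemma kinj (x y : T) : sval x = sval y -> x = y. Proof. exact: sub_inj. Qed.

Lemma kopp_ex (x : T) : exists y, kadd y x = k0.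
Proof.
have [y [yK h]] := addN (svalP x); exists (kmk yK); apply: kinj => /=.
by rewrite -h; exact: (addC yK (svalP x)).
Qed.
Definition kopp x := projT1 (cid (kopp_ex x)).

Lemma kaddA : associative kadd.
Proof. by move=> x y z; apply: kinj; exact: (addA (svalP x) (svalP y) (svalP z)). Qed.
Lemma kaddC : commutative kadd.
Proof. by move=> x y; apply: kinj; exact: (addC (svalP x) (svalP y)). Qed.
Lemma kadd0 : left_id k0 kadd.
Proof. by move=> x; apply: kinj; exact: (add0 (svalP x)). Qed.
Lemma kaddN : left_inverse k0 kopp kadd.
Proof. by move=> x; rewrite /kopp; case: cid. Qed.
HB.instance Definition _ := GRing.isZmodule.Build T kaddA kaddC kadd0 kaddN.

Lemma kmulA : associative kmul.
Proof. by move=> x y z; apply: kinj; exact: (mulA (svalP x) (svalP y) (svalP z)). Qed.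
Lemma kmulC : commutative kmul.
Proof. by move=> x y; apply: kinj; exact: (mulC (svalP x) (svalP y)). Qed.
Lemma kmul1 : left_id k1 kmul.
Proof. by move=> x; apply: kinj; exact: (mul1 (svalP x)). Qed.
Lemma kmulD : left_distributive kmul kadd.
Proof.
move=> x y z; rewrite ![kmul _ z]kmulC; apply: kinj.
exact: (mulD (svalP z) (svalP x) (svalP y)).
Qed.
Lemma k1_neq0 : k1 != k0.
Proof. by apply/eqP => /(congr1 sval); exact: one_neq0. Qed.
HB.instance Definition _ :=
  GRing.Zmodule_isComNzRing.Build T kmulA kmulC kmul1 kmulD k1_neq0.

Lemma kinv_ex (x : T) : exists y, (x != 0 -> kmul y x = 1) /\ (x = 0 -> y = 0).
Proof.
case: (eqVneq x 0) => [->|x0]; first by exists 0.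
have [|y [yK h]] := mulV (svalP x).
  by move=> e; move/eqP: x0; apply; exact: kinj.
exists (kmk yK); split => [_|e]; last by move: x0; rewrite e eqxx.
by apply: kinj => /=; rewrite -h; exact: (mulC yK (svalP x)).
Qed.
Definition kinv x := projT1 (cid (kinv_ex x)).
Lemma kmulV (x : T) : x != 0 -> kinv x * x = 1.
Proof. by rewrite /kinv; case: cid => y [h1 h2]; exact: h1. Qed.
Lemma kinv0 : kinv 0 = 0.
Proof. by rewrite /kinv; case: cid => y [h1 h2] /=; exact: h2. Qed.
HB.instance Definition _ := GRing.ComNzRing_isField.Build T kmulV kinv0.

Definition klt (x y : T) : bool := `[< lt R (sval x) (sval y) >].
Definition kle (x y : T) : bool := (x == y) || klt x y.
Definition knorm (x : T) : T := if klt 0 x then x else - x.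

Lemma klt_add (x y z : T) : klt x y -> klt (x + z) (y + z).
Proof.
by move=> /asboolP h; apply/asboolP; exact: (lt_add (svalP x) (svalP y) (svalP z) h).
Qed.
Lemma klt_trans (x y z : T) : klt x y -> klt y z -> klt x z.
Proof.
move=> /asboolP h /asboolP h'; apply/asboolP.
exact: (lt_trans (svalP x) (svalP y) (svalP z) h h').
Qed.
Lemma klt_irr (x : T) : ~~ klt x x.
Proof. by apply/asboolP; exact: (lt_irr (svalP x)). Qed.
Lemma klt_total (x y : T) : x != y -> klt x y || klt y x.
Proof.
move=> xy; case: (lt_total (svalP x) (svalP y)) => h; apply/orP; [left| |right]; try exact/asboolP.
by move/eqP: xy; case; exact: kinj.
Qed.
Lemma klt0_add (x y : T) : klt 0 x -> klt 0 y -> klt 0 (x + y).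
Proof.
by move=> hx hy; apply: klt_trans hy _; rewrite -{1}[y]add0r; exact: klt_add.
Qed.
Lemma klt0_mul (x y : T) : klt 0 x -> klt 0 y -> klt 0 (x * y).
Proof.
move=> /asboolP hx /asboolP hy; apply/asboolP.
exact: (lt_mul (svalP x) (svalP y) hx hy).
Qed.
Lemma klt0_ngt0 (x : T) : klt 0 x -> ~~ klt x 0.
Proof. by move=> h; apply/negP => h'; move: (klt_irr 0); rewrite (klt_trans h h'). Qed.
Lemma ksub_gt0 (x y : T) : klt 0 (y - x) = klt x y.
Proof.
apply/idP/idP => [/(klt_add x)|/(klt_add (- x))]; first by rewrite add0r subrK.
by rewrite subrr.
Qed.
Lemma klt0_total (x : T) : x != 0 -> klt 0 x || klt x 0.
Proof. by rewrite eq_sym; exact: klt_total. Qed.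
Lemma knormN (x : T) : knorm (- x) = knorm x.
Proof.
rewrite /knorm opprK; have e : klt 0 (- x) = klt x 0 by rewrite -[- x]add0r ksub_gt0.
rewrite e; case: (eqVneq x 0) => [->|/klt0_total]; first by rewrite oppr0 !if_same.
case: ifP => [h _|_]; last by rewrite orbF => ->.
by case: ifP => // /klt0_ngt0; rewrite h.
Qed.
Lemma kle_def (x y : T) : kle x y = (x == y) || klt x y. Proof. by []. Qed.
Lemma kge0_norm (x : T) : kle 0 x -> knorm x = x.
Proof.
rewrite /kle /knorm => /orP [/eqP <-|->] //.
by rewrite oppr0 if_same.
Qed.
HB.instance Definition _ := Num.IntegralDomain_isLtReal.Build T
  klt0_add klt0_mul klt0_ngt0 ksub_gt0 klt0_total knormN kge0_norm kle_def.
Definition KF : realFieldType := T.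
End RealField.

End ModelSorts.

Module ModelFrame.
Import Order.TTheory GRing.Theory Num.Theory.
Import Definability Coding Balls BallGames WadgeGames CompleteMetrics ModelSorts.
Local Open Scope ring_scope.

Import ST.

(** ** A model as a definability frame *)

Section ModelFrame.
Context {M : structure} (hZF : ZF M) (hDC : DC M) (R : real_line M).
Context {w : M} (hw : is_omega w).

Definition ksort : @msort M (KF hZF R) := msub (ST.K R).

Lemma kadd_def : mfun hZF (mprod hZF ksort ksort) ksort (fun p => p.1 + p.2).
Proof.
exists (addf R) => -[[x y] z] /=; have [_ ->] := op_in x y (addf_fun R).
by split => [->|e] //; apply: kinj.
Qed.
Lemma kmul_def : mfun hZF (mprod hZF ksort ksort) ksort (fun p => p.1 * p.2).
Proof.
exists (mulf R) => -[[x y] z] /=; have [_ ->] := op_in x y (mulf_fun R).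
by split => [->|e] //; apply: kinj.
Qed.
Lemma klt_def : mdef (mprod hZF ksort ksort) (fun p => p.1 < p.2).
Proof. by exists (ltr R) => -[x y] /=; split => [/asboolP|h] //; apply/asboolP. Qed.

Lemma ltKE (x y : KF hZF R) : x < y <-> lt R (sval x) (sval y).
Proof. by split => [/asboolP|h] //; apply/asboolP. Qed.
Lemma leKE (x y : KF hZF R) : x <= y <-> le R (sval x) (sval y).
Proof.
rewrite le_eqVlt; split => [/orP [/eqP ->|/ltKE h]|[/ltKE h|h]].
- by right.
- by left.
- by rewrite h orbT.
- by rewrite (kinj h) eqxx.
Qed.

Lemma klub (P : KF hZF R -> Prop) : mdef ksort P -> (exists x, P x) ->
  (exists b, forall x, P x -> x <= b) ->
  exists2 b, forall x, P x -> x <= b & forall c, (forall x, P x -> x <= c) -> b <= c.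
Proof.
move=> hP [x0 Px0] [b hb]; pose Q := exist (mdef ksort) P hP.
have mem x : sval x ∈ extent hZF Q <-> P x := extent_mem hZF Q x.
have sK : sub (extent hZF Q) (ST.K R) by move=> m /extentP [a [_ <-]]; exact: (svalP a).
have up c : (forall x, P x -> x <= c) -> forall m, m ∈ extent hZF Q -> le R m (sval c).
  by move=> h m /extentP [a [/h /leKE ha <-]].
have [||s [sR hs1 hs2]] := lub sK.
- by exists (sval x0); apply/mem.
- by exists (sval b); split; [exact: (svalP b) | exact: up].
exists (kmk hZF sR) => [x Px|c hc].
  by apply/leKE; exact: (hs1 _ ((mem x).2 Px)).
by apply/leKE; apply: hs2; [exact: (svalP c) | exact: up].
Qed.

Definition mframe : frame := @Frame (@msort M) (@mdef M) (mprod hZF)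
  (@mdef_bot M hZF) (@mdef_imp M hZF) (@mdef_all M hZF) (@mdef_eq M hZF) (@mdef_comp M hZF)
  (@mfun_comp M hZF) (@mfun_fst M hZF) (@mfun_snd M hZF) (@mfun_pair M hZF) (@mfun_cst M hZF)
  (@mpow M hZF) (@mdef_mem M hZF) (@mfn M hZF) (@mfun_app M hZF)
  Nat (@nat_sort M w) (nzero hw) (nsucc hZF hw) (@nlt M w)
  (mfun_nsucc hZF hw) (mdef_nlt hZF) (@nat_induction M hZF w hw) (@nlt0 M w hw) (nltS hZF hw)
  (@model_dc M hZF w hw hDC) (KF hZF R) ksort kadd_def kmul_def klt_def klub.
End ModelFrame.

Section ModelDeterminacy.
Context {M : structure} (hZF : ZF M) (hDC : DC M) (R : real_line M).
Context {w : M} (hw : is_omega w).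
Notation fr := (mframe hZF hDC R hw).
Notation N := (Definability.N fr).
Notation seqN := (@Fn fr N N _ _).

Lemma natP n : n ∈ w -> exists k : N, sval k = n.
Proof. by move=> h; exists (exist _ n h). Qed.

Lemma nat_sub (n : N) m : m ∈ sval n -> m ∈ w.
Proof.
have hS : Def (fun n : N => forall m : M, m ∈ sval n -> m ∈ w).
  by apply: (@mdef_fo _ hZF _ _ _ (fun e => forall m, m ∈ e 0 -> m ∈ e 1) (fun=> w)); first fo.
move: n m; apply: indN => //; first by move=> m h; case: (nzeroP h).
by move=> k IH m /(succP hZF) [/IH|->] //; exact: (svalP k).
Qed.

Lemma dbl_even (k : N) : even (sval (dbl k)).
Proof.
move=> S S0 SS.
have hS : Def (fun n : N => sval n ∈ S) by exists S.
move: k; apply: indN; first exact: (Def_comp (f := dbl) (Fn_Dfun dbl) hS).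
  by rewrite dbl0; apply: S0; exact: nzeroP.
by move=> k IH; rewrite dblS; exact: SS.
Qed.

(** Evenness in the model is tested with the set of the doubles. *)
Lemma even_dbl (n : N) : even (sval n) -> exists k : N, n = dbl k.
Proof.
move=> h; have hS : Def (fun n : N => exists k : N, n = dbl k) by def.
have [S SP] := hS; have [c hc] := sep hZF (fun=> S) w (fo_mem M 0 1).
suff /hc [_ /SP //] : sval n ∈ c.
apply: h => [e ez|k /hc [kw kS]].
  have -> : e = sval (nzero hw) by apply: (empty_uniq hZF) ez _; exact: nzeroP.
  apply/hc; split; first exact: (svalP (nzero hw)).
  by apply/(SP (nzero hw)); exists O; rewrite dbl0.
have [m em] := natP kw; rewrite -em in kS *; have [j ej] := (SP m).2 kS.
apply/hc; split; first by do 2 apply: (omega_succ hZF hw); exact: (svalP m).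
apply/(SP (Definability.S (Definability.S m))); exists (Definability.S j); by rewrite dblS ej.
Qed.

Lemma finite_sequencesP s : s ∈ finite_sequences w <-> exists n, n ∈ w /\ is_fun s n w.
Proof.
apply: set_ofP; have [P hP] := powerP hZF (prod w w).
have h : fo (fun e : nat -> M => exists n, n ∈ e 1 /\
  ((forall p, p ∈ e 0 -> exists x, exists y, x ∈ n /\ y ∈ e 1 /\ p = opair x y) /\
  forall x, x ∈ n -> exists y, (exists p, p = opair x y /\ p ∈ e 0) /\
    forall y', (exists p, p = opair x y' /\ p ∈ e 0) -> y = y')) by fof hZF.
have [c hc] := sep hZF (fun=> w) P h; exists c => t; rewrite hc /=.
have E x y : (exists p, p = opair x y /\ p ∈ t) <-> opair x y ∈ t.
  by split => [[p [->]]|] //; exists (opair x y).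
split.
  move=> [_ [n [nw [h1 h2]]]]; exists n; split => //; split.
    by move=> p /h1 h3; apply/(prodP hZF).
  move=> x /h2 [y [/E h3 h4]]; exists y; split => // y' h5; apply: h4; exact/E.
move=> [n [nw [h1 h2]]].
have nsub : sub n w by have [k <-] := natP nw; exact: nat_sub.
split; last first.
  exists n; split => //; split => [p /h1 /(prodP hZF) //|x /h2 [y [h3 h4]]].
  by exists y; split => [|y' /E /h4]; first exact/E.
apply/hP => p /h1; rewrite !(prodP hZF) => -[x [y [/nsub hx h3]]].
by exists x, y.
Qed.

Lemma restrP (u n p : M) : p ∈ restr u n <-> p ∈ u /\ exists x y, x ∈ n /\ p = opair x y.
Proof.
apply: set_ofP.
have h : fo (fun e : nat -> M => exists x, exists y, x ∈ e 1 /\ e 0 = opair x y) by fof hZF.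
have [c hc] := sep hZF (fun=> n) u h; exists c => t; rewrite hc; done.
Qed.

Definition to_set (u : seqN) : M :=
  @graph M hZF Nat Nat (@nat_sort M w) (@nat_sort M w) u.
Lemma to_set_fun u : is_fun (to_set u) w w.
Proof. exact: (@is_fun_graph M hZF Nat Nat (@nat_sort M w) (@nat_sort M w) u). Qed.

Lemma restr_fun (u : seqN) (n : N) : restr (to_set u) (sval n) ∈ finite_sequences w.
Proof.
apply/finite_sequencesP; exists (sval n); split; first exact: (svalP n).
have [h1 h2] := to_set_fun u.
split.
  move=> p /restrP [/h1 /(prodP hZF) [x [y [hx [hy e]]]] [x' [y' [hx' e']]]].
  apply/(prodP hZF); exists x', y'; split => //; split => //.
  by move: e; rewrite e' => /(opair_inj hZF) [_ ->].
move=> x hx; have [y [hy uy]] := h2 x (nat_sub hx); exists y; split.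
  by apply/restrP; split => //; exists x, y.
by move=> y' /restrP [/uy].
Qed.

Lemma restr_agree (u v : seqN) (n : N) : (forall i : N, ltN i n -> u i = v i) ->
  restr (to_set u) (sval n) = restr (to_set v) (sval n).
Proof.
have H (a b : seqN) : (forall i : N, ltN i n -> a i = b i) ->
    forall p, p ∈ restr (to_set a) (sval n) -> p ∈ restr (to_set b) (sval n).
  move=> h p /restrP [/graphP [i e] [x [y [hx e']]]]; apply/restrP; split; last by exists x, y.
  have ix : sval i = x by move: e; rewrite e' => /(opair_inj hZF) [->].
  apply/graphP; exists i; rewrite e; congr (opair _ (sval _)); apply: h.
  by change (sval i ∈ sval n); rewrite ix.
by move=> h; apply: (ext_eq hZF) => p; split; apply: H => // i /h.
Qed.

Section Strategy.
Context (sigma : M) (hsigma : is_fun sigma (finite_sequences w) w).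

Lemma move_ex (u : seqN) (n : N) : exists m : N,
  ST.app sigma (restr (to_set u) (sval n)) = sval m /\
  forall y, opair (restr (to_set u) (sval n)) y ∈ sigma <-> y = sval m.
Proof.
have [h1 h2] := hsigma; have [y [hy uy]] := h2 _ (restr_fun u n).
have /(prodP hZF) [x [z [_ [zw /(opair_inj hZF) [_ e]]]]] := h1 _ hy.
have [m em] := natP zw; exists m.
have hb z' : opair (restr (to_set u) (sval n)) z' ∈ sigma <-> z' = sval m.
  by rewrite em -e; split => [/uy //|->].
by split => //; apply: theP.
Qed.

(** The move which the strategy [sigma] prescribes after the first [n] moves of [u]. *)
Definition move (p : seqN * N) : N := projT1 (cid (move_ex p.1 p.2)).
Lemma moveP u n : ST.app sigma (restr (to_set u) (sval n)) = sval (move (u, n)).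
Proof. by rewrite /move; case: cid => m []. Qed.

Lemma move_Dfun : Dfun move.
Proof.
apply: (@mdef_fo _ hZF _ _ _ (fun e => exists u, exists n, exists m, exists q, exists t,
  exists r, e 0 = opair q m /\ q = opair u n /\ r = opair t m /\ r ∈ e 1 /\
  forall p, p ∈ t <-> p ∈ u /\ exists x, exists y, x ∈ n /\ p = opair x y)
  (fun=> sigma)); first fof hZF.
move=> [[u n] m] /=; have E y : opair (restr (to_set u) (sval n)) y ∈ sigma <->
    y = sval (move (u, n)) by rewrite /move; case: cid => m' [].
split => [->|].
  exists (to_set u), (sval n), (sval (move (u, n))), (opair (to_set u) (sval n)).
  exists (restr (to_set u) (sval n)).
  exists (opair (restr (to_set u) (sval n)) (sval (move (u, n)))).
  do 3 (split => //); split; first exact/E.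
  by move=> p; rewrite restrP.
move=> [u' [n' [m' [q [t [r [/(opair_inj hZF) [<- <-] [/(opair_inj hZF) [<- <-] [-> [h ht]]]]]]]]]].
have et : t = restr (to_set u) (sval n) by apply: (ext_eq hZF) => p; rewrite ht restrP.
by move: h; rewrite et => /E; exact: sub_inj.
Qed.

Lemma move_agree (u v : seqN) (n : N) : (forall i : N, ltN i n -> u i = v i) -> move (u, n) = move (v, n).
Proof.
by move=> h; apply: sub_inj; rewrite -!moveP (restr_agree h).
Qed.

(** Strategies of the model act on finite sequences as sets, those of the frame on
    their codes; a code is translated by searching for a run which has it. *)
Lemma coded_strategy : exists s : seqN, forall (u : seqN) (n : N), s (pcode u n) = move (u, n).
Proof.
have hm := move_Dfun.
pose Q (c m : N) := exists (u : seqN) (n : N), c = pcode u n /\ m = move (u, n).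
have hQ : Def (fun p : N * N => Q p.1 p.2) by rewrite /Q; def.
have hs : Dfun (fun c => mu (Q c)) by def.
exists (mkFn hs) => u n.
have : Q (pcode u n) (mu (Q (pcode u n))).
  apply: (@muP fr (Q (pcode u n))); first by rewrite /Q; def.
  by exists (move (u, n)), u, n.
by move=> [v [k [/pcode_inj [<- h] e]]]; rewrite /= [LHS]e; apply/esym/move_agree.
Qed.
End Strategy.

(** A definable payoff is a set of the model, to which AD applies. *)
Lemma model_determined (P : seqN -> Prop) : AD M -> Def P -> determinedN P.
Proof.
move=> hAD [S hS].
have [A hA] := sep hZF (fun=> S)
  (carrier (mfn hZF (nat_sort (w := w)) (nat_sort (w := w)))) (fo_mem M 0 1).
have AP (u : seqN) : to_set u ∈ A <-> P u.
  by rewrite hA /= hS; split => [[]|h] //; split => //; apply: (val_in (mfn hZF _ _)).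
have Afun x : x ∈ A -> is_fun x w w.
  move=> /hA [/carrierP [u <-] _]; exact: (to_set_fun u).
have setE (u : seqN) (n : N) : ST.app (to_set u) (sval n) = sval (u n).
  exact: (@app_graph M hZF Nat Nat (@nat_sort M w) (@nat_sort M w) u n).
have fun_set := to_set_fun.
case: (hAD w A hw Afun) => [[s [hs win]]|[s [hs win]]]; [left | right];
  have [t ht] := coded_strategy hs; exists t => x hx.
  apply/AP; apply: win => // n /natP [m <-] /even_dbl [k ->].
  by rewrite setE hx ht (moveP hs).
move=> /AP; apply: win => // n /natP [m <-] odd_m.
have [[k ek]|[k ->]] := parity m; first by case: odd_m; rewrite ek; exact: dbl_even.
by rewrite setE hx ht (moveP hs).
Qed.

End ModelDeterminacy.

End ModelFrame.

Module ModelSpaces.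
Import Order.TTheory GRing.Theory Num.Theory.
Import Definability Coding Balls BallGames WadgeGames CompleteMetrics ModelSorts ModelFrame.
Local Open Scope ring_scope.

Import ST.

(** ** Metric spaces of a model *)

Section ModelSpace.
Context {M : structure} (hZF : ZF M) (hDC : DC M) (R : real_line M).
Context {w : M} (hw : is_omega w).
Notation fr := (mframe hZF hDC R hw).
Notation N := (Definability.N fr).
Notation K := (Definability.K fr).
Notation seqN := (@Fn fr N N _ _).
Context (X d : M) (hd : is_metric R X d).

Definition Pt := {x : M | x ∈ X}.
#[local] Instance ptsort : sort fr Pt := @msub M X.

Lemma mdist_ex (x y : Pt) : exists r : K, ST.app d (opair (sval x) (sval y)) = sval r /\
  forall z, opair (opair (sval x) (sval y)) z ∈ d <-> z = sval r.
Proof.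
have [hf _ _ _] := hd.
exact: (@app_is_fun M hZF _ _ (mprod hZF (@msub M X) (@msub M X)) (ksort hZF R) d (x, y) hf).
Qed.
Definition mdist x y : K := projT1 (cid (mdist_ex x y)).
Lemma mdistE x y : ST.app d (opair (sval x) (sval y)) = sval (mdist x y).
Proof. by rewrite /mdist; case: cid => r []. Qed.

Lemma mdist_Dfun : Dfun (fun p : Pt * Pt => mdist p.1 p.2).
Proof.
exists d => -[[x y] r] /=; rewrite /mdist; case: cid => r' [hr1 hr2] /=; rewrite hr2.
by split => [->|h] //; exact: kinj h.
Qed.

Lemma mdist_eq0 x y : mdist x y = 0 <-> x = y.
Proof.
have [_ h _ _] := hd; have {h} := h _ _ (svalP x) (svalP y); rewrite mdistE => h.
split => [e|->]; first by apply: sub_inj; apply/h; rewrite e.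
by apply: kinj; rewrite -mdistE; have [_ h' _ _] := hd; apply/(h' _ _ (svalP y) (svalP y)).
Qed.
Lemma mdistC x y : mdist x y = mdist y x.
Proof.
by have [_ _ h _] := hd; apply: kinj; rewrite -!mdistE; exact: h (svalP x) (svalP y).
Qed.
Lemma mdistT x y z : mdist x z <= mdist x y + mdist y z.
Proof.
have [_ _ _ h] := hd; apply/leKE; have := h _ _ _ (svalP x) (svalP y) (svalP z).
by rewrite !mdistE.
Qed.

Lemma mdistxx x : mdist x x = 0. Proof. exact/mdist_eq0. Qed.

Lemma ptP m : m ∈ X -> exists x : Pt, sval x = m.
Proof. by move=> h; exists (exist _ m h). Qed.
Lemma natP m : m ∈ w -> exists n : N, sval n = m.
Proof. exact: (ModelFrame.natP hZF hDC R hw). Qed.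
Lemma realP m : m ∈ ST.K R -> exists r : K, sval r = m.
Proof. by move=> h; exists (kmk hZF h). Qed.

Lemma set_of_def (P : Pt -> Prop) : Def P ->
  exists U, sub U X /\ forall x : Pt, sval x ∈ U <-> P x.
Proof.
move=> hP; exists (extent hZF (exist _ P hP)); split.
  by move=> m /extentP [x [_ <-]]; exact: (svalP x).
by move=> x; exact: (extent_mem hZF (exist _ P hP) x).
Qed.

Lemma openP U : is_open R X d U <-> sub U X /\ forall x : Pt, sval x ∈ U ->
  exists r, 0 < r /\ forall y : Pt, mdist x y < r -> sval y ∈ U.
Proof.
split=> -[hU h]; split => //.
  move=> x /h [r [/realP [s <-] s0 hs]]; exists s; split; first exact/ltKE.
  by move=> y /ltKE hy; apply: hs; [exact: (svalP y) | rewrite mdistE].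
move=> m mU; have [x ex] := ptP (hU _ mU); rewrite -ex in mU *.
have [r [r0 hr]] := h x mU; exists (sval r); split; first exact: (svalP r).
  exact: ((ltKE 0 r).1 r0).
by move=> m' /ptP [y <-]; rewrite mdistE => /ltKE /hr.
Qed.

Lemma ball_open (x : Pt) (r : K) : exists U, is_open R X d U /\
  forall y : Pt, sval y ∈ U <-> mdist x y < r.
Proof.
have hm := mdist_Dfun.
have [|U [UX hU]] := @set_of_def (fun y => mdist x y < r); first def.
exists U; split => //; apply/openP; split => // y /hU hy.
exists (r - mdist x y); split; first by rewrite subr_gt0.
by move=> z hz; apply/hU; have := mdistT x y z; lra.
Qed.

(** Inverting the injection of a countable dense set into the natural numbers. *)
Lemma dense_sequence : ST.separable R X d -> (exists x, x ∈ X) ->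
  exists q : @Fn fr N Pt _ _, forall x r, 0 < r -> exists n, mdist x (q n) < r.
Proof.
move=> [D [[w' [f [hw' hf finj]]] [DX dD]]] [x0 hx0].
have ew : w' = w := omega_uniq hZF hw' hw; subst w'.
have Xopen : is_open R X d X by apply/openP; split => // x _; exists 1; split => // y _; exact: (svalP y).
have [p [pD _]] := dD X Xopen (ex_intro (fun x => x ∈ X) x0 hx0).
have [p0 ep0] := ptP (DX _ pD).
pose fD := @app_is_fun M hZF _ _ (@msub M D) (@nat_sort M w) f.
have fE x n : x ∈ D -> opair x n ∈ f <-> n = ST.app f x.
  move=> xD; have [m [e h]] := fD (exist _ x xD) hf; rewrite /= in e h.
  by rewrite h e.
have appw x : x ∈ D -> ST.app f x ∈ w.
  by move=> xD; have [m [e _]] := fD (exist _ x xD) hf; rewrite e; exact: (svalP m).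
pose Q (n : N) (x : Pt) := sval x ∈ D /\ opair (sval x) (sval n) ∈ f.
have Qu n x y : Q n x -> Q n y -> x = y.
  move=> [xD xn] [yD yn]; apply: sub_inj; apply: finj => //.
  by rewrite -((fE _ _ xD).1 xn) -((fE _ _ yD).1 yn).
have hQ : Def (fun p : N * Pt => Q p.1 p.2).
  apply: (@mdef_fo _ hZF _ _ _ (fun e => exists n, exists x, exists r,
    e 0 = opair n x /\ x ∈ e 1 /\ r = opair x n /\ r ∈ e 2) (scons D (fun=> f))); first fof hZF.
  move=> [n x] /=; split => [[h1 h2]|].
    by exists (sval n), (sval x), (opair (sval x) (sval n)).
  by move=> [n' [x' [r [/(opair_inj hZF) [<- <-] [h1 [-> h2]]]]]].
have [g hg] : exists g : @Fn fr N Pt _ _, forall n x, Q n x -> g n = x.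
  have [||g hg] := @countable_choice fr Pt _ (fun n x => (exists y, Q n y) -> Q n x).
  - def.
  - move=> n; case: (pselect (exists y, Q n y)) => [[y hy]|h]; first by exists y.
    by exists p0.
  by exists g => n x hx; exact: (Qu n _ _ (hg n (ex_intro _ x hx)) hx).
exists g => x r r0; have [U [hU UE]] := ball_open x r.
have [|m [mD mU]] := dD U hU.
  by exists (sval x); apply/UE; rewrite mdistxx.
have [y ey] := ptP (DX _ mD); have [n en] := natP (appw _ mD).
exists n; rewrite (hg n y); first by apply/UE; rewrite ey.
by split; rewrite ey // fE.
Qed.

Section WithDense.
Context (q : @Fn fr N Pt _ _) (hq : forall x r, 0 < r -> exists n, mdist x (q n) < r).

Definition mspc : mspace fr :=
  @MSpace fr Pt ptsort mdist mdist_Dfun mdist_eq0 mdistC mdistT q hq.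

Notation fnX := (@Fn fr mspc mspc _ _).
(** A dense sequence passes to the model as its range, which is countable there since
    each point can be sent to its least index. *)
Lemma range_set (D : @Fn fr N mspc _ _) : dense_seq D ->
  exists S, [/\ countable S, ST.dense R X d S &
    forall x : Pt, sval x ∈ S <-> exists n, D n = x].
Proof.
move=> dD.
have [|S [SX hS]] := @set_of_def (fun x : mspc => exists n, D n = x); first def.
exists S; split => //; last first.
  split => // U /openP [UX hU] [m mU]; have [x ex] := ptP (UX _ mU).
  rewrite -ex in mU; have [r [r0 hr]] := hU x mU; have [n hn] := dD x r r0.
  by exists (sval (D n)); split; [apply/hS; exists n | exact: hr].
pose sS : sort fr {x : M | x ∈ S} := @msub M S.
pose incl (x : {x : M | x ∈ S}) : mspc := exist _ (sval x) (SX _ (svalP x)).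
have hincl : @Dfun fr _ _ sS _ incl.
  apply: (@mdef_fo _ hZF _ _ _ (fun e => exists x, e 0 = opair x x) (fun=> S)); first fof hZF.
  move=> [x y] /=; split => [->|[z /(opair_inj hZF) [e1 e2]]]; first by exists (sval x).
  by apply: sub_inj; rewrite /= e1 e2.
have hf : @Dfun fr _ _ sS _ (fun x => mu (fun n => D n = incl x)) by def.
pose f := exist _ _ hf.
have fE x : D (sval f x) = incl x.
  apply: (@muP fr (fun n => D n = incl x)); first def.
  by apply/hS; exact: (svalP x).
exists w, (@graph M hZF _ _ sS (@nat_sort M w) f); split => //.
  exact: (@is_fun_graph M hZF _ _ sS (@nat_sort M w) f).
move=> x y xS yS; have := @app_graph M hZF _ _ sS (@nat_sort M w) f.
move=> E; have := E (exist _ x xS); have := E (exist _ y yS); rewrite /= => -> ->.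
move=> /sub_inj e; have := fE (exist _ x xS); rewrite /= e fE.
by move=> /(congr1 sval).
Qed.

Lemma imageP f A : is_fun f X X -> sub A X ->
  forall y, y ∈ image f A <-> exists x, x ∈ A /\ y = ST.app f x.
Proof.
move=> hf AX; apply: set_ofP.
pose fX := @app_is_fun M hZF _ _ (@msub M X) (@msub M X) f.
have h : fo (fun e : nat -> M => exists x, exists p, x ∈ e 1 /\ p = opair x (e 0) /\ p ∈ e 2)
  by fof hZF.
have [c hc] := sep hZF (scons A (fun=> f)) X h; exists c => y; rewrite hc /=; split.
  move=> [_ [x [p [xA [-> hp]]]]]; exists x; split => //.
  by have [b [e hb]] := fX (exist _ x (AX _ xA)) hf; rewrite e; apply/hb.
move=> [x [xA ->]]; have [b [e hb]] := fX (exist _ x (AX _ xA)) hf; rewrite /= in e hb.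
rewrite e; split; first exact: (svalP b).
by exists x, (opair x (sval b)); split => //; split => //; apply/hb.
Qed.

(** In the model, continuity is expressed by images of open sets being open; with
    coded balls it becomes the usual condition, for the homeomorphism and its
    inverse. *)
Lemma model_cdh : ST.countable_dense_homogeneous R X d -> cdh mspc.
Proof.
move=> [_ hcdh] D E dD dE.
have [SD [cD dSD hSD]] := range_set dD; have [SE [cE dSE hSE]] := range_set dE.
have [hm [[hf hinj him hopen] himD]] := hcdh _ _ cD dSD cE dSE.
have [f ef] := (@is_funP M hZF _ _ (@msub M X) (@msub M X) hm).1 hf.
pose h : fnX := f.
have hE (x : Pt) : ST.app hm (sval x) = sval (h x).
  by rewrite -ef; exact: (@app_graph M hZF _ _ (@msub M X) (@msub M X) f x).
have surj y : exists x, h x = y.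
  have : sval y ∈ image hm X by rewrite him; exact: (svalP y).
  rewrite imageP // => -[m [/ptP [x <-]]]; rewrite hE => e.
  by exists x; apply/esym/sub_inj.
have inj x y : h x = h y -> x = y.
  by move=> e; apply: sub_inj; apply: hinj (svalP x) (svalP y) _; rewrite !hE e.
pose h'f y := projT1 (cid (surj y)).
have hK y : h (h'f y) = y by rewrite /h'f; case: cid.
have hh' : Dfun h'f.
  apply: (Dfun_graph (R := fun (y : mspc) (x : mspc) => h x = y)); last def.
  by move=> y x; split => [<-|->] //; apply: inj; rewrite hK.
pose h' : fnX := mkFn hh'.
have h'K : cancel h h' by move=> x; apply: inj; exact: hK.
have img U (x : Pt) : sub U X -> sval (h x) ∈ image hm U <-> sval x ∈ U.
  move=> UX; rewrite imageP //; split => [[m [mU]]|xU].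
    have [y ey] := ptP (UX _ mU); rewrite -ey in mU *; rewrite hE => /sub_inj /inj ->.
    by [].
  by exists (sval x); rewrite hE.
exists h, h'; split => //.
- move=> x r r0; have [V [hV VE]] := ball_open (h x) r.
  have [|U [UX hU]] := @set_of_def (fun y : mspc => mdist (h x) (h y) < r).
    by have hm' := mdist_Dfun; def.
  have eV : image hm U = V.
    apply: (ext_eq hZF) => m; split.
      rewrite imageP // => -[m' [m'U ->]]; have [y ey] := ptP (UX _ m'U).
      by rewrite -ey hE; apply/VE/hU; rewrite ey.
    move=> mV; have [y ey] := ptP (proj1 hV _ mV); have [z ez] := surj y.
    by rewrite -ey -ez; apply/img => //; apply/hU; rewrite ez; apply/VE; rewrite ey.
  have /openP [_ hop] : is_open R X d U by apply/(hopen U UX); rewrite eV.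
  have [|s [s0 hs]] := hop x; first by apply/hU; rewrite mdistxx.
  by exists s; split => // y /hs /hU.
- move=> y r r0; have [U [hU UE]] := ball_open (h' y) r; have UX := proj1 hU.
  have /openP [_ hop] : is_open R X d (image hm U) by apply/(hopen U UX).
  have yU : sval y ∈ image hm U by rewrite -[y]hK img // UE mdistxx.
  have [s [s0 hs]] := hop y yU; exists s; split => // z /hs.
  by rewrite -[z in sval z]hK img // => /UE.
- split => [n|n].
    have : sval (h (D n)) ∈ SE.
      by rewrite -himD img; [apply/hSD; exists n | exact: (proj1 dSD)].
    by move=> /hSE [m <-]; exists m.
  have [x ex] := surj (E n).
  have : sval (h x) ∈ image hm SD by rewrite himD ex; apply/hSE; exists n.
  rewrite img; last exact: (proj1 dSD).
  by move=> /hSD [m em]; exists m; rewrite em.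
Qed.

Lemma sub_leN (n m : N) : sub (sval n) (sval m) <-> leN n m.
Proof.
split=> [h|h x xn].
  by apply/leNNgt => mn; apply: (@ltN_irr fr m); exact: h.
have [k ek] := natP (nat_sub xn); rewrite -ek in xn *.
by case/leN_eqVlt: h => [h|<- //]; exact: (@ltN_trans fr k n m xn h).
Qed.

Lemma model_complete : completely_metrizable_in mspc -> ST.completely_metrizable R X d.
Proof.
move=> [rho [hrho [rho0 rhoC rhoT] dr rc comp]].
pose f : {f : Pt * Pt -> K | mfun hZF (mprod hZF (@msub M X) (@msub M X)) (ksort hZF R) f} :=
  exist _ _ hrho.
pose d' := graph f.
have d'E (x y : Pt) : ST.app d' (opair (sval x) (sval y)) = sval (rho x y).
  exact: (app_graph f (x, y)).
exists d'; split.
- split; first exact: (is_fun_graph f).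
  + move=> _ _ /ptP [x <-] /ptP [y <-]; rewrite d'E; split.
      by move=> e; congr sval; apply/rho0; exact: (@kinj M hZF R (rho x y) 0 e).
    by move=> /sub_inj ->; rewrite ((rho0 y y).2 erefl).
  + by move=> _ _ /ptP [x <-] /ptP [y <-]; rewrite !d'E rhoC.
  + move=> _ _ _ /ptP [x <-] /ptP [y <-] /ptP [z <-]; rewrite !d'E.
    exact: ((leKE _ _).1 (rhoT x y z)).
- move=> U; rewrite openP; split=> -[UX hU]; split => //.
    move=> _ /[dup] /UX /ptP [x <-] /hU [r [r0 hr]]; exists (sval r).
    split; [exact: (svalP r) | exact: ((ltKE 0 r).1 r0) |].
    move=> _ /ptP [y <-]; rewrite d'E => /ltKE h; apply: hr; exact: le_lt_trans (dr x y) h.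
  move=> x /hU [_ [/realP [r <-] r0 hr]]; have [s [s0 hs]] := rc x r ((ltKE 0 r).2 r0).
  exists s; split => // y /hs h; apply: hr (svalP y) _.
  by rewrite d'E; exact/ltKE.
move=> w' s hw' hs hc; have ew : w' = w := omega_uniq hZF hw' hw; subst w'.
have [u eu] := (@is_funP M hZF _ _ (@nat_sort M w) (@msub M X) s).1 hs.
pose v : @Fn fr N mspc _ _ := u.
have vE (n : N) : ST.app s (sval n) = sval (v n).
  by rewrite -eu; exact: (@app_graph M hZF _ _ (@nat_sort M w) (@msub M X) u n).
have [|x hx] := comp v.
  move=> r r0; have [_ [/natP [n0 <-] h]] := hc (sval r) (svalP r) ((ltKE 0 r).1 r0).
  exists n0 => m n /sub_leN h1 /sub_leN h2; apply/ltKE.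
  by have := h _ _ (svalP m) (svalP n) h1 h2; rewrite !vE d'E.
exists (sval x); split; first exact: (svalP x).
move=> _ /realP [r <-] r0; have [n0 hn0] := hx r ((ltKE 0 r).2 r0).
exists (sval n0); split; first exact: (svalP n0).
move=> _ /natP [n <-] /sub_leN h; rewrite vE d'E; apply/ltKE.
by rewrite rhoC; exact: hn0.
Qed.
End WithDense.
End ModelSpace.

Theorem model_cdh_completely_metrizable (M : structure) : ZF M -> DC M -> AD M ->
  forall (R : real_line M) (X d : M), is_metric R X d -> ST.separable R X d ->
  ST.countable_dense_homogeneous R X d -> ST.completely_metrizable R X d.
Proof.
move=> hZF hDC hAD R X d hd hs hcdh.
have [w hw] := omega_ex hZF.
case: (pselect (exists x, x ∈ X)) => [hX|noX]; last first.
  (* the empty space has no sequence of points, so every metric on it is complete *)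
  exists d; split => //; move=> w' s [[[z [_ zw]] _] _] [hs1 hs2].
  have [y [/hs1 /(prodP hZF) [a [b [_ [bX _]]]] _]] := hs2 z zw.
  by case: noX; exists b.
have [q hq] := dense_sequence hZF hDC hw hd hs hX.
apply: (@model_complete M hZF hDC R w hw X d hd q hq).
apply: cdh_completely_metrizable; last exact: model_cdh.
move=> v wf; split; apply: model_determined => //; def.
Qed.

End ModelSpaces.

Module ProjectiveSets.
Import Order.TTheory GRing.Theory Num.Theory.
Local Open Scope classical_set_scope.
Local Open Scope ring_scope.

(** * Projective sets *)

Notation BS := baire_space.

(** Functions into discrete spaces.  Predicates on sequences which depend on finitely
    many terms are of this kind, and locally constant predicates are clopen sets. *)
Definition locally_constant (T : topologicalType) (D : Type) (f : T -> D) :=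
  forall x, \forall y \near x, f y = f x.

Section LocallyConstant.
Context (T : topologicalType).

Lemma lc_map D E (g : D -> E) (f : T -> D) :
  locally_constant f -> locally_constant (fun x => g (f x)).
Proof. by move=> h x; near=> y; congr g; near: y; exact: h. Unshelve. all: end_near. Qed.

Lemma lc_cst D (c : D) : locally_constant (fun _ : T => c).
Proof. by move=> x; near=> y. Unshelve. all: end_near. Qed.

(** This covers functions which look up a term of a sequence whose index is itself
    read off from the argument. *)
Lemma lc_pick D E (f : T -> D) (F : D -> T -> E) :
  locally_constant f -> (forall d, locally_constant (F d)) ->
  locally_constant (fun x => F (f x) x).
Proof.
move=> hf hF x; near=> y.
by have -> : f y = f x; [near: y; exact: hf | near: y; exact: hF].
Unshelve. all: end_near. Qed.

Lemma lc_pair D E (f : T -> D) (g : T -> E) :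
  locally_constant f -> locally_constant g -> locally_constant (fun x => (f x, g x)).
Proof.
move=> hf hg; apply: (lc_pick (F := fun d x => (d, g x))) => // d.
exact: (lc_map (pair d)).
Qed.

Lemma lc_comp (U : topologicalType) D (f : U -> D) (g : T -> U) :
  continuous g -> locally_constant f -> locally_constant (fun x => f (g x)).
Proof. by move=> hg hf x; exact: (hg x _ (hf (g x))). Qed.

Lemma lc_open (P : set T) : locally_constant P -> open P.
Proof.
move=> h; rewrite openE => x Px; rewrite /interior.
by near=> y; have -> : P y = P x by near: y; exact: h.
Unshelve. all: end_near. Qed.
End LocallyConstant.

Lemma cvg_BS (F : set_system BS) (z : BS) : Filter F ->
  (forall k, F [set w | w k = z k]) -> F --> z.
Proof.
move=> FF h; apply/cvg_sup => k A /= [B [[C oC <-] Cz] BA].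
apply: filterS BA _; apply: filterS (h k) => w /= ->; exact: Cz.
Qed.

Lemma lc_coord k : locally_constant (fun z : BS => z k).
Proof.
move=> z; exact: (@proj_continuous nat (fun=> nat) k z _ (discrete_set1 (z k))).
Qed.

Lemma lc_mkseq k : locally_constant (fun z : BS => mkseq z k).
Proof.
elim: k => [|k IH]; first exact: lc_cst.
have -> : (fun z : BS => mkseq z k.+1) = (fun z => rcons (mkseq z k) (z k)).
  by apply/funext => z; rewrite mkseqS.
exact: (lc_map (fun p : seq nat * nat => rcons p.1 p.2) (lc_pair IH (@lc_coord k))).
Qed.

Lemma continuous_BS (T : topologicalType) (f : T -> BS) :
  (forall k, locally_constant (fun x => f x k)) -> continuous f.
Proof. by move=> h x; apply: cvg_BS => k; exact: h. Qed.

Lemma nbhs_BS (z : BS) (A : set BS) : nbhs z A ->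
  exists n, forall w : BS, (forall i, (i < n)%N -> w i = z i) -> A w.
Proof.
pose cyl n : set BS := [set w | forall i, (i < n)%N -> w i = z i].
pose F := filter_from [set: nat] cyl.
have FF : Filter F.
  apply: filter_from_filter; first by exists 0%N.
  move=> i j _ _; exists (maxn i j) => // w hw; split => k hk; apply: hw.
    by rewrite leq_max hk.
  by rewrite leq_max hk orbT.
have : F --> z by apply: cvg_BS => k; exists k.+1 => // w /=; apply.
by move=> h /h [n _ hn]; exists n.
Qed.

Lemma continuous_pair (T U V : topologicalType) (f : T -> U) (g : T -> V) :
  continuous f -> continuous g -> continuous (fun x => (f x, g x)).
Proof.
move=> hf hg x; exact: (cvg_pair (hf x : f y @[y --> x] --> f x) (hg x : g y @[y --> x] --> g x)).
Qed.

Lemma continuous_fst (T U : topologicalType) : continuous (@fst T U).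
Proof. by move=> p; exact: cvg_fst. Qed.

Lemma continuous_snd (T U : topologicalType) : continuous (@snd T U).
Proof. by move=> p; exact: cvg_snd. Qed.

Lemma continuous_comp_fun (T U V : topologicalType) (f : T -> U) (g : U -> V) :
  continuous f -> continuous g -> continuous (fun x => g (f x)).
Proof. by move=> hf hg x; apply: continuous_comp; [exact: hf | exact: hg]. Qed.

Section Classes.
Implicit Types (T U : topologicalType).

Lemma boldSigma1_preimage n T U (f : T -> U) (A : set U) :
  continuous f -> boldSigma1 n A -> boldSigma1 n (f @^-1` A).
Proof.
elim: n T U f A => [|n IH] T U f A hf /=; first by apply: open_comp => ? _.
move=> [B [hB ->]]; pose g (p : T * BS) := (f p.1, p.2).
have hg : continuous g.
  apply: continuous_pair; last exact: continuous_snd.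
  exact: continuous_comp_fun (@continuous_fst _ _) hf.
exists (g @^-1` B); split; first by rewrite preimage_setC; exact: IH.
apply/seteqP; split=> [x [[u z] Bu /= uf]|x [[y z] By /= <-]].
  by exists (x, z) => //; rewrite /g /preimage /= -uf.
by exists (f y, z).
Qed.

(** A dummy variable is projected away; hence the complement of a set of level [n] is
    of level [n.+1], over any space. *)
Lemma boldSigma1_setC n T (A : set T) :
  boldSigma1 n (~` A) -> boldSigma1 n.+1 A.
Proof.
move=> h; exists (fst @^-1` A); split.
  by rewrite preimage_setC; apply: boldSigma1_preimage => //; exact: continuous_fst.
apply/seteqP; split=> [x Ax|x [p Ap <-] //].
by exists (x, (fun=> 0%N)).
Qed.

(** The terms with even and with odd index give a homeomorphism of the Baire space
    with its square, which merges two existential quantifiers into one. *)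
Definition half (b : bool) (z : BS) : BS := fun k => z (b + k.*2)%N.

Lemma half_continuous b : continuous (half b).
Proof. by apply: continuous_BS => k; exact: lc_coord. Qed.

Lemma half_merge (z w : BS) : exists v, half false v = z /\ half true v = w.
Proof.
exists (fun n => if odd n then w n./2 else z n./2); split; apply/funext => k.
  by rewrite /half add0n odd_double doubleK.
by rewrite /half oddD odd_double /= uphalf_double.
Qed.

(** The two statements are proved together since the class of the complements
    exchanges unions and intersections. *)
Lemma boldSigma1_UI n T (A B : set T) : boldSigma1 n A -> boldSigma1 n B ->
  boldSigma1 n (A `|` B) /\ boldSigma1 n (A `&` B).
Proof.
elim: n T A B => [|n IH] T A B /=; first by split; [exact: openU | exact: openI].
move=> [A' [hA ->]] [B' [hB ->]]; split.
  exists (A' `|` B'); rewrite setCU image_setU; split => //.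
  by have [] := IH _ _ _ hA hB.
pose g b (p : T * BS) := (p.1, half b p.2).
have hg b : continuous (g b).
  apply: continuous_pair; first exact: continuous_fst.
  exact: continuous_comp_fun (@continuous_snd _ _) (@half_continuous b).
exists (g false @^-1` A' `&` g true @^-1` B'); split.
  rewrite setCI.
  have h b (C : set (T * BS)) : boldSigma1 n (~` C) -> boldSigma1 n (~` (g b @^-1` C)).
    by move=> hC; rewrite preimage_setC; apply: boldSigma1_preimage (hg b) hC.
  exact: (IH _ _ _ (h false _ hA) (h true _ hB)).1.
apply/seteqP; split=> [x [[[x1 z] Az /= e1] [[x2 w] Bw /= e2]]|x [[y v] [Av Bv] /= <-]].
  have [v [vz vw]] := half_merge z w; subst x1 x2.
  by exists (x, v) => //; split; rewrite /g /preimage /= ?vz ?vw.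
by split; [exists (y, half false v) | exists (y, half true v)].
Qed.
End Classes.

(** The topological notion: open sets are F-sigma sets. *)
Definition perfect_space (T : topologicalType) := forall W : set T, open W ->
  exists F : nat -> set T, (forall n, closed (F n)) /\ W = \bigcup_n F n.

Lemma closed_sections (T : topologicalType) D (f : T -> D) (F : D -> set T) :
  locally_constant f -> (forall d, closed (F d)) -> closed [set x | F (f x) x].
Proof.
move=> hf hF; rewrite -openC openE => x /= Fx.
have : nbhs x (~` F (f x)) by apply: open_nbhs_nbhs; split => //; rewrite openC.
move=> h; rewrite /interior; near=> y => /=.
have -> : f y = f x by near: y; exact: hf.
by near: y.
Unshelve. all: end_near. Qed.

(** An open set [W] of the product is the union over all finite sequences [s] of the
    rectangles [V s] times the cylinder of [s], where [V s] is the largest open set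
    for which the rectangle is contained in [W]. *)
Lemma perfect_prod (T : topologicalType) :
  perfect_space T -> perfect_space (T * BS)%type.
Proof.
move=> hT W oW.
pose V (s : seq nat) : set T := \bigcup_(U in [set U | open U /\
  forall x (z : BS), U x -> mkseq z (size s) = s -> W (x, z)]) U.
have oV s : open (V s) by apply: bigcup_open => U [].
pose F s := projT1 (cid (hT _ (oV s))).
have [cF VF] : (forall s n, closed (F s n)) /\ forall s, V s = \bigcup_n F s n.
  by split=> s; rewrite /F; case: cid => ? [].
pose C s n : set (T * BS) := [set p | mkseq p.2 (size s) = s /\ F s n p.1].
have cC s n : closed (C s n).
  have cl1 : closed [set p : T * BS | mkseq p.2 (size s) = s].
    rewrite -openC; apply: lc_open.
    exact: (lc_map (fun t => ~ t = s) (lc_comp (@continuous_snd T BS) (@lc_mkseq _))).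
  apply: closedI => //.
  by apply: (preimage_closed _ (cF s n)) => p _; exact: continuous_fst.
exists (fun m => if unpickle m is Some (s, n) then C s n else set0).
split=> [m|].
  by case: unpickle => [[s n]|]; [exact: cC | exact: closed0].
apply/seteqP; split=> [[x z] Wxz|[x z] [m _]].
  have /= : nbhs (x, z) W by apply: open_nbhs_nbhs.
  case=> -[A B] /= [nA /nbhs_BS [k hk]] AB.
  have : V (mkseq z k) x.
    exists A^°; last exact: nA.
    split; first exact: open_interior.
    move=> y w /interior_subset Ay; rewrite size_mkseq => e; apply: (AB (y, w)).
    split => //=; apply: hk => i ik.
    by rewrite -(nth_mkseq 0%N w ik) e nth_mkseq.
  rewrite VF => -[n _ Fn]; exists (pickle (mkseq z k, n)) => //.
  by rewrite pickleK; split; rewrite /= ?size_mkseq.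
case: unpickle => [[s n] [/= e Fn]|//].
by have : V s x; [rewrite VF; exists n | move=> [U [_ hU] Ux]; exact: (hU)].
Qed.

(** The union of closed sets [F n] is the projection of the closed set of the pairs
    [(x, z)] with [x] in [F (z 0)]. *)
Lemma open_boldSigma1 (T : topologicalType) (W : set T) :
  perfect_space T -> open W -> boldSigma1 1 W.
Proof.
move=> hT /hT [F [cF ->]]; exists [set p : T * BS | F (p.2 0%N) p.1]; split => /=.
  rewrite openC; apply: (closed_sections (f := fun p : T * BS => p.2 0%N) (F := fun n => fst @^-1` F n)).
    exact: (lc_comp (@continuous_snd T BS) (@lc_coord 0)).
  by move=> n; apply: (preimage_closed _ (cF n)) => p _; exact: continuous_fst.
apply/seteqP; split=> [x [n _ Fx]|x [[y z] /= Fy <-]].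
  by exists (x, (fun=> n)).
by exists (z 0%N).
Qed.

Lemma boldSigma1S (T : topologicalType) (A : set T) n :
  perfect_space T -> boldSigma1 n A -> boldSigma1 n.+1 A.
Proof.
elim: n T A => [|n IH] T A hT; first exact: open_boldSigma1.
move=> [B [hB ->]]; exists B; split => //; apply: IH => //; exact: perfect_prod.
Qed.

(** The classes of the hierarchy need not increase over an arbitrary space.  Asking
    for all levels from some level on gives a class which is closed under Boolean
    operations, preimages and projections over every space. *)
Definition eventually_projective (T : topologicalType) (A : set T) :=
  exists n, forall m, (n <= m)%N -> boldSigma1 m A.
Notation EP := eventually_projective.

Section EventuallyProjective.
Context (T : topologicalType).
Implicit Types (A B : set T).

Lemma EP_projective A : EP A -> projective A.
Proof. by move=> [n h]; exists n; apply: h. Qed.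

Lemma projective_EP A : perfect_space T -> projective A -> EP A.
Proof.
move=> hT [n h]; exists n.+1 => m /subnK <-; elim: (m - n.+1)%N => // k IH.
by rewrite addSn; exact: boldSigma1S.
Qed.

Lemma EP_preimage (U : topologicalType) (f : U -> T) A :
  continuous f -> EP A -> EP (f @^-1` A).
Proof. by move=> hf [n h]; exists n => m /h; exact: boldSigma1_preimage. Qed.

Lemma EP_setC A : EP A -> EP (~` A).
Proof.
move=> [n h]; exists n.+1 => -[//|m] hm; apply: boldSigma1_setC; rewrite setCK; exact: h.
Qed.

Lemma EP_setI A B : EP A -> EP B -> EP (A `&` B).
Proof.
move=> [n h] [k h']; exists (maxn n k) => m; rewrite geq_max => /andP[/h ? /h' ?].
by apply: (boldSigma1_UI _ _).2.
Qed.

(** Clopen sets belong to the levels 0 and 1, and taking complements twice raises the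
    level by 2. *)
Lemma EP_lc (P : T -> Prop) : locally_constant P -> EP [set x | P x].
Proof.
have raise A n k : boldSigma1 n A -> boldSigma1 (n + k.*2) A.
  elim: k => [|k IH h]; first by rewrite addn0.
  rewrite doubleS !addnS; apply: boldSigma1_setC; apply: boldSigma1_setC.
  by rewrite setCK; exact: IH.
move=> h; exists 1%N => m _.
have h0 : boldSigma1 0 [set x | P x] by exact: lc_open.
have h1 : boldSigma1 1 [set x | P x].
  by apply: boldSigma1_setC; apply: lc_open; exact: (lc_map not h).
rewrite -(odd_double_half m); case: (odd m); exact: raise.
Qed.
End EventuallyProjective.

Lemma EP_proj (T : topologicalType) (A : set (T * BS)) : EP A -> EP (fst @` A).
Proof.
move=> hA; have [n h] := EP_setC hA; exists n.+1 => -[//|m] hm; exists A; split => //; exact: h.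
Qed.

Section Predicates.
Implicit Types T : topologicalType.

Lemma EP_and T (P Q : T -> Prop) : EP P -> EP Q -> EP (fun x => P x /\ Q x).
Proof. exact: EP_setI. Qed.

Lemma EP_not T (P : T -> Prop) : EP P -> EP (fun x => ~ P x).
Proof. exact: EP_setC. Qed.

Lemma EP_iff T (P Q : T -> Prop) : EP P -> EP Q -> EP (fun x => P x <-> Q x).
Proof.
move=> hP hQ; have -> : (fun x => P x <-> Q x) =
    (fun x => ~ (P x /\ ~ Q x) /\ ~ (Q x /\ ~ P x)).
  apply/funext => x; apply/propext; split=> [[PQ QP]|[h1 h2]].
    by split=> -[? ?]; auto.
  by split=> h; apply: contrapT => ?; [apply: h1 | apply: h2].
by apply: EP_and; apply: EP_not; apply: EP_and => //; apply: EP_not.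
Qed.

Lemma EP_ex T (P : T -> BS -> Prop) :
  EP (fun p : T * BS => P p.1 p.2) -> EP (fun x => exists z, P x z).
Proof.
move=> /EP_proj; congr EP; apply/seteqP; split=> x.
  by move=> [[y z] /= h <-]; exists z.
by move=> [z h]; exists (x, z).
Qed.

(** A quantifier over numbers is a quantifier over the Baire space that only looks at
    the first term. *)
Lemma EP_exn T (P : T -> nat -> Prop) :
  EP (fun p : T * BS => P p.1 (p.2 0%N)) -> EP (fun x => exists n, P x n).
Proof.
move=> h; have := EP_ex (P := fun x z => P x (z 0%N)) h; congr EP.
apply/seteqP; split=> x; first by move=> [z hz]; exists (z 0%N).
by move=> [n hn]; exists (fun=> n).
Qed.

Lemma EP_alln T (P : T -> nat -> Prop) :
  EP (fun p : T * BS => P p.1 (p.2 0%N)) -> EP (fun x => forall n, P x n).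
Proof.
move=> h; have := EP_not (EP_exn (P := fun x n => ~ P x n) (EP_not h)); congr EP.
apply/seteqP; split=> x hx; last by move=> [n]; apply; exact: hx.
by move=> n; apply: contrapT => h'; apply: hx; exists n.
Qed.
End Predicates.

End ProjectiveSets.

Module PolishCoding.
Import Order.TTheory GRing.Theory Num.Theory.
Import ProjectiveSets.
Local Open Scope classical_set_scope.
Local Open Scope ring_scope.

Import metricType_numDomainType.
(** * Complete metric spaces as images of the Baire space *)

Lemma perfect_metric (R : realType) (Y : metricType R) : perfect_space Y.
Proof.
move=> W oW.
exists (fun n => [set x | forall v, ~ W v -> n.+1%:R^-1 <= mdist x v]); split=> [n|].
  rewrite -openC openE => x /= /existsNP [v /not_implyP [Wv /negP]].
  rewrite -ltNge => xv; apply/nbhs_mdistP.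
  exists (n.+1%:R^-1 - mdist x v); first by rewrite /= subr_gt0.
  move=> u /= xu hu; have := hu v Wv; rewrite leNgt => /negP; apply.
  apply: le_lt_trans (metric_triangle u x v) _.
  by rewrite (metric_sym u x) -ltrBrDr.
apply/seteqP; split=> [x Wx|x [n _ hx]]; last first.
  by apply: contrapT => /hx; rewrite mdistxx leNgt invr_gt0 ltr0n.
have : nbhs x W by apply: open_nbhs_nbhs.
move=> /nbhs_mdistP [e /= e0 he]; exists (Num.trunc e^-1) => // v Wv /=.
rewrite leNgt; apply/negP => xv; apply: Wv; apply: he => /=; apply: lt_trans xv _.
rewrite invf_plt ?posrE ?ltr0n //; exact: truncnS_gt.
Qed.

Section Limits.
Context (R : realType) (Y : metricType R) (y : nat -> Y).
Hypothesis complete_Y : complete_space Y.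
Implicit Types z : BS.

Local Notation h n := (2^-1 ^+ n : R).

(** A sequence [z] of indices is read as a name of a point: the index [z k.+1] is
    accepted only if its point is close to the current one.  The accepted points
    form a Cauchy sequence for every [z], and rapidly converging names are
    accepted without change. *)
Fixpoint frozen z n : nat := if n is k.+1 then
  if mdist (y (frozen z k)) (y (z k.+1)) < h k then z k.+1 else frozen z k
  else z 0%N.

Lemma frozen_lc n : locally_constant (fun z => frozen z n).
Proof.
elim: n => [|n IH]; first exact: lc_coord.
exact: (lc_map (fun p : nat * nat =>
  if mdist (y p.1) (y p.2) < h n then p.2 else p.1) (lc_pair IH (@lc_coord n.+1))).
Qed.

Lemma h_gt0 n : 0 < h n. Proof. by rewrite exprn_gt0. Qed.

(** The bound is the exact sum of the geometric progression, which makes the induction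
    work. *)
Lemma frozen_dist z k m : (k <= m)%N ->
  mdist (y (frozen z k)) (y (frozen z m)) <= 2 * h k - 2 * h m.
Proof.
move=> /subnK <-; elim: (m - k)%N => [|i IH]; first by rewrite mdistxx subrr.
apply: le_trans (metric_triangle _ (y (frozen z (i + k))) _) _.
have : mdist (y (frozen z (i + k))) (y (frozen z (i.+1 + k))) <= h (i + k).
  by rewrite addSn /=; case: ifP => [/ltW //|_]; rewrite mdistxx ltW ?h_gt0.
rewrite addSn exprS; lra.
Qed.

Lemma h_small e : 0 < e -> exists n, h n < e.
Proof.
move=> e0; have [n _ hn] := near_infty_natSinv_expn_lt (PosNum e0).
by exists n; have := hn n (leqnn _); rewrite /= div1r exprVn.
Qed.

Lemma ex_decode z : exists l, forall k, mdist (y (frozen z k)) l <= 2 * h k.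
Proof.
have hc : cauchy ((y \o frozen z) @ \oo).
  apply: cauchy_exP => e e0.
  have [n hn] : exists n, h n < e / 2 by apply: h_small; lra.
  exists (y (frozen z n)), n => // m /= nm; rewrite ballEmdist /=.
  have := frozen_dist z nm; have := h_gt0 m; lra.
have [l hl] := complete_Y _ hc.
exists l => k; apply/ler_addgt0Pr => e e0.
have [n _ hn] := cvgr_dist_lt hl e0.
have := hn (maxn n k) (leq_maxl _ _); rewrite /= metric_sym => hm.
have := frozen_dist z (leq_maxr n k); have := h_gt0 (maxn n k).
have := metric_triangle (y (frozen z k)) (y (frozen z (maxn n k))) l; lra.
Qed.

Definition decode z : Y := projT1 (cid (ex_decode z)).
Lemma decodeP z k : mdist (y (frozen z k)) (decode z) <= 2 * h k.
Proof. exact: (projT2 (cid (ex_decode z))). Qed.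

Lemma decode_continuous : continuous decode.
Proof.
move=> z A /nbhs_mdistP [e /= e0 he].
have [n hn] : exists n, h n < e / 4 by apply: h_small; lra.
apply: filterS (frozen_lc n z) => w /= ew; apply: he => /=.
have := decodeP z n; have := decodeP w n; rewrite ew.
have := metric_triangle (decode z) (y (frozen z n)) (decode w).
rewrite (metric_sym (decode z) (y _)); lra.
Qed.

(** Open balls become countable unions of clopen conditions on the name. *)
Lemma decode_near z c r :
  mdist (decode z) c < r <-> exists k, mdist (y (frozen z k)) c < r - 2 * h k.
Proof.
split=> [zc|[k hk]]; last first.
  have := metric_triangle (decode z) (y (frozen z k)) c; have := decodeP z k.
  rewrite (metric_sym (decode z) (y _)); lra.
have [n hn] : exists n, h n < (r - mdist (decode z) c) / 4 by apply: h_small; lra.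
exists n; have := metric_triangle (y (frozen z n)) (decode z) c; have := decodeP z n; lra.
Qed.

Lemma decode_onto x : (forall e, 0 < e -> exists n, mdist x (y n) < e) ->
  exists z, decode z = x.
Proof.
move=> hx; have hz n : exists k, mdist x (y k) < h n / 4.
  by apply: hx; have := h_gt0 n; lra.
pose z : BS := fun n => projT1 (cid (hz n)).
have zP n : mdist x (y (z n)) < h n / 4 by exact: (projT2 (cid (hz n))).
have fz n : frozen z n = z n.
  elim: n => //= n ->; case: ifP => // /negP []; have := zP n; have := zP n.+1.
  have := metric_triangle (y (z n)) x (y (z n.+1)); rewrite (metric_sym (y (z n)) x).
  have := h_gt0 n; rewrite exprS; lra.
exists z; apply: mdist_positivity; apply/eqP; rewrite eq_le mdist_ge0 andbT.
apply/ler_addgt0Pr => e e0; rewrite add0r.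
have [n hn] : exists n, h n < e / 4 by apply: h_small; lra.
have := metric_triangle (decode z) (y (z n)) x; have := zP n; have := decodeP z n.
rewrite fz (metric_sym (decode z) (y _)) (metric_sym (y _) x); have := h_gt0 n; lra.
Qed.
End Limits.

Lemma separable_seq (R : realType) (X : metricType R) (x0 : X) : separable X ->
  exists p : nat -> X, forall x e, 0 < e -> exists n, mdist x (p n) < e.
Proof.
move=> [D [/countable_injP [f finj] dD]].
pose p n := if pselect (exists x, x \in D /\ f x = n) is left h
  then projT1 (cid h) else x0.
exists p => x e e0.
have [|//|y [/= xy Dy]] := dD (ball x e)^°%classic.
- exists x; exact: nbhsx_ballx.
- exact: open_interior.
exists (f y); rewrite /p; case: pselect => [h|[]]; last by exists y; rewrite inE.
have [h1 h2] := projT2 (cid h).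
rewrite (finj _ _ h1 _ h2) ?inE //.
by have := interior_subset xy; rewrite ballEmdist.
Qed.

End PolishCoding.

Module ClassicalFrame.
Import Order.TTheory GRing.Theory Num.Theory.
Import Definability Coding Balls BallGames CompleteMetrics ProjectiveSets PolishCoding.
Local Open Scope ring_scope.

Import metricType_numDomainType.

(** * The ambient logic as a definability frame *)

Section Classical.
Variable R : realType.

Lemma classical_dc T (P : T -> Prop) (r : T -> T -> Prop) :
  (exists x, P x) -> (forall x, P x -> exists2 y, P y & r x y) ->
  exists2 f : nat -> T, True & forall n, P (f n) /\ r (f n) (f n.+1).
Proof.
move=> [x0 Px0] hr.
have next (x : {x | P x}) : {y : {x | P x} | r (sval x) (sval y)}.
  by apply: cid; have [y Py xy] := hr _ (svalP x); exists (exist _ y Py).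
pose f := fix f n : {x | P x} := if n is k.+1 then sval (next (f k)) else exist _ x0 Px0.
exists (fun n => sval (f n)) => // n; split; [exact: svalP (f n) | exact: svalP (next (f n))].
Qed.

Lemma classical_lub (P : R -> Prop) : True -> (exists x, P x) ->
  (exists b, forall x, P x -> x <= b) ->
  exists2 b, forall x, P x -> x <= b & forall c, (forall x, P x -> x <= c) -> b <= c.
Proof.
move=> _ hP hb; exists (sup P) => [x Px|c hc]; last exact: ge_sup.
by apply: ub_le_sup.
Qed.

Lemma ltnS_or n m : (n < m.+1)%N <-> (n < m)%N \/ n = m.
Proof.
rewrite ltnS leq_eqVlt; split=> [/orP[/eqP ->|]|[->|->]]; rewrite ?eqxx ?orbT; auto.
Qed.

Definition cframe : frame.
Proof.
refine (@Frame (fun _ => unit) (fun _ _ _ => True) (fun _ _ _ _ => tt)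
  _ _ _ _ _ _ _ _ _ _ (fun _ _ => tt) _ (fun _ _ _ _ => tt) _
  nat tt 0%N succn (fun n m => (n < m)%N) _ _ _ _ ltnS_or _ R tt _ _ _ classical_lub).
all: try done.
- by move=> P _ P0 PS; elim.
- by move=> T _ P r _ _; exact: classical_dc.
Defined.

#[global] Instance csort (T : Type) : sort cframe T := tt.
Definition wrap S T (f : S -> T) : @Fn cframe S T _ _ := exist _ f I.
Lemma wrapK S T (f : @Fn cframe S T _ _) : wrap (fapp f) = f.
Proof. by case: f => f []. Qed.

Notation fr := cframe.
Notation nat' := (N fr).
Notation seqN := (@Fn fr nat' nat' _ _).

Lemma dbl_double (k : nat') : dbl k = (k.*2)%N :> nat.
Proof. by elim: k => [|k IH]; rewrite ?dbl0 // dblS IH. Qed.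

Lemma classical_pcode (u x : seqN) (n m : nat') : pcode u n = pcode x m ->
  mkseq u n = mkseq x m.
Proof.
by move=> /pcode_inj [<- h]; apply/eq_in_map => i; rewrite mem_iota => hi; apply: h.
Qed.

(** A strategy on finite sequences, transferred to codes; any run through the
    position that has the given code yields the same sequence. *)
Definition strategy (sigma : seq nat -> nat) : seqN := wrap (fun c : nat' =>
  if pselect (exists (p : seqN * nat'), pcode p.1 p.2 = c) is left h
  then sigma (mkseq (projT1 (cid h)).1 (projT1 (cid h)).2) else 0%N : nat').

Lemma strategyE sigma (x : seqN) (n : nat') :
  strategy sigma (pcode x n) = sigma (mkseq x n).
Proof.
rewrite /strategy /wrap /fapp /=; case: pselect => [h|[]]; last by exists (x, n).
by congr sigma; apply: classical_pcode; exact: (projT2 (cid h)).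
Qed.

Lemma determined_classical (P : seqN -> Prop) :
  Defs.determined (fun u : baire_space => P (wrap (u : nat' -> nat'))) -> determinedN P.
Proof.
case=> [[s hs]|[t ht]]; [left; exists (strategy s)|right; exists (strategy t)] => x hx.
  rewrite -(wrapK x); apply: (hs (fapp x)) => n; rewrite -strategyE => en.
  by have := hx n./2; rewrite dbl_double even_halfK.
rewrite -(wrapK x); apply: (ht (fapp x)) => n; rewrite -strategyE => on.
have e : n = (n./2.*2).+1 by rewrite -[LHS]odd_double_half on.
have h := hx n./2; rewrite dbl_double in h.
exact: (eq_ind_r (fun m : nat' => x m = strategy t (pcode x m)) h e).
Qed.
End Classical.

Section Space.
Context (R : realType) (X : metricType R) (p : nat -> X).
Notation fr := (cframe R).
Notation nat' := (N fr).
Notation seqN := (@Fn fr nat' nat' _ _).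
Hypothesis p_dense : forall x e, 0 < e -> exists n, mdist x (p n) < e.

Lemma mdist_eq0 (x y : X) : mdist x y = 0 <-> x = y.
Proof. by split=> [/mdist_positivity|->] //; exact: mdistxx. Qed.

Definition space : mspace fr := @MSpace fr X tt (@mdist R X) I mdist_eq0
  (@metric_sym _ X) (@metric_triangle _ X) (wrap R p) p_dense.

Lemma cont_space (f : X -> X) : continuous f -> @cont fr space (wrap R f).
Proof.
move=> hf x r r0.
have h : \forall t \near x, mdist (f x) (f t) < r by exact: cvgr_dist_lt (hf x) _ r0.
by move/nbhs_mdistP: h => [s /= s0 hs]; exists s.
Qed.

Lemma dense_seq_range (D : @Fn fr nat' X _ _) : @dense_seq fr space D ->
  countable (range (fapp D)) /\ dense (range (fapp D)).
Proof.
move=> hD; split.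
  by apply: card_le_trans (card_image_le _ _) _; exact: countableP.
move=> U [x Ux] oU; have /nbhs_mdistP [e /= e0 he] : nbhs x U by apply: open_nbhs_nbhs.
by have [n hn] := hD x e e0; exists (D n); split; [exact: he | exists n].
Qed.

Lemma cdh_space : countable_dense_homogeneous X -> cdh space.
Proof.
move=> [_ h] D E /dense_seq_range [cD dD] /dense_seq_range [cE dE].
have [f [[cf [g [cg fK gK]]] fDE]] := h _ _ cD dD cE dE.
exists (wrap R f), (wrap R g); split => //; try exact: cont_space.
split=> n.
  have : range (fapp E) (f (D n)) by rewrite -fDE; exists (D n) => //; exists n.
  by move=> [m _ e]; exists m.
have : (f @` range (fapp D))%classic (E n) by rewrite fDE; exists n.
by move=> [_ [m _ <-] e]; exists m.
Qed.

Lemma completely_metrizable_space :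
  completely_metrizable_in space -> completely_metrizable R X.
Proof.
move=> [rho [_ [h0 hC hT] hle hcont hcauchy]]; exists rho; split => //.
  move=> x; rewrite -filter_from_mdist_nbhs; apply/seteqP; split=> A [e /= e0 he].
    by exists e => // y xy; apply: he; exact: le_lt_trans (hle _ _) xy.
  have [s [s0 hs]] := hcont x e e0.
  by exists s => // y xy; apply: he; exact: hs.
move=> s hs; have [r r0|x hx] := hcauchy (wrap R (s : nat' -> X)).
  by have [n0 h] := hs r r0; exists n0 => m n; exact: h.
exists x; apply/cvgrPdist_lt => e e0; have [n0 h] := hx e e0.
by exists n0 => // n /= hn; apply: le_lt_trans (hle _ _) (h n hn).
Qed.

Section Payoffs.
Context (Y : metricType R) (i : X -> Y).
Hypothesis complete_Y : complete_space Y.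
Hypothesis i_iso : forall x y, mdist (i x) (i y) = mdist x y.
Hypothesis i_proj : projective (range i).
Notation EP := eventually_projective.
Notation y := (fun n => i (p n)).
Notation wr u := (wrap R (u : nat' -> nat') : seqN).
Notation st w u k := (stage w (evens (wr u)) (odds (wr u)) k).

Lemma lc_stage w k : locally_constant (fun u : BS => st w u k : nat').
Proof.
case: k => [|k].
  under [X in locally_constant X]funext do rewrite stage0.
  exact: lc_cst.
under [X in locally_constant X]funext do rewrite stageS.
exact: (lc_map (w : nat' * nat' -> nat')
  (lc_pair (@lc_coord (dbl (k : nat'))) (@lc_coord (S (dbl (k : nat')))))).
Qed.

(** The payoffs are written with quantifiers over numbers and names in front of locally
    constant conditions; the lookup of terms whose index is quantified is handled
    by [lc_pick]. *)
Lemma EP_legal v w : EP (fun u : BS => legal v w (evens (wr u)) (odds (wr u))).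
Proof.
refine (EP_alln (P := fun (u : BS) (k : nat) => elt (st w u k, evens (wr u) k) v) _).
apply: EP_lc.
apply: (lc_pick (F := fun k (q : BS * BS) => elt (st w q.1 k, evens (wr q.1) k) v)).
  exact: (lc_comp (@continuous_snd BS BS) (@lc_coord 0)).
move=> k; have h := lc_pair (lc_stage w k) (@lc_coord (dbl (k : nat'))).
exact: (lc_comp (@continuous_fst BS BS) (lc_map (fun t : nat' * nat' => elt t v) h)).
Qed.

Lemma EP_zero_tail : EP (fun u : BS => zero_tail (odds (wr u))).
Proof.
refine (EP_exn (P := fun (u : BS) (n : nat) =>
  forall k : nat, leN (n : nat') k -> odds (wr u) k = O) _).
refine (EP_alln (P := fun (q : BS * BS) (k : nat) =>
  leN (q.2 0%N : nat') k -> odds (wr q.1) k = O) _).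
apply: EP_lc.
apply: (lc_pick (F := fun k (q : BS * BS * BS) =>
  leN (q.1.2 0%N : nat') k -> odds (wr q.1.1) k = O)).
  exact: (lc_comp (@continuous_snd _ BS) (@lc_coord 0)).
move=> k.
have h1 := lc_comp (@continuous_snd BS BS) (@lc_coord 0).
have h2 := lc_comp (@continuous_fst BS BS) (@lc_coord (S (dbl (k : nat')))).
exact: (lc_comp (@continuous_fst _ BS)
  (lc_map (fun t : nat' * nat' => leN t.1 k -> t.2 = O) (lc_pair h1 h2))).
Qed.

(** A quantifier over the points of the space becomes one over names of points of its
    completion, which is where the projective set [range i] enters. *)
Lemma common_point_decode (s : nat' -> nat') : common_point space s <-> exists z,
  range i (decode y complete_Y z) /\ forall k : nat, exists j : nat,
    s k = O \/ mdist (y (frozen y z j)) (i (cen space (s k))) <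
               rad (s k) - 2 * 2^-1 ^+ j.
Proof.
split=> [[x hx]|[z [[x _ xz] hz]]].
  have [|z hz] := @decode_onto R Y y complete_Y (i x).
    by move=> e /(p_dense x) [n]; exists n; rewrite i_iso.
  exists z; split=> [|k]; first by exists x.
  case: (hx k) => [->|h]; first by exists 0%N; left.
  have : mdist (decode y complete_Y z) (i (cen space (s k))) < rad (s k).
    by rewrite hz i_iso.
  by move/decode_near => [j hj]; exists j; right.
exists x => k; have [j [->|h]] := hz k; [by left | right].
rewrite /= -i_iso xz; apply/decode_near; by exists j.
Qed.

Lemma EP_common_point w : EP (fun u : BS => common_point space (fun k => st w u k)).
Proof.
have -> : (fun u : BS => common_point space (fun k => st w u k)) = (fun u : BS => exists z,
  range i (decode y complete_Y z) /\ forall k : nat, exists j : nat,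
    st w u k = O \/ mdist (y (frozen y z j)) (i (cen space (st w u k))) <
               rad (st w u k) - 2 * 2^-1 ^+ j).
  by apply/funext => u; apply/propext; exact: common_point_decode.
apply: EP_ex; apply: EP_and.
  have := projective_EP (@perfect_metric _ Y) i_proj.
  apply: EP_preimage; apply: continuous_comp_fun (@continuous_snd _ _) _.
  exact: decode_continuous.
apply: (EP_alln (P := fun (q : BS * BS) (k : nat) => exists j : nat,
  st w q.1 k = O \/ mdist (y (frozen y q.2 j)) (i (cen space (st w q.1 k))) <
               rad (st w q.1 k) - 2 * 2^-1 ^+ j)).
apply: (EP_exn (P := fun (q : BS * BS * BS) (j : nat) =>
  st w q.1.1 (q.2 0%N) = O \/ mdist (y (frozen y q.1.2 j))
   (i (cen space (st w q.1.1 (q.2 0%N)))) < rad (st w q.1.1 (q.2 0%N)) - 2 * 2^-1 ^+ j)).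
apply: EP_lc.
apply: (lc_pick (F := fun j (q : BS * BS * BS * BS) =>
  st w q.1.1.1 (q.1.2 0%N) = O \/ mdist (y (frozen y q.1.1.2 j))
   (i (cen space (st w q.1.1.1 (q.1.2 0%N)))) <
     rad (st w q.1.1.1 (q.1.2 0%N)) - 2 * 2^-1 ^+ j)).
  exact: (lc_comp (@continuous_snd _ BS) (@lc_coord 0)).
move=> j; apply: (lc_comp (@continuous_fst (BS * BS * BS)%type BS)
  (f := fun q : BS * BS * BS => st w q.1.1 (q.2 0%N) = O \/
   mdist (y (frozen y q.1.2 j)) (i (cen space (st w q.1.1 (q.2 0%N)))) <
     rad (st w q.1.1 (q.2 0%N)) - 2 * 2^-1 ^+ j)).
apply: (lc_pick (F := fun k (q : BS * BS * BS) => st w q.1.1 k = O \/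
   mdist (y (frozen y q.1.2 j)) (i (cen space (st w q.1.1 k))) <
     rad (st w q.1.1 k) - 2 * 2^-1 ^+ j)).
  exact: (lc_comp (@continuous_snd _ BS) (@lc_coord 0)).
move=> k.
have h1 := lc_comp (@continuous_fst BS BS) (lc_stage w k).
have h2 := lc_comp (@continuous_snd BS BS) (frozen_lc y j).
exact: (lc_comp (@continuous_fst _ BS)
  (lc_map (fun t : nat' * nat => t.1 = O \/ mdist (y t.2) (i (cen space t.1)) <
     rad t.1 - 2 * 2^-1 ^+ j) (lc_pair h1 h2))).
Qed.

Lemma ball_games_determined_space : projective_determinacy -> ball_games_determined space.
Proof.
move=> PD v w; split; apply: determined_classical; apply: PD; apply: EP_projective;
  (apply: EP_and; first exact: EP_legal).
- by apply: EP_not; exact: EP_common_point.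
- exact: EP_common_point.
- by apply: EP_iff; [exact: EP_zero_tail | exact: EP_common_point].
Qed.
End Payoffs.
End Space.

Theorem projective_cdh_completely_metrizable : projective_determinacy ->
  forall (R : realType) (X : metricType R),
    separable X -> projective_metric_space X -> countable_dense_homogeneous X ->
    completely_metrizable R X.
Proof.
move=> PD R X sX [Y [i [cY iso _ iproj]]] hX.
case: (pselect (exists x : X, True)) => [[x0 _]|hE]; last first.
  (* the empty space *)
  exists (fun _ _ => 0); split=> [x|x|x|x|s]; by case: hE; first [exists x | exists (s 0%N)].
have [p hp] := separable_seq x0 sX.
apply: (completely_metrizable_space (p_dense := hp)).
apply: cdh_completely_metrizable; last exact: cdh_space.
exact: (ball_games_determined_space hp cY iso iproj PD).
Qed.

End ClassicalFrame.

Theorem corollary2p7 :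
  (projective_determinacy ->
   forall (R : realType) (X : metricType R),
     separable X -> projective_metric_space X -> countable_dense_homogeneous X ->
     completely_metrizable R X)
  /\
  (forall M : ST.structure,
     ST.ZF M -> ST.DC M -> ST.AD M ->
     forall (R : ST.real_line M) (X d : ST.domain M),
       ST.is_metric R X d -> ST.separable R X d ->
       ST.countable_dense_homogeneous R X d ->
       ST.completely_metrizable R X d).
Proof.
split; first exact: ClassicalFrame.projective_cdh_completely_metrizable.
exact: ModelSpaces.model_cdh_completely_metrizable.
Qed.
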